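(* Let $d\ge 1$, $\mathcal D=\{1,\dots,d\}$, and suppose that for every $j=1,\dots,d$ the pair of weight functions $(\rho_j,\psi_j)$ satisfies $$\int_{-\infty}^{c} \frac{\Phi_j(t)}{\psi_j(t)}\,dt<\infty\quad\text{and}\quad \int_c^\infty \frac{1-\Phi_j(t)}{\psi_j(t)}\,dt<\infty\quad\text{for all finite } c .$$ Then the spaces $\mathcal H_d$ and $\mathcal W_d$ are equivalent (they coincide as sets and have equivalent norms), and for all $f$ in this common space $$\|f\|_{\mathcal W_d}^2\;\le\;\|f\|_{\mathcal H_d}^2\;\le\;\Bigg(\max_{\mathfrak v\subseteq\mathcal D}\ \sum_{\mathfrak w\subseteq\mathfrak v}\frac{\gamma_{\mathfrak v}}{\gamma_{\mathfrak v\setminus\mathfrak w}}\prod_{j\in\mathfrak w}C(\rho_j,\psi_j)\Bigg)\,\|f\|_{\mathcal W_d}^2,$$ where $$C(\rho_j,\psi_j)=\int_{-\infty}^\infty\frac{\Phi_j(t)\,(1-\Phi_j(t))}{\psi_j(t)}\,dt .$$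
   Context: Let $\mathcal D=\{1,\dots,d\}$. For each $j\in\mathcal D$, $\rho_j:\mathbb R\to(0,\infty)$ is a strictly positive probability density function with distribution function $\Phi_j(x)=\int_{-\infty}^x\rho_j(t)\,dt$, and $\psi_j:\mathbb R\to(0,\infty)$ is a strictly positive locally integrable function such that $1/\psi_j$ is also locally integrable. For each $\mathfrak u\subseteq\mathcal D$ there is a weight parameter $\gamma_{\mathfrak u}>0$. Write $\boldsymbol x_{\mathfrak u}=(x_j)_{j\in\mathfrak u}$, $\boldsymbol\psi_{\mathfrak u}(\boldsymbol x_{\mathfrak u})=\prod_{j\in\mathfrak u}\psi_j(x_j)$, $\boldsymbol\rho_{\mathcal D\setminus\mathfrak u}(\boldsymbol x_{\mathcal D\setminus\mathfrak u})=\prod_{j\in\mathcal D\setminus\mathfrak u}\rho_j(x_j)$. Empty products equal $1$. $\partial^{\mathfrak u}f=\prod_{j\in\mathfrak u}\frac{\partial}{\partial x_j}f$ denotes the first-order mixed weak derivative: the locally integrable function with $\int_{\mathbb R^d}\partial^{\mathfrak u}f\,v\,d\boldsymbol x=(-1)^{|\mathfrak u|}\int_{\mathbb R^d}f\,\partial^{\mathfrak u}v\,d\boldsymbol x$ for all $v\in C_0^\infty(\mathbb R^d)$. $\mathcal H_d$ and $\mathcal W_d$ consist of the locally integrable functions $f$ on $\mathbb R^d$ (identified when equal almost everywhere) for which, respectively, the following norms are finite: $$\|f\|_{\mathcal H_d}^2=\sum_{\mathfrak u\subseteq\mathcal D}\frac1{\gamma_{\mathfrak u}}\int_{\mathbb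 R^d}|\partial^{\mathfrak u}f(\boldsymbol x)|^2\,\boldsymbol\psi_{\mathfrak u}(\boldsymbol x_{\mathfrak u})\,\boldsymbol\rho_{\mathcal D\setminus\mathfrak u}(\boldsymbol x_{\mathcal D\setminus\mathfrak u})\,d\boldsymbol x,$$ $$\|f\|_{\mathcal W_d}^2=\sum_{\mathfrak u\subseteq\mathcal D}\frac1{\gamma_{\mathfrak u}}\int_{\mathbb R^{|\mathfrak u|}}\bigg|\int_{\mathbb R^{d-|\mathfrak u|}}\partial^{\mathfrak u}f(\boldsymbol x_{\mathfrak u},\boldsymbol x_{\mathcal D\setminus\mathfrak u})\,\boldsymbol\rho_{\mathcal D\setminus\mathfrak u}(\boldsymbol x_{\mathcal D\setminus\mathfrak u})\,d\boldsymbol x_{\mathcal D\setminus\mathfrak u}\bigg|^2\boldsymbol\psi_{\mathfrak u}(\boldsymbol x_{\mathfrak u})\,d\boldsymbol x_{\mathfrak u}.$$ Finiteness is understood to require that the weak derivatives $\partial^{\mathfrak u}f$, $\mathfrak u\subseteq\mathcal D$, exist and that the inner integrals are well defined as (absolutely convergent) Lebesgue integrals for almost all $\boldsymbol x_{\mathfrak u}$; in particular $f\in\mathcal W_d$ implies $\int_{\mathbb R^d}|f|\prod_j\rho_j(x_j)\,d\boldsymbol x<\infty$. *)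

(* Defs.v *)
From HB Require Import structures.
From mathcomp Require Import all_boot all_order all_algebra.
From mathcomp Require Import all_classical all_reals all_analysis.

Set Implicit Arguments.
Unset Strict Implicit.
Unset Printing Implicit Defensive.

Import Order.TTheory GRing.Theory Num.Theory.
Import numFieldNormedType.Exports.

Local Open Scope classical_set_scope.
Local Open Scope ring_scope.

(* The Borel sigma-algebra of R^n = 'rV[R]_n, generated by the coordinates,
   as for n.-tuple T. An almost everywhere class of Lebesgue measurable
   functions always contains a Borel one, so using Borel functions throughout
   loses nothing. *)
Section measurable_rV.
Context {R : realType} {n : nat}.

Definition coordV (i : 'I_n) (x : 'rV[R]_n) : R := x 0 i.

Let rV_set0 : g_sigma_preimage coordV set0.
Proof. exact: sigma_algebra0. Qed.

Let rV_setC A : g_sigma_preimage coordV A -> g_sigma_preimage coordV (~` A).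
Proof. exact: sigma_algebraC. Qed.

Let rV_bigcup (F : (set 'rV[R]_n)^nat) :
  (forall i, g_sigma_preimage coordV (F i)) ->
  g_sigma_preimage coordV (\bigcup_i (F i)).
Proof. exact: sigma_algebra_bigcup. Qed.

HB.instance Definition _ := @isMeasurable.Build
  (measure_tuple_display default_measure_display)
  'rV[R]_n (g_sigma_preimage coordV) rV_set0 rV_setC rV_bigcup.

Lemma measurable_coordV i : measurable_fun setT (coordV i).
Proof.
move=> _ Y mY; rewrite setTI; apply: sub_sigma_algebra => /=.
rewrite -bigcup_seq/=; exists i => /=; first by rewrite mem_index_enum.
by exists Y => //; rewrite setTI.
Qed.

Lemma measurable_fun_rV d (T : measurableType d) (f : T -> 'rV[R]_n) :
  (forall i, measurable_fun setT (coordV i \o f)) -> measurable_fun setT f.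
Proof.
move=> mf.
have fE : g_sigma_preimage (fun i => coordV i \o f) =
    preimage_set_system setT f measurable by exact: g_sigma_preimage_comp.
move=> _ Y mY.
have : g_sigma_preimage (fun i => coordV i \o f) (setT `&` f @^-1` Y).
  by rewrite fE; exists Y.
apply: smallest_sub; first exact: sigma_algebra_measurable.
rewrite -bigcup_seq => A [i _] [B mB <-]; exact: mf.
Qed.

End measurable_rV.

Section lebesgueV.
Context {R : realType}.

Definition consV {n : nat} (p : measurableTypeR R * 'rV[R]_n) : 'rV[R]_n.+1 :=
  row_mx (p.1%:M : 'rV[R]_1) p.2.

Lemma coordV_cons0 n (p : R * 'rV[R]_n) : coordV ord0 (consV p) = p.1.
Proof.
by rewrite /coordV /consV mxE; case: splitP => // j _; rewrite ord1 mxE mulr1n.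
Qed.

Lemma coordV_consS n (p : R * 'rV[R]_n) i :
  coordV (lift ord0 i) (consV p) = p.2 0 i.
Proof.
rewrite /coordV /consV mxE; case: splitP => [j|j /= /eqP].
  by rewrite ord1 => /eqP; rewrite eqE.
by rewrite /bump leq0n eqSS => /eqP/val_inj ->.
Qed.

Lemma measurable_consV n : measurable_fun setT (@consV n).
Proof.
apply: measurable_fun_rV => i; case: (unliftP ord0 i) => [j ->|->].
- rewrite (_ : _ \o _ = coordV j \o snd); last first.
    by apply/funext => p /=; rewrite coordV_consS.
  by apply: measurableT_comp => //; exact: measurable_coordV.
- rewrite (_ : _ \o _ = fst) //.
  by apply/funext => p /=; rewrite coordV_cons0.
Qed.

Section step.
Variables (n : nat) (m : {sigma_finite_measure set 'rV[R]_n -> \bar R}).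

Definition lebesgueS (A : set 'rV[R]_n.+1) : \bar R :=
  (lebesgue_measure \x m)%E (@consV n @^-1` A).

Let lebesgueS0 : lebesgueS set0 = 0%E.
Proof. by rewrite /lebesgueS preimage_set0 measure0. Qed.

Let lebesgueS_ge0 A : (0 <= lebesgueS A)%E.
Proof. exact: measure_ge0. Qed.

Let mcons A : measurable A -> measurable (@consV n @^-1` A).
Proof. by move=> mA; rewrite -[X in measurable X]setTI; exact: measurable_consV. Qed.

Let lebesgueS_sigma_additive : semi_sigma_additive lebesgueS.
Proof.
move=> F mF tF mUF; rewrite /lebesgueS preimage_bigcup.
apply: measure_semi_sigma_additive.
- by move=> k; exact: mcons.
- apply/trivIsetP => /= i j _ _ ij; rewrite -preimage_setI.
  by move/trivIsetP : tF => /(_ _ _ _ _ ij) ->//; rewrite preimage_set0.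
- by rewrite -preimage_bigcup; exact: mcons.
Qed.

HB.instance Definition _ := isMeasure.Build _ _ _ lebesgueS
  lebesgueS0 lebesgueS_ge0 lebesgueS_sigma_additive.

Let lebesgueS_sigma_finite : sigma_finite setT lebesgueS.
Proof.
have [F TF Foo] : sigma_finite setT (@lebesgue_measure R \x m)%E.
  have /sigma_finiteP[F [TF ndF Foo]] := sigma_finiteT (@lebesgue_measure R).
  have /sigma_finiteP[G [TG ndG Goo]] := sigma_finiteT m.
  exists (fun k => F k `*` G k).
    rewrite -setXTT TF TG predeqE => -[x y]; split.
      move=> [/= [i _ Fix] [k _ Gky]]; exists (maxn i k) => //; split.
      - by move: x Fix; exact/subsetPset/ndF/leq_maxl.
      - by move: y Gky; exact/subsetPset/ndG/leq_maxr.
    by move=> [i _ []/= ? ?]; split; exists i.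
  move=> k; have [? ?] := Foo k; have [? ?] := Goo k.
  split; first exact: measurableX.
  by rewrite product_measure1E// lte_mul_pinfty// ge0_fin_numE.
pose un (x : 'rV[R]_n.+1) : measurableTypeR R * 'rV[R]_n :=
  (coordV ord0 x, \row_i coordV (lift ord0 i) x).
have unK : cancel un (@consV n).
  move=> x; apply/rowP => i; rewrite -[LHS]/(coordV i (consV (un x))).
  case: (unliftP ord0 i) => [j ->|->]; last by rewrite coordV_cons0.
  by rewrite coordV_consS mxE.
have consK : cancel (@consV n) un.
  move=> [t x]; rewrite /un; congr pair; first by rewrite coordV_cons0.
  by apply/rowP => i; rewrite mxE coordV_consS.
have mun : measurable_fun setT un.
  apply/measurable_fun_pairP; split; first exact: measurable_coordV.
  apply: measurable_fun_rV => i.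
  rewrite (_ : _ \o _ = coordV (lift ord0 i)); first exact: measurable_coordV.
  by apply/funext => x /=; rewrite /coordV mxE.
exists (fun k => un @^-1` F k).
  by rewrite -preimage_bigcup -TF preimage_setT.
move=> k; have [mF Fk] := Foo k; split.
  by rewrite -[X in measurable X]setTI; exact: mun.
rewrite /lebesgueS -comp_preimage (_ : un \o _ = idfun) //.
by apply/funext => p /=; rewrite consK.
Qed.

HB.instance Definition _ :=
  Measure_isSigmaFinite.Build _ _ _ lebesgueS lebesgueS_sigma_finite.

End step.

(* The Lebesgue measure on R^n, as an iterated product; R^0 is a point of mass 1. *)
Fixpoint lebesgueV (n : nat) : {sigma_finite_measure set 'rV[R]_n -> \bar R} :=
  match n with
  | 0 => \d_(0 : 'rV[R]_0)
  | n'.+1 => lebesgueS (lebesgueV n')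
  end.

Lemma lebesgueV_box n (A : 'I_n -> set R) : (forall i, measurable (A i)) ->
  lebesgueV n [set x | forall i, A i (x 0 i)] =
  (\prod_(i < n) lebesgue_measure (A i))%E.
Proof.
elim: n A => [|n ih] A mA.
  rewrite big_ord0 /= diracE mem_set//= => i; by case: i.
rewrite big_ord_recl -ih//= /lebesgueS.
rewrite (_ : _ @^-1` _ = (A ord0 : set (measurableTypeR R)) `*`
    [set x : 'rV[R]_n | forall i, A (lift ord0 i) (x 0 i)]).
  rewrite product_measure1E//; first exact: mA.
  rewrite (_ : mkset _ = \bigcap_(i in [set: 'I_n])
      (coordV i @^-1` A (lift ord0 i))).
    apply: fin_bigcap_measurable => // i _.
    by rewrite -[X in measurable X]setTI; exact: measurable_coordV.
  by apply/seteqP; split=> [x Ax i _|x Ax i]; [exact: Ax|exact: (Ax i)].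
apply/seteqP; split=> [p Ap|p [Ap0 Ap] i]; last first.
  case: (unliftP ord0 i) => [j ->|->].
    by rewrite -[_ 0 _]/(coordV _ _) coordV_consS; exact: Ap.
  by rewrite -[_ 0 _]/(coordV _ _) coordV_cons0.
split=> [|i] /=; first by have := Ap ord0; rewrite -[_ 0 _]/(coordV _ _) coordV_cons0.
by have := Ap (lift ord0 i); rewrite -[_ 0 _]/(coordV _ _) coordV_consS.
Qed.

End lebesgueV.

Section weak_derivatives.
Context {R : realType} {n : nat}.
Implicit Types (f g v : 'rV[R]_n -> R) (u : {set 'I_n}).

Definition locally_integrableV f := measurable_fun setT f /\
  forall K, compact K -> (\int[lebesgueV n]_(x in K) `|f x|%:E < +oo)%E.

(* Iterated classical partial derivative along the directions listed in s. *)
Definition partials (s : seq 'I_n) v : 'rV[R]_n -> R :=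
  foldr (fun j g x => 'D_(delta_mx 0 j) g x) v s.

Definition smooth v := forall s : seq 'I_n, continuous (partials s v) /\
  forall j x, derivable (partials s v) x (delta_mx 0 j).

Definition test_function v :=
  smooth v /\ compact (closure [set x | v x != 0]).

Definition is_weak_derivative u f g := locally_integrableV g /\
  forall v, test_function v ->
    \int[lebesgueV n]_x (g x * v x) =
    (-1) ^+ #|u| * \int[lebesgueV n]_x (f x * partials (enum u) v x).

(* A representative of the almost everywhere unique weak derivative, when it
   exists, and 0 otherwise. *)
Definition weak_derivative u f : 'rV[R]_n -> R :=
  xget (cst 0) [set g | is_weak_derivative u f g].

Definition has_weak_derivatives f :=
  forall u, exists g, is_weak_derivative u f g.

(* spreadV u places the coordinates of a vector of R^|u| at the positions in u
   (in increasing order) and 0 elsewhere; mergeV u y z is (x_u, x_{D \ u}). *)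
Definition spreadV u (y : 'rV[R]_#|u|) : 'rV[R]_n :=
  \sum_(k < #|u|) y 0 k *: delta_mx 0 (enum_val k).

Definition mergeV u (y : 'rV[R]_#|u|) (z : 'rV[R]_#|~: u|) : 'rV[R]_n :=
  spreadV y + spreadV z.

Definition weight_prod (w : 'I_n -> R -> R) u (x : 'rV[R]_n) : R :=
  \prod_(j in u) w j (x 0 j).

End weak_derivatives.

Section weights.
Context {R : realType}.
Implicit Types rho psi : R -> R.

Definition positive_density rho := [/\ measurable_fun setT rho,
  forall x, 0 < rho x & (\int[lebesgue_measure]_x (rho x)%:E = 1)%E].

Definition density_cdf rho (x : R) : R :=
  \int[lebesgue_measure]_(t in `]-oo, x]) rho t.

Definition positive_weight psi := [/\ forall x, 0 < psi x,
  locally_integrable setT psi & locally_integrable setT (fun x => (psi x)^-1)].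

Definition embedding_condition rho psi := forall c : R,
  (\int[lebesgue_measure]_(t in `]-oo, c])
      (density_cdf rho t / psi t)%:E < +oo)%E /\
  (\int[lebesgue_measure]_(t in `[c, +oo[)
      ((1 - density_cdf rho t) / psi t)%:E < +oo)%E.

Definition embedding_const rho psi : \bar R :=
  (\int[lebesgue_measure]_t
     (density_cdf rho t * (1 - density_cdf rho t) / psi t)%:E)%E.

End weights.

Section spaces.
Context {R : realType} {d : nat}.
Variables (rho psi : 'I_d -> R -> R) (gamma : {set 'I_d} -> R).
Implicit Types (u : {set 'I_d}) (f : 'rV[R]_d -> R).

Definition H_norm2 f : \bar R :=
  (\sum_(u : {set 'I_d}) (gamma u)^-1%:E * \int[lebesgueV d]_x
    (`|weak_derivative u f x| ^+ 2 *
       weight_prod psi u x * weight_prod rho (~: u) x)%:E)%E.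

Definition H_norm f : R := Num.sqrt (fine (H_norm2 f)).

(* H_space and W_space are sets of functions, each stable under almost
   everywhere equality. *)
Definition H_space : set ('rV[R]_d -> R) := [set f |
  [/\ locally_integrableV f, has_weak_derivatives f & (H_norm2 f < +oo)%E]].

Definition W_integrand u f (y : 'rV[R]_#|u|) (z : 'rV[R]_#|~: u|) : R :=
  weak_derivative u f (mergeV y z) * weight_prod rho (~: u) (mergeV y z).

Definition W_norm2 f : \bar R :=
  (\sum_(u : {set 'I_d}) (gamma u)^-1%:E * \int[lebesgueV #|u|]_y
    (`|(\int[lebesgueV #|~: u|]_z W_integrand f y z)%R| ^+ 2 *
       weight_prod psi u (spreadV y))%:E)%E.

Definition W_norm f : R := Num.sqrt (fine (W_norm2 f)).

(* The third clause asks for absolute convergence of the inner integrals of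
   W_norm2; for u = set0 it says that f * prod_j rho_j is integrable. *)
Definition W_space : set ('rV[R]_d -> R) := [set f |
  [/\ locally_integrableV f, has_weak_derivatives f,
      forall u, {ae lebesgueV #|u|, forall y,
        (lebesgueV #|~: u|).-integrable setT (EFin \o W_integrand f y)} &
      (W_norm2 f < +oo)%E]].

Definition equivalence_const : \bar R :=
  (\big[maxe/-oo]_(v : {set 'I_d}) \sum_(w : {set 'I_d} | w \subset v)
    (gamma v / gamma (v :\: w))%:E *
    \prod_(j in w) embedding_const (rho j) (psi j))%E.

End spaces.

(* Main.v *)
Require Import Defs.
From HB Require Import structures.
From mathcomp Require Import all_boot all_order all_algebra.
From mathcomp Require Import all_classical all_reals all_analysis.
From mathcomp Require Import measurable_realfun ring lra.

(** Write F_v(x_v) for the average of the weak derivative D^v f against rho over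
    the variables outside v, and kappa_j(x, t) = Phi_j(t) - 1(x <= t), so that
    h(x) - int h rho_j = int kappa_j(x, t) h'(t) dt. Applying this in each
    variable outside u gives the ANOVA expansion
      D^u f = sum_(w <= ~u) T_(u,w),
      T_(u,w)(x) = int F_(u+w)(x_u, t_w) prod_(j in w) kappa_j(x_j, t_j) dt_w.
    The terms are orthogonal in L^2(psi_u rho_(~u)), because kappa_j(., t) has
    mean zero for rho_j, and Cauchy-Schwarz bounds the squared norm of T_(u,w)
    by prod_(j in w) C(rho_j, psi_j) times that of F_(u+w). Summing over u and
    grouping by v = u+w gives the upper bound; the lower bound is the
    Cauchy-Schwarz estimate of the single term w = empty.

    The expansion is proved by downward induction on u, without absolutely
    continuous representatives. Tested against boxes, D^u f and the sum of the
    T_(u,w) satisfy the same integrated-by-parts identity in every direction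
    outside u, so their difference depends only on x_u almost everywhere; and its
    average over the other variables vanishes. *)

Set Implicit Arguments.
Unset Strict Implicit.
Unset Printing Implicit Defensive.

Import Order.TTheory GRing.Theory Num.Theory.
Import numFieldNormedType.Exports.

Local Open Scope classical_set_scope.
Local Open Scope ring_scope.

(** * Integration on the space of row vectors *)

(** Partial integrations become an exchange of coordinates on R^n x R^n; [mergeV] enters only in the
    comparison with the W-norm.

    Two obstacles shape the expansion. Weak derivatives only see smooth compactly supported
    functions, so integrating by parts in direction j requires a factor phi(x_j) whose primitive has
    compact support; hence phi is a combination of two indicators with integral 0. Such tests leave
    a function of the other variables undetermined, which the average against rho fixes. Moreover
    rho and psi may come arbitrarily close to 0 on compact sets, so weighted integrability is not
    local integrability. Testing T_(u,w) against boxes rests on the local integrability of 1/psi_j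
    and on a bound of int kappa_j(x, t)^2 / psi_j(t) dt uniform for x in a compact interval, which
    the embedding condition gives.

    C is the rho-average of that integral, because int kappa_j(x, t)^2 rho_j(x) dx = Phi_j(t) (1 -
    Phi_j(t)). *)

Section change_of_variables.
Local Open Scope ereal_scope.
Context d1 d2 (X : measurableType d1) (Y : measurableType d2) (R : realType).
Variables (phi : X -> Y) (mphi : measurable_fun setT phi).
Variables (m1 : {measure set X -> \bar R}) (m2 : {measure set Y -> \bar R}).
Hypothesis m12 : forall A, measurable A -> m2 A = m1 (phi @^-1` A).

Lemma ge0_integral_image (g : Y -> \bar R) :
  measurable_fun setT g -> (forall y, 0 <= g y) ->
  \int[m2]_y g y = \int[m1]_x g (phi x).
Proof.
move=> mg g0; transitivity (\int[pushforward m1 phi]_y g y).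
  by apply: eq_measure_integral => // A mA _; exact: m12.
by rewrite ge0_integral_pushforward.
Qed.

Lemma integrable_image (g : Y -> \bar R) : measurable_fun setT g ->
  m1.-integrable setT (g \o phi) -> m2.-integrable setT g.
Proof.
move=> mg /integrableP[_ gi]; apply/integrableP; split => //.
by rewrite ge0_integral_image//; exact: measurableT_comp.
Qed.

Lemma integral_image (g : Y -> \bar R) : measurable_fun setT g ->
  \int[m2]_y g y = \int[m1]_x g (phi x).
Proof.
move=> mg; rewrite [LHS]integralE [RHS]integralE.
rewrite (ge0_integral_image (measurable_funepos mg))//.
by rewrite (ge0_integral_image (measurable_funeneg mg))//; congr (_ + - _);
  apply: eq_integral => x _; rewrite ?(funepos_comp g phi) ?(funeneg_comp g phi).
Qed.

End change_of_variables.

Section lebesgueV_integration.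
Context {R : realType}.
Local Open Scope ereal_scope.

Lemma ge0_integral_lebesgueVS n (g : 'rV[R]_n.+1 -> \bar R) :
  measurable_fun setT g -> (forall x, 0 <= g x) ->
  \int[lebesgueV n.+1]_x g x =
  \int[lebesgue_measure]_t \int[lebesgueV n]_x g (consV (t, x)).
Proof.
move=> mg g0.
rewrite (@ge0_integral_image _ _ _ _ _ _ (@measurable_consV R n)
  (lebesgue_measure \x lebesgueV n))//.
rewrite fubini_tonelli1//.
by apply: measurableT_comp => //; exact: measurable_consV.
Qed.

Lemma measurable_comp_coordV n (h : R -> R) (i : 'I_n) :
  measurable_fun setT h -> measurable_fun setT (fun x : 'rV[R]_n => h (x 0%R i)).
Proof. by move=> mh; apply: (measurableT_comp mh); exact: measurable_coordV. Qed.

Lemma ge0_integral_prodV n (h : 'I_n -> R -> R) :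
  (forall i, measurable_fun setT (h i)) -> (forall i t, (0 <= h i t)%R) ->
  \int[lebesgueV n]_x (\prod_(i < n) h i (x 0%R i))%:E =
  \prod_(i < n) \int[lebesgue_measure]_t (h i t)%:E.
Proof.
elim: n h => [|n ih] h mh h0.
  rewrite big_ord0 /=; under eq_integral do rewrite big_ord0.
  by rewrite integral_dirac//= diracE mem_set// mul1e.
rewrite ge0_integral_lebesgueVS; last 2 first.
- apply/measurable_EFinP; apply: measurable_prod => i _.
  exact: measurable_comp_coordV.
- by move=> x; rewrite lee_fin prodr_ge0.
rewrite big_ord_recl -ge0_integralZr//; last 3 first.
- by apply/measurable_EFinP; exact: mh.
- by move=> t _; rewrite lee_fin.
- by apply: prode_ge0 => i _; apply: integral_ge0 => t _; rewrite lee_fin.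
apply: eq_integral => t _; rewrite -ih// -ge0_integralZl//=.
- apply: eq_integral => x _; rewrite big_ord_recl EFinM.
  rewrite -[_ 0%R ord0]/(coordV _ _) coordV_cons0; congr (_ * _%:E).
  by apply: eq_bigr => i _; rewrite -[_ 0%R (lift _ _)]/(coordV _ _) coordV_consS.
- apply/measurable_EFinP; apply: measurable_prod => i _.
  exact: measurable_comp_coordV.
- by move=> x _; rewrite lee_fin prodr_ge0.
- by rewrite lee_fin.
Qed.

Definition boxV n (A : 'I_n -> set R) : set 'rV[R]_n :=
  [set x | forall i, A i (x 0%R i)].

Lemma measurable_boxV n (A : 'I_n -> set R) :
  (forall i, measurable (A i)) -> measurable (boxV A).
Proof.
move=> mA; rewrite (_ : boxV A = \bigcap_(i in [set: 'I_n]) (coordV i @^-1` A i)).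
  apply: fin_bigcap_measurable => // i _.
  by rewrite -[X in measurable X]setTI; exact: measurable_coordV.
by apply/seteqP; split=> [x Ax i _|x Ax i]; [exact: Ax|exact: (Ax i)].
Qed.

Lemma indic_boxV n (A : 'I_n -> set R) (x : 'rV[R]_n) :
  \1_(boxV A) x = (\prod_(i < n) \1_(A i) (x 0 i))%R :> R.
Proof.
have [xA|xA] := pselect (boxV A x).
  rewrite indicE mem_set// big1// => i _; rewrite indicE mem_set//; exact: xA.
rewrite indicE memNset//; have [i xi] : exists i, ~ A i (x 0%R i).
  by apply/not_existsP => h; apply: xA => i; apply: contrapT; exact: h.
by rewrite (bigD1 i)//= indicE memNset// mul0r.
Qed.

Definition oitv (I : set R) := exists a b : R, I = `]a, b[%classic.

(** Bounded open intervals generate the Borel sets because each half-open generator ]a, b] is the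
    intersection of the intervals ]a, b + 1/(k+1)[. *)
Lemma measurableR_oitv : @measurable _ R = <<s oitv >>.
Proof.
apply/seteqP; split; last first.
  apply: smallest_sub; first exact: sigma_algebra_measurable.
  by move=> _ [a [b ->]]; exact: measurable_itv.
have so : sigma_algebra setT <<s oitv >> by exact: smallest_sigma_algebra.
apply: smallest_sub => //.
move=> _ [[a b] /= _ <-].
rewrite (_ : `]a, b]%classic =
    \bigcap_k `]a, (b + k.+1%:R^-1)%R[%classic).
  apply: (@bigcapT_measurable _ (g_sigma_algebraType oitv)) => k.
  by apply: sub_sigma_algebra; exists a, (b + k.+1%:R^-1)%R.
apply/seteqP; split=> [x /=|x abx /=].
  rewrite in_itv/= => /andP[ax xb] k _ /=.
  by rewrite in_itv/= ax/= (le_lt_trans xb)// ltrDl.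
have := abx 0%N I; rewrite /= !in_itv/= => /andP[-> _] /=.
have : `]-oo, b]%classic x.
  rewrite (itvNycEbigcap true) => k _ /=.
  by have := abx k I; rewrite /= !in_itv/= => /andP[].
by rewrite /= in_itv.
Qed.

(** Open boxes are stable under intersection, generate the sigma-algebra and contain an exhausting
    sequence of cubes of finite measure, so the uniqueness theorem for pi-systems applies.
    Identities between measures, for an exchange of coordinates or for a density, are thereby
    reduced to boxes. *)
Lemma boxV_measure_unique n (m1 m2 : {measure set 'rV[R]_n -> \bar R}) :
  (forall a b : 'I_n -> R, m1 (boxV (fun i => `]a i, b i[%classic)) < +oo) ->
  (forall a b : 'I_n -> R, m1 (boxV (fun i => `]a i, b i[%classic)) =
     m2 (boxV (fun i => `]a i, b i[%classic))) ->
  forall A, measurable A -> m1 A = m2 A.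
Proof.
move=> m1oo m12.
pose G := [set B | exists a b : 'I_n -> R,
  B = boxV (fun i => `]a i, b i[%classic)].
pose g (k : nat) := @boxV n (fun=> `](- k%:R)%R, k%:R[%classic).
have Ug : \bigcup_k g k = setT.
  apply/seteqP; split => // x _.
  exists (\max_(i < n) (Num.truncn `|x 0%R i|).+1)%N => // i /=.
  rewrite in_itv/= -ltr_norml (lt_le_trans (truncnS_gt _))//.
  by rewrite ler_nat (bigD1 i)//= leq_max leqnn.
apply: (measure_unique G g) => //.
- apply/seteqP; split; last first.
    apply: smallest_sub; first exact: sigma_algebra_measurable.
    move=> _ [a [b ->]]; apply: measurable_boxV => i; exact: measurable_itv.
  apply: smallest_sub; first exact: smallest_sigma_algebra.
  rewrite -bigcup_seq => _ [i _] [B mB <-]; rewrite setTI.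
  (* [H] is a sigma-algebra on the line, so only cylinders over open intervals remain; such a
     cylinder is the countable union of boxes whose other sides are ]-k, k[. *)
  pose H := [set B : set R | <<s G >> (coordV i @^-1` B)].
  suff : measurable `<=` H by apply.
  rewrite measurableR_oitv; apply: smallest_sub.
    split.
    - rewrite /H/= preimage_set0; exact: sigma_algebra0.
    - move=> A HA; rewrite /H/= setTD preimage_setC.
      exact: (@measurableC _ (g_sigma_algebraType G)).
    - move=> F HF; rewrite /H/= preimage_bigcup.
      exact: (@bigcupT_measurable _ (g_sigma_algebraType G)).
  move=> _ [a [b ->]]; rewrite /H/=.
  rewrite (_ : _ @^-1` _ = \bigcup_k boxV (fun j => if j == i then `]a, b[%classic
      else `](- k%:R)%R, k%:R[%classic)).
    apply: (@bigcupT_measurable _ (g_sigma_algebraType G)) => k.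
    apply: sub_sigma_algebra.
    exists (fun j => if j == i then a else (- k%:R)%R),
           (fun j => if j == i then b else k%:R).
    by congr boxV; apply/funext => j; case: ifP.
  apply/seteqP; split=> [x xab|x [k _ /(_ i)]]; last by rewrite eqxx.
  have : (\bigcup_k g k) x by rewrite Ug.
  by case=> k _ gx; exists k => // j /=; case: ifPn => [/eqP ->|_] //; exact: gx.
- move=> _ _ [a [b ->]] [a' [b' ->]].
  exists (fun i => Num.max (a i) (a' i)), (fun i => Num.min (b i) (b' i)).
  apply/seteqP; split=> [x [h h'] i /=|x h].
    move: (h i) (h' i); rewrite /= !in_itv/= gt_max lt_min.
    by move=> /andP[-> ->] /andP[-> ->].
  split=> i /=; move: (h i); rewrite /= !in_itv/= gt_max lt_min;
    by case/andP => /andP[h1 h2] /andP[h3 h4]; apply/andP.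
- by move=> k; exists (fun=> (- k%:R)%R), (fun=> k%:R).
- by move=> _ [a [b ->]]; exact: m12.
- by move=> k; exact: m1oo.
Qed.

End lebesgueV_integration.

(** * Exchange of coordinates between two points *)

Section mix.
Context {R : realType} {n : nat}.
Implicit Types (u : {set 'I_n}) (x y : 'rV[R]_n).

(** That g depends on x_u only is expressed by [g (mix u x y) = g x] for all y, with no type of
    partial vectors. *)
Definition mix u x y : 'rV[R]_n := \row_j (if j \in u then x 0 j else y 0 j).

Lemma mixE u x y j : mix u x y 0 j = if j \in u then x 0 j else y 0 j.
Proof. by rewrite mxE. Qed.

Lemma mixKl u x y : mix u (mix u x y) (mix u y x) = x.
Proof. by apply/rowP => j; rewrite !mixE; case: (j \in u). Qed.

Lemma measurable_mix d (T : measurableType d) (f g : T -> 'rV[R]_n) u :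
  measurable_fun setT f -> measurable_fun setT g ->
  measurable_fun setT (fun t => mix u (f t) (g t)).
Proof.
move=> mf mg; apply: measurable_fun_rV => j.
rewrite (_ : _ \o _ = coordV j \o (if j \in u then f else g)).
  by apply: measurableT_comp; [exact: measurable_coordV|case: ifP].
by apply/funext => t /=; rewrite /coordV mixE; case: ifP.
Qed.

(** Exchanging the coordinates outside u between two points is an involution that preserves the
    product measure: the change of variables behind the partial integrations. *)
Definition swapV u (p : 'rV[R]_n * 'rV[R]_n) := (mix u p.1 p.2, mix u p.2 p.1).

Lemma swapVK u : involutive (swapV u).
Proof. by move=> [x y]; rewrite /swapV/= !mixKl. Qed.

Lemma measurable_swapV u : measurable_fun setT (swapV u).
Proof.
by apply: measurable_fun_pair; exact: measurable_mix.
Qed.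

End mix.

Section product_unique.
Context {R : realType} {n : nat}.
Local Open Scope ereal_scope.

Lemma measurable_row_mx :
  measurable_fun setT (fun p : 'rV[R]_n * 'rV[R]_n => row_mx p.1 p.2).
Proof.
apply: measurable_fun_rV => j; case: (split_ordP j) => k ->.
- rewrite (_ : _ \o _ = coordV k \o fst).
    by apply: measurableT_comp => //; exact: measurable_coordV.
  by apply/funext => p /=; rewrite /coordV row_mxEl.
- rewrite (_ : _ \o _ = coordV k \o snd).
    by apply: measurableT_comp => //; exact: measurable_coordV.
  by apply/funext => p /=; rewrite /coordV row_mxEr.
Qed.

Lemma measurable_unrow_mx :
  measurable_fun setT (fun z : 'rV[R]_(n + n) => (lsubmx z, rsubmx z)).
Proof.
apply: measurable_fun_pair; apply: measurable_fun_rV => j.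
- rewrite (_ : _ \o _ = coordV (lshift n j)); first exact: measurable_coordV.
  by apply/funext => z; rewrite /coordV/= mxE.
- rewrite (_ : _ \o _ = coordV (rshift n j)); first exact: measurable_coordV.
  by apply/funext => z; rewrite /coordV/= mxE.
Qed.

(** [row_mx] identifies pairs of vectors with vectors of R^(n+n), where a box is a product of two
    boxes, so the uniqueness on one space applies to the image measures. *)
Lemma boxV2_measure_unique (m1 m2 : {measure set ('rV[R]_n * 'rV[R]_n) -> \bar R}) :
  (forall a b a' b' : 'I_n -> R,
     let B := boxV (fun i => `]a i, b i[%classic) `*`
              boxV (fun i => `]a' i, b' i[%classic) in
     m1 B < +oo /\ m1 B = m2 B) ->
  forall A, measurable A -> m1 A = m2 A.
Proof.
move=> m12 A mA.
pose phi (p : 'rV[R]_n * 'rV[R]_n) := row_mx p.1 p.2.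
have box_phi (a b : 'I_(n + n) -> R) :
    phi @^-1` boxV (fun i => `]a i, b i[%classic) =
    boxV (fun i => `]a (lshift n i), b (lshift n i)[%classic) `*`
    boxV (fun i => `]a (rshift n i), b (rshift n i)[%classic).
  apply/seteqP; split=> [p h|p [h1 h2] i /=].
    by split=> i; [have := h (lshift n i)|have := h (rshift n i)];
      rewrite /= /phi ?row_mxEl ?row_mxEr.
  by rewrite /phi; case: (split_ordP i) => k ->;
    rewrite ?row_mxEl ?row_mxEr; [exact: h1|exact: h2].
have mphi : measurable_fun setT phi by exact: measurable_row_mx.
have key : forall B, measurable B -> m1 (phi @^-1` B) = m2 (phi @^-1` B).
  apply: (@boxV_measure_unique _ _ (pushforward m1 phi) (pushforward m2 phi)) => //
    a b; rewrite /= /pushforward box_phi.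
    by have [] := m12 (fun i => a (lshift n i)) (fun i => b (lshift n i))
      (fun i => a (rshift n i)) (fun i => b (rshift n i)).
  by have [] := m12 (fun i => a (lshift n i)) (fun i => b (lshift n i))
      (fun i => a (rshift n i)) (fun i => b (rshift n i)).
pose B := (fun z : 'rV[R]_(n + n) => (lsubmx z, rsubmx z)) @^-1` A.
have mB : measurable B.
  by rewrite -[B]setTI; exact: measurable_unrow_mx.
have -> : A = phi @^-1` B.
  rewrite /B -comp_preimage (_ : _ \o _ = id) //.
  by apply/funext => -[x y]; rewrite /phi/= row_mxKl row_mxKr.
exact: key.
Qed.

End product_unique.

Section spreadV.
Context {R : realType} {n : nat}.
Implicit Types (u : {set 'I_n}).

Lemma spreadVE u (y : 'rV[R]_#|u|) j :
  spreadV y 0 j = \sum_(k < #|u| | enum_val k == j) (y 0 k).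
Proof.
rewrite /spreadV summxE [RHS]big_mkcond; apply: eq_bigr => k _ /=.
by rewrite !mxE eqxx/= eq_sym; case: eqP => _; rewrite ?mulr1 ?mulr0.
Qed.

Lemma spreadV_in u (y : 'rV[R]_#|u|) k : spreadV y 0 (enum_val k) = y 0 k.
Proof.
rewrite spreadVE (big_pred1 k) // => i /=.
by apply/eqP/eqP => [/enum_val_inj//|->].
Qed.

Lemma spreadV_notin u (y : 'rV[R]_#|u|) j : j \notin u -> spreadV y 0 j = 0.
Proof.
move=> ju; rewrite spreadVE big_pred0// => k.
by apply/negbTE; apply: contraNN ju => /eqP <-; exact: enum_valP.
Qed.

Lemma mergeV_in u (y : 'rV[R]_#|u|) (z : 'rV[R]_#|~: u|) j : j \in u ->
  mergeV y z 0 j = spreadV y 0 j.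
Proof. by move=> ju; rewrite mxE [X in (_ + X)]spreadV_notin ?inE ?ju// addr0. Qed.

Lemma mergeV_notin u (y : 'rV[R]_#|u|) (z : 'rV[R]_#|~: u|) j : j \notin u ->
  mergeV y z 0 j = spreadV z 0 j.
Proof. by move=> ju; rewrite mxE [X in (X + _)]spreadV_notin// add0r. Qed.

Lemma measurable_spreadV u : measurable_fun setT (@spreadV R n u).
Proof.
apply: measurable_fun_rV => j; have [ju|ju] := boolP (j \in u).
- rewrite (_ : _ \o _ = coordV (enum_rank_in ju j)); first exact: measurable_coordV.
  apply/funext => y; rewrite /coordV/=.
  by rewrite -[in LHS](enum_rankK_in ju ju) spreadV_in.
- rewrite (_ : _ \o _ = cst 0) //.
  by apply/funext => y; rewrite /coordV/= spreadV_notin.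
Qed.

Lemma measurable_mergeV d (T : measurableType d) u (f : T -> 'rV[R]_#|u|)
    (g : T -> 'rV[R]_#|~: u|) :
  measurable_fun setT f -> measurable_fun setT g ->
  measurable_fun setT (fun t => mergeV (f t) (g t)).
Proof.
move=> mf mg; apply: measurable_fun_rV => j.
rewrite (_ : _ \o _ = (coordV j \o (@spreadV R n u) \o f) \+
   (coordV j \o (@spreadV R n (~: u)) \o g)).
  by apply: measurable_funD; apply: measurableT_comp => //;
    apply: measurableT_comp; [exact: measurable_coordV|exact: measurable_spreadV|
    exact: measurable_coordV|exact: measurable_spreadV].
by apply/funext => t; rewrite /coordV/= mxE.
Qed.

End spreadV.

Section swap_and_merge.
Context {R : realType} {n : nat}.
Implicit Types (u : {set 'I_n}).
Local Open Scope ereal_scope.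

Lemma lebesgueV_oobox m (a b : 'I_m -> R) :
  lebesgueV m (boxV (fun i => `]a i, b i[%classic)) =
  \prod_(i < m) lebesgue_measure `]a i, b i[%classic.
Proof. exact: lebesgueV_box. Qed.

Lemma lebesgueV_oobox_lty m (a b : 'I_m -> R) :
  lebesgueV m (boxV (fun i => `]a i, b i[%classic)) < +oo.
Proof.
rewrite lebesgueV_oobox ltey_eq prode_fin_num// => i _.
by rewrite lebesgue_measure_itv; case: ifP.
Qed.

Let swap_boxV u (A B : 'I_n -> set R) :
  swapV u @^-1` (boxV A `*` boxV B) =
  boxV (fun i => if i \in u then A i else B i) `*`
  boxV (fun i => if i \in u then B i else A i).
Proof.
apply/seteqP; split=> [[x y] [/= h1 h2]|[x y] [/= h1 h2]].
  by split=> i; have := h1 i; have := h2 i; rewrite !mixE; case: ifP.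
by split=> i; have := h1 i; have := h2 i; rewrite !mixE; case: ifP.
Qed.

(** On a product of two boxes the exchange only permutes the 2n side lengths, and the measure is
    their product. *)
Lemma lebesgueV_swap u (A : set ('rV[R]_n * 'rV[R]_n)) : measurable A ->
  (lebesgueV n \x lebesgueV n) A =
  (lebesgueV n \x lebesgueV n) (swapV u @^-1` A).
Proof.
move: A; apply: (@boxV2_measure_unique _ _ (lebesgueV n \x lebesgueV n)
    (pushforward (lebesgueV n \x lebesgueV n) (swapV u))) => //.
  exact: measurable_swapV.
move=> msw a b a' b' B; have moo (c e : 'I_n -> R) :
    measurable (boxV (fun i => `]c i, e i[%classic)).
  by apply: measurable_boxV => i; exact: measurable_itv.
have E (c e c' e' : 'I_n -> R) : (lebesgueV n \x lebesgueV n)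
    (boxV (fun i => `]c i, e i[%classic) `*`
     boxV (fun i => `]c' i, e' i[%classic)) =
    (\prod_(i < n) lebesgue_measure `]c i, e i[%classic) *
    (\prod_(i < n) lebesgue_measure `]c' i, e' i[%classic).
  by rewrite product_measure1E//; congr (_ * _); exact: lebesgueV_oobox.
split.
  rewrite /B /= E -!lebesgueV_oobox lte_mul_pinfty// ?ge0_fin_numE//;
    exact: lebesgueV_oobox_lty.
rewrite /= /pushforward /B swap_boxV E.
rewrite [X in boxV X `*` _](_ : _ = fun i => `](if i \in u then a i else a' i),
    (if i \in u then b i else b' i)[%classic); last first.
  by apply/funext => i; case: ifP.
rewrite [X in _ `*` boxV X](_ : _ = fun i => `](if i \in u then a' i else a i),
    (if i \in u then b' i else b i)[%classic); last first.
  by apply/funext => i; case: ifP.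
rewrite E -!big_split/=.
by apply: eq_bigr => i _; case: ifP => //; rewrite muleC.
Qed.

Lemma ge0_integral_swap u (G : 'rV[R]_n * 'rV[R]_n -> \bar R) :
  measurable_fun setT G -> (forall p, 0 <= G p) ->
  \int[lebesgueV n]_x \int[lebesgueV n]_y G (x, y) =
  \int[lebesgueV n]_x \int[lebesgueV n]_y G (mix u x y, mix u y x).
Proof.
move=> mG G0; rewrite -(fubini_tonelli1 G)//.
rewrite (ge0_integral_image (measurable_swapV u) (lebesgueV_swap u))//.
apply: (fubini_tonelli1 (G \o swapV u)) => [|p]; last exact: G0.
exact: (measurableT_comp mG (measurable_swapV u)).
Qed.

Lemma ge0_integral_exchange (G : 'rV[R]_n * 'rV[R]_n -> \bar R) :
  measurable_fun setT G -> (forall p, 0 <= G p) ->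
  \int[lebesgueV n]_x \int[lebesgueV n]_y G (x, y) =
  \int[lebesgueV n]_y \int[lebesgueV n]_x G (x, y).
Proof. exact: fubini_tonelli. Qed.

Lemma integrable_swap u (G : 'rV[R]_n * 'rV[R]_n -> \bar R) :
  (lebesgueV n \x lebesgueV n).-integrable setT G ->
  (lebesgueV n \x lebesgueV n).-integrable setT (G \o swapV u).
Proof.
(* [G \o swapV u] is tested through its own composition with the involution, which is [G] again. *)
move=> Gi; apply: (integrable_image (measurable_swapV u) (lebesgueV_swap u)).
  exact: (measurableT_comp (measurable_int _ Gi) (measurable_swapV u)).
by rewrite -compA (_ : swapV u \o swapV u = id) //; exact/funext/swapVK.
Qed.

Lemma integral_swap u (G : 'rV[R]_n * 'rV[R]_n -> \bar R) :
  (lebesgueV n \x lebesgueV n).-integrable setT G ->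
  \int[lebesgueV n]_x \int[lebesgueV n]_y G (x, y) =
  \int[lebesgueV n]_x \int[lebesgueV n]_y G (mix u x y, mix u y x).
Proof.
move=> Gi; rewrite (integral12_prod_meas1 Gi).
rewrite (integral_image (measurable_swapV u) (lebesgueV_swap u)); last first.
  exact: measurable_int Gi.
by rewrite -(integral12_prod_meas1 (integrable_swap u Gi)).
Qed.

(** Both sides give a box the product of its side lengths, regrouped into the factors in u and those
    outside. *)
Lemma lebesgueV_merge u (A : set 'rV[R]_n) : measurable A ->
  lebesgueV n A = (lebesgueV #|u| \x lebesgueV #|~: u|)
    ((fun p => mergeV p.1 p.2) @^-1` A).
Proof.
have mm : measurable_fun setT (fun p : 'rV[R]_#|u| * 'rV[R]_#|~: u| =>
    mergeV p.1 p.2) by exact: measurable_mergeV.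
move: A; apply: (@boxV_measure_unique _ _ (lebesgueV n)
    (pushforward (lebesgueV #|u| \x lebesgueV #|~: u|) (fun p => mergeV p.1 p.2))) => //.
  by move=> a b; exact: lebesgueV_oobox_lty.
move=> a b; rewrite /= /pushforward.
rewrite (_ : _ @^-1` _ = boxV (fun k : 'I_#|u| => `]a (enum_val k), b (enum_val k)[%classic) `*`
  boxV (fun k : 'I_#|~: u| => `]a (enum_val k), b (enum_val k)[%classic)).
  rewrite product_measure1E; last 2 first.
  - by apply: measurable_boxV => i; exact: measurable_itv.
  - by apply: measurable_boxV => i; exact: measurable_itv.
  have E (w : {set 'I_n}) : lebesgueV #|w|
      (boxV (fun k : 'I_#|w| => `]a (enum_val k), b (enum_val k)[%classic)) =
      \prod_(i in w) lebesgue_measure `]a i, b i[%classic.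
    by rewrite lebesgueV_oobox [RHS]big_enum_val.
  transitivity ((\prod_(i in u) lebesgue_measure `]a i, b i[%classic) *
      \prod_(i in ~: u) lebesgue_measure `]a i, b i[%classic).
    rewrite lebesgueV_oobox (bigID (mem u))/=; congr (_ * _).
    by apply: eq_bigl => i; rewrite inE.
  by rewrite -!E.
apply/seteqP; split=> [[y z] /= h|[y z] [/= h1 h2] i].
  split=> k /=.
    by have := h (enum_val k); rewrite /= mergeV_in ?enum_valP// spreadV_in.
  have := h (enum_val k); rewrite /= mergeV_notin ?spreadV_in//.
  by have := enum_valP k; rewrite inE.
have [iu|iu] := boolP (i \in u).
  have := h1 (enum_rank_in iu i).
  by rewrite /= mergeV_in// -spreadV_in enum_rankK_in.
have iu' : i \in ~: u by rewrite inE.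
have := h2 (enum_rank_in iu' i).
by rewrite /= mergeV_notin// -spreadV_in enum_rankK_in.
Qed.

Lemma ge0_integral_merge u (g : 'rV[R]_n -> \bar R) :
  measurable_fun setT g -> (forall x, 0 <= g x) ->
  \int[lebesgueV n]_x g x =
  \int[lebesgueV #|u|]_y \int[lebesgueV #|~: u|]_z g (mergeV y z).
Proof.
move=> mg g0.
have mm : measurable_fun setT (fun p : 'rV[R]_#|u| * 'rV[R]_#|~: u| =>
    mergeV p.1 p.2) by exact: measurable_mergeV.
rewrite (ge0_integral_image mm (@lebesgueV_merge u))// fubini_tonelli1//.
exact: (measurableT_comp mg mm).
Qed.

End swap_and_merge.

(** * Cauchy-Schwarz and elementary inequalities in the extended reals *)

Section cauchy_schwarz.
Context d (T : measurableType d) (R : realType) (mu : {measure set T -> \bar R}).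
Local Open Scope ereal_scope.

(** Hoelder's inequality with both exponents 2, squared so that it can be read in the extended reals
    even when an integral is infinite. *)
Lemma integral_cauchy_schwarz (f g : T -> R) :
  measurable_fun setT f -> measurable_fun setT g ->
  (\int[mu]_x `|f x * g x|%:E) * (\int[mu]_x `|f x * g x|%:E) <=
  (\int[mu]_x (f x ^+ 2)%:E) * (\int[mu]_x (g x ^+ 2)%:E).
Proof.
move=> mf mg.
have pow2 (x : \bar R) : 0 <= x -> x `^ 2%R = x * x.
  case: x => [r||//] r0; first by rewrite poweR_EFin powR_mulrn// expr2.
  by rewrite poweRE eqxx pnatr_eq0 mulyy.
have N2 (h : T -> R) : Lnorm mu 2%:E (EFin \o h) * Lnorm mu 2%:E (EFin \o h) =
    \int[mu]_x (h x ^+ 2)%:E.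
  rewrite -pow2 ?Lnorm_ge0// poweR_Lnorm//; apply: eq_integral => x _.
  by rewrite pow2//= -EFinM -expr2 real_normK// num_real.
have h : (\int[mu]_x `|f x * g x|%:E) <=
    Lnorm mu 2%:E (EFin \o f) * Lnorm mu 2%:E (EFin \o g).
  rewrite (le_trans _ (hoelder mu mf mg (ltr0Sn R 1) (ltr0Sn R 1) _)) ?Lnorm1//.
  by rewrite [RHS](splitr 1%R) !mul1r.
apply: (le_trans (lee_pmul _ _ h h)).
- by apply: integral_ge0 => x _; rewrite lee_fin.
- by apply: integral_ge0 => x _; rewrite lee_fin.
by rewrite muleACA !N2.
Qed.

(** From 2 x |s| <= x^2 + s^2. It shows that a product is integrable when both squares are, x being
    an absolute integral that may be infinite. *)
Lemma lee_mul_sqr (x : \bar R) (X : \bar R) (s : R) :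
  0 <= x -> x * x <= X -> x * `|s|%:E <= 2^-1%:E * (X + (s ^+ 2)%:E).
Proof.
case: X => [X||]; last 2 first.
- by move=> *; rewrite addye// gt0_muley ?leey// lte_fin.
- by move=> x0; rewrite leeNy_eq => /eqP h; have := mule_ge0 x0 x0; rewrite h.
case: x => [x|_|//]; last by rewrite mulyy leye_eq.
rewrite -EFinD -!EFinM !lee_fin => x0 xX.
have := sqr_ge0 (x - `|s|)%R; rewrite sqrrB real_normK ?num_real// expr2.
by move=> h; lra.
Qed.

(** With A = s X and B = k / s one has A B = X k, and A B <= (A + B)^2. The free factor s will be a
    product of weights psi_j, chosen so that each summand is integrable over a box. *)
Lemma lee_mul_am_gm (x X : \bar R) (s k : R) : (0 < s)%R -> (0 <= k)%R ->
  0 <= x -> 0 <= X -> x * x <= X * k%:E -> x <= s%:E * X + (k / s)%:E.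
Proof.
move=> s0 k0; case: X => [X||] // x0; last first.
  by move=> _ _; rewrite gt0_muley ?lte_fin// addye ?leey.
case: x x0 => [x|_|//]; last by rewrite mulyy leye_eq.
rewrite -!EFinM -EFinD !lee_fin => x0 X0 xX.
rewrite -(@ler_sqr _ x) ?nnegrE//; last first.
  by rewrite addr_ge0// ?mulr_ge0 ?invr_ge0 ?(ltW s0).
rewrite expr2 (le_trans xX)//.
have -> : (X * k = (s * X) * (k / s))%R by field; rewrite gt_eqF.
have a0 : (0 <= s * X)%R by rewrite mulr_ge0 ?(ltW s0).
have b0 : (0 <= k / s)%R by rewrite mulr_ge0 ?invr_ge0 ?(ltW s0).
nra.
Qed.

End cauchy_schwarz.

(** * Measurability of integrals depending on a parameter *)

Section parameter_integral.
Context d1 d2 (T1 : measurableType d1) (T2 : measurableType d2) (R : realType).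
Variable m2 : {sigma_finite_measure set T2 -> \bar R}.

(** The integral is by definition the difference of those of the positive and negative parts, and
    Tonelli gives the measurability of each; nothing has to converge. *)
Lemma measurable_eintegral_param (h : T1 * T2 -> R) : measurable_fun setT h ->
  measurable_fun setT (fun x => \int[m2]_y (h (x, y))%:E)%E.
Proof.
move=> mh; have meh : measurable_fun setT (EFin \o h) by exact/measurable_EFinP.
rewrite (_ : (fun x => _) = (fun x => (\int[m2]_y (EFin \o h)^\+ (x, y) -
  \int[m2]_y (EFin \o h)^\- (x, y))%E)); last first.
  apply/funext => x; rewrite integralE; congr (_ - _)%E;
    by apply: eq_integral => y _; rewrite ?funeposE ?funenegE.
apply: emeasurable_funB.
- by apply: measurable_fun_fubini_tonelli_F => //; exact: measurable_funepos.
- by apply: measurable_fun_fubini_tonelli_F => //; exact: measurable_funeneg.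
Qed.

Lemma measurable_integral_param (h : T1 * T2 -> R) : measurable_fun setT h ->
  measurable_fun setT (fun x => \int[m2]_y h (x, y))%R.
Proof.
move=> mh; apply: (measurableT_comp (fine_measurable measurableT)).
exact: measurable_eintegral_param.
Qed.

End parameter_integral.

(** * Products of one-variable weights *)

Section weight_prod_theory.
Context {R : realType} {n : nat}.
Implicit Types (h : 'I_n -> R -> R) (u w : {set 'I_n}) (x y : 'rV[R]_n).

Lemma weight_prod_ge0 h u x : (forall j t, 0 <= h j t) -> 0 <= weight_prod h u x.
Proof. by move=> h0; apply: prodr_ge0. Qed.

Lemma weight_prod_gt0 h u x : (forall j t, 0 < h j t) -> 0 < weight_prod h u x.
Proof. by move=> h0; apply: prodr_gt0. Qed.

Lemma weight_prod_mix_in h u w x y : w \subset u ->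
  weight_prod h w (mix u x y) = weight_prod h w x.
Proof. by move=> /fintype.subsetP wu; apply: eq_bigr => j /wu ju; rewrite mixE ju. Qed.

Lemma weight_prod_mix_out h u w x y : [disjoint w & u]%B ->
  weight_prod h w (mix u x y) = weight_prod h w y.
Proof.
move=> wu; apply: eq_bigr => j jw; rewrite mixE.
by rewrite (disjointFr wu jw).
Qed.

Lemma weight_prodU h u w x : [disjoint u & w]%B ->
  weight_prod h (u :|: w) x = weight_prod h u x * weight_prod h w x.
Proof.
move=> uw; rewrite /weight_prod -(bigU _ _ _ uw)/=.
by apply: eq_bigl => j; rewrite inE.
Qed.

Lemma weight_prodC h u x :
  weight_prod h u x * weight_prod h (~: u) x = weight_prod h [set: 'I_n]%SET x.
Proof. by rewrite -weight_prodU ?finset.setUCr// -finset.setI_eq0 finset.setICr. Qed.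

Lemma measurable_prod_in d (T : measurableType d) u (g : 'I_n -> T -> R) :
  (forall j, measurable_fun setT (g j)) ->
  measurable_fun setT (fun t => \prod_(j in u) g j t).
Proof.
move=> mg; rewrite (_ : (fun t => _) =
    fun t => \prod_(j < n) (if j \in u then g j t else 1)); last first.
  by apply/funext => t; rewrite big_mkcond.
by apply: measurable_prod => j _; case: (j \in u); [exact: mg|exact: measurable_cst].
Qed.

Lemma measurable_coord d (T : measurableType d) (f : T -> 'rV[R]_n) j :
  measurable_fun setT f -> measurable_fun setT (fun t => f t 0 j).
Proof. by move=> mf; apply: (measurableT_comp (measurable_coordV j)). Qed.

Lemma measurable_weight_prod d (T : measurableType d) h u (f : T -> 'rV[R]_n) :
  (forall j, measurable_fun setT (h j)) -> measurable_fun setT f ->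
  measurable_fun setT (fun t => weight_prod h u (f t)).
Proof.
move=> mh mf; apply: measurable_prod_in => j.
by apply: (measurableT_comp (mh j)); exact: measurable_coord.
Qed.

End weight_prod_theory.

Lemma measurable_norm_comp d (T : measurableType d) (R : realType) (f : T -> R) :
  measurable_fun setT f -> measurable_fun setT (fun x => `|f x|).
Proof. by move=> mf; apply: (measurableT_comp (@normr_measurable R setT)). Qed.

(** Proves measurability by recursion on the shape of the function, using the measurability of its
    atoms found in the context. *)
Ltac mfun1 := match goal with
  | mF : measurable_fun _ ?F |- measurable_fun _ ?F => exact: mF
  | |- forall _, _ => move=> ?
  | mF : (forall j, measurable_fun _ (?F j)) |- measurable_fun _ (?F _) => exact: mF
  | |- measurable_fun _ (fun _ => weight_prod _ _ _) => apply: measurable_weight_prod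
  | |- measurable_fun _ (weight_prod _ _) => apply: (@measurable_weight_prod _ _ _ _ _ _ id)
  | |- measurable_fun _ (fun _ => mix _ _ _) => apply: measurable_mix
  | |- measurable_fun _ (mix _ _) => apply: (@measurable_mix _ _ _ _ (fun=> _) id)
  | |- measurable_fun _ (fun _ => (_, _)) => apply: measurable_fun_pair
  | |- measurable_fun _ (fun _ => (_ * _)%R) => apply: measurable_funM
  | |- measurable_fun _ (fun _ => (_ + _)%R) => apply: measurable_funD
  | |- measurable_fun _ (fun _ => (- _)%R) => apply: measurable_funN
  | |- measurable_fun _ (fun _ => (_ ^+ _)%R) => apply: measurable_funX
  | |- measurable_fun _ (fun _ => EFin _) => apply/measurable_EFinP
  | |- measurable_fun _ (fun _ => Num.norm _) => apply: measurable_norm_comp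
  | |- measurable_fun _ (fun _ => (\prod_(_ in _) _)%R) => apply: measurable_prod_in
  | |- measurable_fun _ (EFin \o _) => apply/measurable_EFinP
  | |- measurable_fun _ (fun x => x) => exact: measurable_id
  | |- measurable_fun _ fst => exact: measurable_fst
  | |- measurable_fun _ snd => exact: measurable_snd
  | |- measurable_fun _ (fun p => p.1) => exact: measurable_fst
  | |- measurable_fun _ (fun p => p.2) => exact: measurable_snd
  | |- measurable_fun _ (fun p => fun_of_matrix _ _ _) => apply: measurable_coord
  | mF : measurable_fun _ ?F |- measurable_fun _ (fun p => ?F _) =>
      apply: (measurableT_comp mF)
  | mF : (forall j, measurable_fun _ (?F j)) |- measurable_fun _ (fun p => ?F _ _) =>
      apply: (measurableT_comp (mF _))
  | |- measurable_fun _ (fun _ => _) => exact: measurable_cst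
  end.
Ltac mfun := repeat mfun1.

Section density_integrals.
Context {R : realType} {n : nat}.
Variable rho : 'I_n -> R -> R.
Hypothesis mrho : forall j, measurable_fun setT (rho j).
Hypothesis rho0 : forall j t, 0 <= rho j t.
Hypothesis rho1 : forall j, (\int[lebesgue_measure]_t (rho j t)%:E = 1)%E.
Implicit Types (h c : 'I_n -> R -> R) (u w : {set 'I_n}) (x y : 'rV[R]_n).
Local Notation lam := (lebesgueV n).
Local Notation wp := weight_prod.
Local Open Scope ereal_scope.

Lemma ge0_integral_weight_prod h :
  (forall j, measurable_fun setT (h j)) -> (forall j t, (0 <= h j t)%R) ->
  \int[lam]_x (wp h [set: 'I_n]%SET x)%:E = \prod_j \int[lebesgue_measure]_t (h j t)%:E.
Proof.
move=> mh h0; rewrite -ge0_integral_prodV//; apply: eq_integral => x _.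
by congr _%:E; apply: eq_bigl => j; rewrite inE.
Qed.

Lemma ge0_integral_weight_prod_density h u :
  (forall j, measurable_fun setT (h j)) -> (forall j t, (0 <= h j t)%R) ->
  \int[lam]_x (wp h u x * wp rho (~: u) x)%:E =
  \prod_(j in u) \int[lebesgue_measure]_t (h j t)%:E.
Proof.
move=> mh h0; pose g j := if j \in u then h j else rho j.
rewrite [LHS](_ : _ = \int[lam]_x (wp g [set: 'I_n]%SET x)%:E); last first.
  apply: eq_integral => x _; congr _%:E.
  rewrite -(weight_prodC g u); congr (_ * _)%R; apply: eq_bigr => j.
    by rewrite /g => ->.
  by rewrite inE /g => /negbTE ->.
rewrite ge0_integral_weight_prod; last 2 first.
- by move=> j; rewrite /g; case: ifP.
- by move=> j t; rewrite /g; case: ifP.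
rewrite [RHS]big_mkcond; apply: eq_bigr => j _.
by rewrite /g; case: ifP.
Qed.

Lemma integral_density : \int[lam]_x (wp rho [set: 'I_n]%SET x)%:E = 1.
Proof. by rewrite ge0_integral_weight_prod// big1. Qed.

(** After the coordinates outside u are exchanged, K and all factors c_j belong to x, and the
    factors rho_j to y, where they integrate to 1. Read from right to left, this distributes an
    integral over R^n over two points, x carrying x_u and y the other variables. *)
Lemma ge0_integral_marginal (K : 'rV[R]_n -> R) c u :
  measurable_fun setT K -> (forall x, (0 <= K x)%R) ->
  (forall j, measurable_fun setT (c j)) -> (forall j t, (0 <= c j t)%R) ->
  \int[lam]_x \int[lam]_y (K (mix u x y) * (wp c u x * wp rho (~: u) x) *
    (wp c (~: u) y * wp rho u y))%:E = \int[lam]_x (K x * wp c [set: 'I_n]%SET x)%:E.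
Proof.
move=> mK K0 mc c0.
rewrite (ge0_integral_swap u (G := fun p => (K (mix u p.1 p.2) *
  (wp c u p.1 * wp rho (~: u) p.1) * (wp c (~: u) p.2 * wp rho u p.2))%:E)) /=; last 2 first.
- by mfun.
- by move=> p; rewrite lee_fin !mulr_ge0// weight_prod_ge0.
apply: eq_integral => x _.
transitivity ((K x * wp c [set: 'I_n]%SET x)%:E * \int[lam]_y (wp rho [set: 'I_n]%SET y)%:E).
  rewrite -ge0_integralZl//=; last 3 first.
  - by mfun.
  - by move=> y _; rewrite lee_fin weight_prod_ge0.
  - by rewrite lee_fin mulr_ge0// weight_prod_ge0.
  apply: eq_integral => y _; rewrite -EFinM; congr _%:E.
  have du : [disjoint ~: u & u]%B by rewrite -finset.setI_eq0 finset.setIC finset.setICr.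
  rewrite mixKl !(weight_prod_mix_in _ _ _ (subxx u)) !(weight_prod_mix_out _ _ _ du).
  by rewrite -(weight_prodC c u) -(weight_prodC rho u); ring.
by rewrite integral_density mule1.
Qed.

(** A depends on x_u and M on the other variables, so they are independent under rho. Writing the
    product of the two integrals as a double integral and exchanging the coordinates outside u
    gathers A M at one point and all rho_j at the other. *)
Lemma ge0_integral_indep (A M : 'rV[R]_n -> \bar R) u :
  measurable_fun setT A -> (forall x, 0 <= A x) ->
  measurable_fun setT M -> (forall x, 0 <= M x) ->
  (forall x y, A (mix u x y) = A x) -> (forall x y, M (mix u x y) = M y) ->
  \int[lam]_x (A x * M x) =
  (\int[lam]_x (A x * (wp rho (~: u) x)%:E)) * (\int[lam]_x (M x * (wp rho u x)%:E)).
Proof.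
move=> mA A0 mM M0 Au Mu.
have IM0 : 0 <= \int[lam]_x (M x * (wp rho u x)%:E).
  by apply: integral_ge0 => x _; rewrite mule_ge0// lee_fin weight_prod_ge0.
have mw w : measurable_fun setT (fun x : 'rV[R]_n => (wp rho w x)%:E) by mfun.
rewrite -ge0_integralZr//; last 2 first.
- exact: emeasurable_funM.
- by move=> x _; rewrite mule_ge0// lee_fin weight_prod_ge0.
transitivity (\int[lam]_x \int[lam]_y (A x * (wp rho (~: u) x)%:E *
    (M y * (wp rho u y)%:E))); last first.
  apply: eq_integral => x _; rewrite ge0_integralZl//.
  - exact: emeasurable_funM.
  - by move=> y _; rewrite mule_ge0// lee_fin weight_prod_ge0.
  - by rewrite mule_ge0// lee_fin weight_prod_ge0.
have mG : measurable_fun setT (fun p : 'rV[R]_n * 'rV[R]_n =>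
    A p.1 * (wp rho (~: u) p.1)%:E * (M p.2 * (wp rho u p.2)%:E)).
  apply: emeasurable_funM; apply: emeasurable_funM.
  - exact: (measurableT_comp mA measurable_fst).
  - by mfun.
  - exact: (measurableT_comp mM measurable_snd).
  - by mfun.
rewrite (ge0_integral_swap u mG)/=; last first.
  by move=> p; rewrite !mule_ge0// lee_fin weight_prod_ge0.
apply: eq_integral => x _.
rewrite -[LHS]mule1 -integral_density -ge0_integralZl//; last 2 first.
- by move=> y _; rewrite lee_fin weight_prod_ge0.
- by rewrite mule_ge0.
apply: eq_integral => y _.
have du : [disjoint ~: u & u]%B by rewrite -finset.setI_eq0 finset.setIC finset.setICr.
rewrite Au Mu (weight_prod_mix_in _ _ _ (subxx u)) (weight_prod_mix_out _ _ _ du).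
by rewrite [RHS]muleACA -EFinM (mulrC (wp rho (~: u) y)) weight_prodC.
Qed.

(** The link between [mix] and [mergeV]: the coordinates of y in u occur only in rho_u, which
    integrates to 1. The vector [b] is overwritten by [mix], hence arbitrary. *)
Lemma ge0_integral_mix_merge (K : 'rV[R]_n -> R) u (a : 'rV[R]_#|u|)
    (b : 'rV[R]_#|~: u|) :
  measurable_fun setT K -> (forall x, (0 <= K x)%R) ->
  \int[lam]_y (K (mix u (mergeV a b) y) * wp rho [set: 'I_n]%SET y)%:E =
  \int[lebesgueV #|~: u|]_z (K (mergeV a z) * wp rho (~: u) (mergeV a z))%:E.
Proof.
move=> mK K0; rewrite (ge0_integral_merge u); last 2 first.
- by mfun.
- by move=> y; rewrite lee_fin mulr_ge0// weight_prod_ge0.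
set I := RHS.
have mspread (w : {set 'I_n}) : measurable_fun setT
    (fun y : 'rV[R]_#|w| => wp rho w (spreadV y)).
  by apply: measurable_weight_prod => //; exact: measurable_spreadV.
transitivity (\int[lebesgueV #|u|]_y ((wp rho u (spreadV y))%:E * I)).
  apply: eq_integral => y _; rewrite /I -ge0_integralZl//; last 3 first.
  - have mm : measurable_fun setT (fun z : 'rV[R]_#|~: u| => mergeV a z).
      by apply: measurable_mergeV => //; exact: measurable_id.
    by mfun.
  - by move=> z _; rewrite lee_fin mulr_ge0// weight_prod_ge0.
  - by rewrite lee_fin weight_prod_ge0.
  apply: eq_integral => z _; rewrite -EFinM; congr _%:E.
  have -> : mix u (mergeV a b) (mergeV y z) = mergeV a z.
    apply/rowP => j; rewrite mixE; case: ifPn => ju.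
      by rewrite !mergeV_in.
    by rewrite !mergeV_notin.
  rewrite -(weight_prodC rho u).
  have -> : wp rho u (mergeV y z) = wp rho u (spreadV y).
    by apply: eq_bigr => j ju; rewrite mergeV_in.
  have -> : wp rho (~: u) (mergeV a z) = wp rho (~: u) (mergeV y z).
    by apply: eq_bigr => j; rewrite inE => ju; rewrite !mergeV_notin.
  by ring.
rewrite ge0_integralZr//; last 3 first.
- by apply/measurable_EFinP; exact: mspread.
- by move=> y _; rewrite lee_fin weight_prod_ge0.
- by apply: integral_ge0 => z _; rewrite lee_fin mulr_ge0// weight_prod_ge0.
rewrite [X in X * _](_ : _ = 1) ?mul1e//.
rewrite [LHS](_ : _ = \int[lebesgueV #|u|]_y
    (\prod_(k < #|u|) rho (enum_val k) (y 0%R k))%:E); last first.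
  apply: eq_integral => y _; congr _%:E; rewrite /weight_prod big_enum_val.
  by apply: eq_bigr => k _; rewrite spreadV_in.
rewrite (ge0_integral_prodV (h := fun k => rho (enum_val k)))//.
by rewrite big1.
Qed.

End density_integrals.

(** * The kernel of one variable *)

Section anova_kernel.
Context {R : realType}.
Variables rho psi : R -> R.
Hypothesis hrho : positive_density rho.
Hypothesis hpsi : positive_weight psi.
Hypothesis hcond : embedding_condition rho psi.
Local Notation leb := (@lebesgue_measure R).
Local Notation cdf := (density_cdf rho).
Implicit Types x t : R.

Definition anova_kernel x t : R := density_cdf rho t - (x <= t)%R%:R.
Local Notation kap := anova_kernel.

Lemma density_measurable : measurable_fun setT rho.
Proof. by case: hrho. Qed.

Lemma density_ge0 x : 0 <= rho x.
Proof. by case: hrho => _ /(_ x)/ltW. Qed.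

Lemma density_integral : (\int[leb]_x (rho x)%:E = 1)%E.
Proof. by case: hrho. Qed.

Lemma density_integrable : leb.-integrable setT (EFin \o rho).
Proof.
apply/integrableP; split; first by apply/measurable_EFinP; exact: density_measurable.
under eq_integral do rewrite /= ger0_norm ?density_ge0//.
by rewrite density_integral ltry.
Qed.

Lemma weight_gt0 t : 0 < psi t. Proof. by case: hpsi. Qed.

Lemma weight_measurable : measurable_fun setT psi.
Proof. by case: hpsi => _ [+ _ _]. Qed.

Lemma weightV_measurable : measurable_fun setT (fun t => (psi t)^-1).
Proof. by case: hpsi => _ _ [+ _ _]. Qed.

Lemma measurable_leb_indic d (T : measurableType d) (f g : T -> R) :
  measurable_fun setT f -> measurable_fun setT g ->
  measurable_fun setT (fun p => (f p <= g p)%R%:R : R).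
Proof.
move=> mf mg; rewrite (_ : (fun p => _) = (fun p => if f p <= g p then 1 else 0)).
  by apply: measurable_fun_ifT => //; exact: measurable_fun_ler.
by apply/funext => p; case: ifP.
Qed.

Lemma density_cdfE t : cdf t = \int[leb]_x ((x <= t)%R%:R * rho x).
Proof.
rewrite /density_cdf Rintegral_mkcond; apply: eq_Rintegral => x _.
rewrite patchE mem_setE in_itv/=.
by case: (x <= t)%R; rewrite ?mul1r ?mul0r.
Qed.

Lemma integrable_mask (h : R -> R) t : leb.-integrable setT (EFin \o h) ->
  leb.-integrable setT (fun x => ((x <= t)%R%:R * h x)%:E).
Proof.
move=> hi; have /measurable_EFinP mh := measurable_int _ hi.
apply: (le_integrable _ _ _ hi) => //.
  apply/measurable_EFinP; apply: measurable_funM.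
    by apply: measurable_leb_indic => //; exact: measurable_cst.
  exact: mh.
move=> x _ /=; rewrite lee_fin normrM ler_piMl//.
by case: (x <= t)%R; rewrite ?normr1 ?normr0.
Qed.

Lemma density_cdf_ge0 t : 0 <= cdf t.
Proof. by apply: Rintegral_ge0 => x _; exact: density_ge0. Qed.

Lemma density_cdf_le1 t : cdf t <= 1.
Proof.
rewrite density_cdfE -[leRHS](_ : \int[leb]_x (rho x) = 1); last first.
  by rewrite /Rintegral density_integral.
apply: le_Rintegral => //.
- exact: integrable_mask density_integrable.
- exact: density_integrable.
- move=> x _; rewrite ler_piMl// ?density_ge0//.
  by case: (x <= t)%R.
Qed.

Lemma measurable_density_cdf : measurable_fun setT cdf.
Proof.
rewrite (_ : cdf = fun t => \int[leb]_x ((x <= t)%R%:R * rho x)).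
  apply: (@measurable_integral_param _ _ _ _ _ leb
    (fun p => (p.2 <= p.1)%R%:R * rho p.2)).
  apply: measurable_funM.
    by apply: measurable_leb_indic; [exact: measurable_snd|exact: measurable_fst].
  exact: (measurableT_comp density_measurable measurable_snd).
by apply/funext => t; exact: density_cdfE.
Qed.

Lemma measurable_anova_kernel d (T : measurableType d) (f g : T -> R) :
  measurable_fun setT f -> measurable_fun setT g ->
  measurable_fun setT (fun p => kap (f p) (g p)).
Proof.
move=> mf mg; apply: measurable_funB.
  exact: (measurableT_comp measurable_density_cdf mg).
exact: measurable_leb_indic.
Qed.

Lemma anova_kernel_norm_le1 x t : `|kap x t| <= 1.
Proof.
rewrite /kap ler_norml; have := density_cdf_ge0 t; have := density_cdf_le1 t.
by case: (x <= t)%R => /= h1 h2; apply/andP; split; lra.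
Qed.

Lemma integrable_anova_kernelM (h : R -> R) t :
  leb.-integrable setT (EFin \o h) ->
  leb.-integrable setT (fun x => (kap x t * h x)%:E).
Proof.
move=> hi; have /measurable_EFinP mh := measurable_int _ hi.
apply: (le_integrable _ _ _ hi) => //.
  apply/measurable_EFinP; apply: measurable_funM.
    by apply: measurable_anova_kernel => //; exact: measurable_cst.
  exact: mh.
by move=> x _ /=; rewrite lee_fin normrM ler_piMl// anova_kernel_norm_le1.
Qed.

(** Two choices of h matter. For h = rho the two terms cancel; for h with integral 0 only minus the
    primitive of h at t remains, so that integrating against kappa is an integration by parts. *)
Lemma integral_anova_kernelM (h : R -> R) t :
  leb.-integrable setT (EFin \o h) ->
  \int[leb]_x (kap x t * h x) =
  cdf t * (\int[leb]_x h x) - \int[leb]_x ((x <= t)%R%:R * h x).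
Proof.
move=> hi; under eq_Rintegral do rewrite /kap mulrBl.
rewrite RintegralB//; last 2 first.
- exact: (integrableZl measurableT (cdf t) hi).
- exact: integrable_mask.
by rewrite RintegralZl.
Qed.

Lemma integral_anova_kernel_density t : \int[leb]_x (kap x t * rho x) = 0.
Proof.
rewrite (integral_anova_kernelM _ density_integrable) -density_cdfE.
by rewrite /Rintegral density_integral mulr1 subrr.
Qed.

(** An indicator equals its square, so kappa^2 = Phi^2 + (1 - 2 Phi) 1(x <= t), with mean Phi^2 + (1
    - 2 Phi) Phi. This is the variance of a Bernoulli variable with parameter Phi(t), and the source
    of the constant C. *)
Lemma integral_sqr_anova_kernel_density t :
  (\int[leb]_x (kap x t ^+ 2 * rho x)%:E = (cdf t * (1 - cdf t))%:E)%E.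
Proof.
have ir := density_integrable.
have im := integrable_mask t ir.
transitivity (\int[leb]_x ((cdf t ^+ 2 * rho x)%:E +
  ((1 - 2 * cdf t) * ((x <= t)%R%:R * rho x))%:E))%E.
  apply: eq_integral => x _; rewrite -EFinD; congr _%:E; rewrite /kap.
  by case: (x <= t)%R => /=; ring.
rewrite integralD_EFin//; last 2 first.
- exact: (integrableZl measurableT (cdf t ^+ 2) ir).
- exact: (integrableZl measurableT (1 - 2 * cdf t) im).
have E1 : (\int[leb]_x (cdf t ^+ 2 * rho x)%:E = (cdf t ^+ 2)%:E)%E.
  under eq_integral do rewrite EFinM.
  by rewrite integralZl// density_integral mule1.
have E2 : (\int[leb]_x ((1 - 2 * cdf t) * ((x <= t)%R%:R * rho x))%:E =
    ((1 - 2 * cdf t) * cdf t)%:E)%E.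
  under eq_integral do rewrite EFinM.
  rewrite integralZl// -(fineK (integrable_fin_num measurableT im)) EFinM.
  by congr (_ * _%:E)%E; rewrite density_cdfE.
by rewrite /= E1 E2 -EFinD; congr _%:E; ring.
Qed.

(** A common majorant, finite by the embedding condition, for C and for the kernel norms at all
    points of [a, b]; for a <= b the two half-lines cover the line. *)
Definition cond_bound (a b : R) : \bar R :=
  (\int[leb]_(t in `]-oo, b]) (cdf t / psi t)%:E +
   \int[leb]_(t in `[a, +oo[) ((1 - cdf t) / psi t)%:E)%E.

Lemma cond_bound_lty a b : (cond_bound a b < +oo)%E.
Proof. by rewrite lte_add_pinfty//; [exact: (hcond b).1|exact: (hcond a).2]. Qed.

Lemma le_cond_bound a b (g : R -> R) : measurable_fun setT g ->
  (forall t, 0 <= g t) ->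
  (forall t, g t <= (t <= b)%R%:R * (cdf t / psi t) +
                    (a <= t)%R%:R * ((1 - cdf t) / psi t)) ->
  (\int[leb]_t (g t)%:E <= cond_bound a b)%E.
Proof.
move=> mg g0 gle.
have p0 t : 0 <= (psi t)^-1 by rewrite invr_ge0 ltW// weight_gt0.
have c0 := density_cdf_ge0.
have c1 t : 0 <= 1 - cdf t by rewrite subr_ge0 density_cdf_le1.
have mip := weightV_measurable.
have mc := measurable_density_cdf.
have m1 : measurable_fun setT (fun t => (t <= b)%R%:R * (cdf t / psi t)).
  apply: measurable_funM; last by mfun.
  by apply: measurable_leb_indic => //; exact: measurable_cst.
have m2 : measurable_fun setT (fun t => (a <= t)%R%:R * ((1 - cdf t) / psi t)).
  apply: measurable_funM; last by mfun.
  by apply: measurable_leb_indic => //; exact: measurable_cst.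
rewrite /cond_bound [X in (_ <= X + _)%E]integral_mkcond [X in (_ <= _ + X)%E]integral_mkcond.
rewrite [X in (_ <= X + _)%E](_ : _ = \int[leb]_t
    ((t <= b)%R%:R * (cdf t / psi t))%:E)%E; last first.
  apply: eq_integral => t _; rewrite patchE mem_setE in_itv/=.
  by case: (t <= b)%R; rewrite ?mul1r ?mul0r.
rewrite [X in (_ <= _ + X)%E](_ : _ = \int[leb]_t
    ((a <= t)%R%:R * ((1 - cdf t) / psi t))%:E)%E; last first.
  apply: eq_integral => t _; rewrite patchE mem_setE in_itv/= andbT.
  by case: (a <= t)%R; rewrite ?mul1r ?mul0r.
have n1 t : 0 <= (t <= b)%R%:R * (cdf t / psi t) by rewrite !mulr_ge0.
have n2 t : 0 <= (a <= t)%R%:R * ((1 - cdf t) / psi t) by rewrite !mulr_ge0.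
rewrite -ge0_integralD//=; last 4 first.
- by move=> t _; rewrite lee_fin.
- by mfun.
- by move=> t _; rewrite lee_fin.
- by mfun.
apply: ge0_le_integral => //=.
- by move=> t _; rewrite lee_fin.
- by mfun.
- by apply: emeasurable_funD; mfun.
- by move=> t _; rewrite -EFinD lee_fin.
Qed.

(** Phi (1 - Phi) is at most Phi on the left of 0 and at most 1 - Phi on the right. *)
Lemma embedding_const_lty : (embedding_const rho psi < +oo)%E.
Proof.
apply: le_lt_trans (cond_bound_lty 0 0).
have p0 t : 0 <= (psi t)^-1 by rewrite invr_ge0 ltW// weight_gt0.
have c0 := density_cdf_ge0.
have c1 := density_cdf_le1.
have mip := weightV_measurable.
have mc := measurable_density_cdf.
apply: le_cond_bound.
- by mfun.
- by move=> t; rewrite !mulr_ge0// subr_ge0.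
move=> t; have := c0 t; have := c1 t; move: (cdf t) => c h1 h0.
rewrite !mulrA -mulrDl ler_wpM2r//.
by case: (leP t 0) => t0 /=; case: (leP 0 t) => t1 /=; nra.
Qed.

(** The squared norm of kappa(x, .) in L^2(1/psi), the constant of a pointwise Cauchy-Schwarz
    estimate. The real-valued integral would read 0 on divergence; [kernel_norm2E] rules this
    out. *)
Definition kernel_norm2 x : R := \int[leb]_t (kap x t ^+ 2 / psi t).

(** On the right of x the kernel is Phi - 1, on the left it is Phi, and both lie in [-1, 1], so the
    squares are at most 1 - Phi and Phi. The bound is uniform for x in [a, b]. *)
Lemma integral_kernel_le x a b : a <= x -> x <= b ->
  (\int[leb]_t (kap x t ^+ 2 / psi t)%:E <= cond_bound a b)%E.
Proof.
move=> ax xb.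
have p0 t : 0 <= (psi t)^-1 by rewrite invr_ge0 ltW// weight_gt0.
have c0 := density_cdf_ge0.
have c1 := density_cdf_le1.
have mip := weightV_measurable.
have mk : measurable_fun setT (kap x).
  by apply: measurable_anova_kernel => //; exact: measurable_cst.
apply: le_cond_bound.
- by mfun.
- by move=> t; rewrite mulr_ge0// sqr_ge0.
move=> t; have := c0 t; have := c1 t; rewrite /kap; move: (cdf t) => c h1 h0.
rewrite !mulrA -mulrDl ler_wpM2r//.
case: (leP x t) => xt /=.
  have -> : (a <= t)%R by rewrite (le_trans ax).
  by case: (t <= b)%R => /=; nra.
have -> : (t <= b)%R by rewrite (le_trans (ltW xt)).
by case: (a <= t)%R => /=; nra.
Qed.

Lemma kernel_norm2E x :
  (\int[leb]_t (kap x t ^+ 2 / psi t)%:E = (kernel_norm2 x)%:E)%E.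
Proof.
rewrite /kernel_norm2 /Rintegral fineK// ge0_fin_numE; last first.
  apply: integral_ge0 => t _.
  by rewrite lee_fin mulr_ge0 ?sqr_ge0// invr_ge0 ltW// weight_gt0.
exact: le_lt_trans (integral_kernel_le (lexx x) (lexx x)) (cond_bound_lty _ _).
Qed.

Lemma kernel_norm2_ge0 x : 0 <= kernel_norm2 x.
Proof.
apply: Rintegral_ge0 => t _.
by rewrite mulr_ge0 ?sqr_ge0// invr_ge0 ltW// weight_gt0.
Qed.

Lemma measurable_sqr_kernel d (T : measurableType d) (f g : T -> R) :
  measurable_fun setT f -> measurable_fun setT g ->
  measurable_fun setT (fun p => kap (f p) (g p) ^+ 2 / psi (g p)).
Proof.
move=> mf mg; apply: measurable_funM.
  by apply: measurable_funX; exact: measurable_anova_kernel.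
exact: (measurableT_comp weightV_measurable mg).
Qed.

Lemma measurable_kernel_norm2 : measurable_fun setT kernel_norm2.
Proof.
apply: (@measurable_integral_param _ _ _ _ _ leb
    (fun p => kap p.1 p.2 ^+ 2 / psi p.2)).
by apply: measurable_sqr_kernel; [exact: measurable_fst|exact: measurable_snd].
Qed.

(** By Tonelli the average over x can be taken first, and the variance identity leaves Phi (1 - Phi)
    / psi. *)
Lemma integral_kernel_norm2 :
  (\int[leb]_x (kernel_norm2 x * rho x)%:E = embedding_const rho psi)%E.
Proof.
have mr := density_measurable.
have mip := weightV_measurable.
have p0 t : 0 <= (psi t)^-1 by rewrite invr_ge0 ltW// weight_gt0.
transitivity (\int[leb]_x \int[leb]_t (kap x t ^+ 2 / psi t * rho x)%:E)%E.
  apply: eq_integral => x _; rewrite EFinM -kernel_norm2E -ge0_integralZr//.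
  - by apply/measurable_EFinP; apply: measurable_sqr_kernel => //; exact: measurable_cst.
  - by move=> t _; rewrite lee_fin mulr_ge0 ?sqr_ge0.
  - by rewrite lee_fin density_ge0.
rewrite (fubini_tonelli (fun p : measurableTypeR R * measurableTypeR R => (kap p.1 p.2 ^+ 2 / psi p.2 * rho p.1)%:E))/=; last 2 first.
- apply/measurable_EFinP; apply: measurable_funM.
    by apply: measurable_sqr_kernel; [exact: measurable_fst|exact: measurable_snd].
  exact: (measurableT_comp mr measurable_fst).
- by move=> p; rewrite lee_fin mulr_ge0 ?density_ge0// mulr_ge0 ?sqr_ge0.
apply: eq_integral => t _.
rewrite EFinM -integral_sqr_anova_kernel_density -ge0_integralZr//.
- by apply: eq_integral => x _; rewrite -EFinM; congr _%:E; ring.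
- apply/measurable_EFinP; apply: measurable_funM => //; apply: measurable_funX.
  by apply: measurable_anova_kernel => //; exact: measurable_cst.
- by move=> x _; rewrite lee_fin mulr_ge0 ?sqr_ge0 ?density_ge0.
- by rewrite lee_fin.
Qed.

(** The uniform bound on [a, b] takes the place of integrability against rho, which does not imply
    local integrability because rho may have no positive lower bound on an interval. *)
Lemma integral_itv_kernel_norm2_lty (a b : R) :
  (\int[leb]_(x in `]a, b[) (kernel_norm2 x)%:E < +oo)%E.
Proof.
apply: (@le_lt_trans _ _ (\int[leb]_(x in `]a, b[) (cst (cond_bound a b) x))%E).
  apply: ge0_le_integral => //.
  - by move=> x _; rewrite lee_fin kernel_norm2_ge0.
  - by apply/measurable_funTS/measurable_EFinP; exact: measurable_kernel_norm2.
  - move=> x; rewrite /= in_itv/= => /andP[ax xb].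
    by rewrite -kernel_norm2E integral_kernel_le// ltW.
rewrite integral_cst//= lebesgue_measure_itv/=.
have := cond_bound_lty a b; rewrite ltey_eq => /orP[foo|/eqP Noo].
  by rewrite ltey_eq fin_numM//; case: ifP.
have : (0 <= cond_bound a b)%E.
  apply: adde_ge0; apply: integral_ge0 => t _; rewrite lee_fin divr_ge0//.
  + exact: density_cdf_ge0.
  + by rewrite ltW// weight_gt0.
  + by rewrite subr_ge0 density_cdf_le1.
  + by rewrite ltW// weight_gt0.
by rewrite Noo.
Qed.

End anova_kernel.

(** * Integration of a single coordinate *)

Section coordinate_integral.
Context {R : realType} {n : nat}.
Variable rho : 'I_n -> R -> R.
Hypothesis hrho : forall j, positive_density (rho j).
Local Notation lam := (lebesgueV n).
Local Notation leb := (@lebesgue_measure R).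
Local Notation wp := weight_prod.
Local Notation ST := [set: 'I_n]%SET.
Local Open Scope ereal_scope.

Let mrho j : measurable_fun setT (rho j). Proof. exact: density_measurable. Qed.
Let rho0 j t : (0 <= rho j t)%R. Proof. exact: density_ge0. Qed.
Let rho1 j : \int[leb]_t (rho j t)%:E = 1. Proof. exact: density_integral. Qed.

Lemma weight_prod1 (h : 'I_n -> R -> R) (j : 'I_n) (x : 'rV[R]_n) :
  wp h [set j]%SET x = h j (x 0%R j).
Proof. by rewrite /weight_prod finset.big_set1. Qed.

(** Weighting the remaining coordinates by rho lets a one-dimensional integral be written over
    R^n. *)
Lemma ge0_integral_coordinate_density (a : R -> R) j :
  measurable_fun setT a -> (forall t, (0 <= a t)%R) ->
  \int[lam]_y (a (y 0%R j) * wp rho (~: [set j]) y)%:E = \int[leb]_t (a t)%:E.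
Proof.
move=> ma a0.
have := ge0_integral_weight_prod_density mrho rho0 rho1 [set j]%SET
  (fun=> ma) (fun=> a0).
rewrite finset.big_set1 => <-; apply: eq_integral => y _.
by rewrite weight_prod1.
Qed.

Lemma integrable_coordinate_density (a : R -> R) j :
  leb.-integrable setT (EFin \o a) ->
  lam.-integrable setT (fun y => (a (y 0%R j) * wp rho (~: [set j]) y)%:E).
Proof.
move=> /integrableP[/measurable_EFinP ma ai]; apply/integrableP; split.
  by mfun.
rewrite (le_lt_trans _ ai)// -(@ge0_integral_coordinate_density (fun t => `|a t|%R) j)//.
- rewrite le_eqVlt; apply/orP; left; apply/eqP; apply: eq_integral => y _ /=.
  by rewrite normrM [X in (_ * X)%R]ger0_norm// weight_prod_ge0.
- by mfun.
Qed.

Lemma integral_coordinate_density (a : R -> R) j :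
  measurable_fun setT a ->
  \int[lam]_y (a (y 0%R j) * wp rho (~: [set j]) y)%:E = \int[leb]_t (a t)%:E.
Proof.
move=> ma; have w0 y : (0 <= wp rho (~: [set j]) y)%R by exact: weight_prod_ge0.
rewrite [LHS]integralE [RHS]integralE.
have pos : \int[lam]_y (fun y : 'rV[R]_n => (a (y 0%R j) * wp rho (~: [set j]) y)%:E)^\+ y =
    \int[leb]_t (EFin \o a)^\+ t.
  rewrite -[RHS](_ : \int[leb]_t (Num.max (a t) 0)%:E = _); last first.
    by apply: eq_integral => t _; rewrite funeposE EFin_max.
  rewrite -(@ge0_integral_coordinate_density _ j); last 2 first.
  - by apply: measurable_maxr => //; exact: measurable_cst.
  - by move=> t; rewrite le_max lexx orbT.
  apply: eq_integral => y _; rewrite funeposE -EFin_max; congr _%:E.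
  by rewrite maxr_pMl// mul0r.
have neg : \int[lam]_y (fun y : 'rV[R]_n => (a (y 0%R j) * wp rho (~: [set j]) y)%:E)^\- y =
    \int[leb]_t (EFin \o a)^\- t.
  rewrite -[RHS](_ : \int[leb]_t (Num.max (- a t) 0)%:E = _); last first.
    by apply: eq_integral => t _; rewrite funenegE EFin_max.
  rewrite -(@ge0_integral_coordinate_density _ j); last 2 first.
  - by apply: measurable_maxr; [mfun|exact: measurable_cst].
  - by move=> t; rewrite le_max lexx orbT.
  apply: eq_integral => y _; rewrite funenegE -EFinN -EFin_max; congr _%:E.
  by rewrite maxr_pMl// mul0r mulNr.
by congr (_ + - _); [exact: pos|exact: neg].
Qed.

Lemma integrable_density : lam.-integrable setT (fun y => (wp rho ST y)%:E).
Proof.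
apply/integrableP; split; first by mfun.
under eq_integral do rewrite gee0_abs ?lee_fin ?weight_prod_ge0//.
by rewrite integral_density// ltry.
Qed.

(* Integrating out the coordinate [j], on which [c] does not depend, and
   integrating it back against [rho j], avoids splitting the space. *)
Lemma integral_coordinate (c : 'rV[R]_n -> R) (a : R -> R) (j : 'I_n) :
  measurable_fun setT c -> (forall x y, c (mix (~: [set j]) x y) = c x) ->
  leb.-integrable setT (EFin \o a) ->
  lam.-integrable setT (fun x => (c x * a (x 0%R j))%:E) ->
  \int[lam]_x (c x * a (x 0%R j))%:E =
  \int[lam]_x (c x * (rho j (x 0%R j) * \int[leb]_t a t))%:E.
Proof.
move=> mc cj ai cai; have /measurable_EFinP ma := measurable_int _ ai.
pose H (p : 'rV[R]_n * 'rV[R]_n) := (c p.1 * a (p.1 0%R j) * wp rho ST p.2)%:E.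
have mH : measurable_fun setT H by rewrite /H; mfun.
have iH : (lam \x lam).-integrable setT H.
  apply/integrable12ltyP => //=.
  rewrite [ltLHS](_ : _ = \int[lam]_x `|(c x * a (x 0%R j))%:E|).
    by have /integrableP[] := cai.
  apply: eq_integral => x _.
  rewrite -[RHS]mule1 -(integral_density mrho rho0 rho1) -ge0_integralZl//=; last 2 first.
  - by mfun.
  - by move=> y _; rewrite lee_fin weight_prod_ge0.
  apply: eq_integral => y _; rewrite normrM EFinM; congr (_ * _%:E).
  by rewrite ger0_norm// weight_prod_ge0.
transitivity (\int[lam]_x \int[lam]_y H (x, y)).
  apply: eq_integral => x _; rewrite /H/=.
  under eq_integral do rewrite EFinM.
  by rewrite integralZl ?integral_density ?mule1//; exact: integrable_density.
rewrite (integral_swap (~: [set j]) iH); apply: eq_integral => x _; rewrite /H/=.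
have jJ : j \notin ~: [set j] by rewrite !inE eqxx.
transitivity (\int[lam]_y ((c x * rho j (x 0%R j))%:E *
    (a (y 0%R j) * wp rho (~: [set j]) y)%:E)).
  apply: eq_integral => y _; rewrite -EFinM; congr _%:E.
  rewrite cj mixE (negbTE jJ) -(weight_prodC _ (~: [set j])).
  rewrite (weight_prod_mix_in _ _ _ (subxx _)) finset.setCK.
  rewrite weight_prod1 mixE (negbTE jJ).
  by ring.
rewrite integralZl//; last exact: integrable_coordinate_density.
rewrite integral_coordinate_density// -(fineK (integrable_fin_num measurableT ai)).
by rewrite -EFinM mulrA.
Qed.

End coordinate_integral.

(** * ANOVA terms *)

Section anova_terms.
Context {R : realType} {n : nat}.
Variables rho psi : 'I_n -> R -> R.
Hypothesis hrho : forall j, positive_density (rho j).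
Hypothesis hpsi : forall j, positive_weight (psi j).
Hypothesis hcond : forall j, embedding_condition (rho j) (psi j).
Local Notation lam := (lebesgueV n).
Local Notation leb := (@lebesgue_measure R).
Local Notation wp := weight_prod.
Local Notation ST := [set: 'I_n]%SET.
Local Open Scope ereal_scope.
Implicit Types (u w v : {set 'I_n}) (F : 'rV[R]_n -> R).

Let mrho j : measurable_fun setT (rho j). Proof. exact: density_measurable. Qed.
Let rho0 j t : (0 <= rho j t)%R. Proof. exact: density_ge0. Qed.
Let rho1 j : \int[leb]_t (rho j t)%:E = 1. Proof. exact: density_integral. Qed.
Let mpsi j : measurable_fun setT (psi j). Proof. exact: weight_measurable. Qed.
Let mpsiV j : measurable_fun setT (fun t => (psi j t)^-1)%R.
Proof. exact: weightV_measurable. Qed.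
Let psi0 j t : (0 < psi j t)%R. Proof. exact: weight_gt0. Qed.
Let psi0' j t : (0 <= psi j t)%R. Proof. exact: ltW. Qed.

Definition kernelV w (x t : 'rV[R]_n) : R :=
  \prod_(j in w) anova_kernel (rho j) (x 0%R j) (t 0%R j).

Definition kernel_norm2V w : 'rV[R]_n -> R :=
  wp (fun j => kernel_norm2 (rho j) (psi j)) w.

(** The point t ranges over all of R^n: its coordinates outside w carry rho, of mass 1, so when F
    depends on x_(u+w) only, this amounts to the integrand over t_w. *)
Definition anova_integrand u w F (p : 'rV[R]_n * 'rV[R]_n) : R :=
  (F (mix u p.1 p.2) * (kernelV w p.1 p.2 * wp rho (~: w) p.2))%R.

Definition anova_term u w F (x : 'rV[R]_n) : R :=
  (\int[lam]_t anova_integrand u w F (x, t))%R.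

(** When F depends on x_v only, the weight rho on the other variables integrates to 1, so one
    functional expresses the summands of both norms. *)
Definition weighted_norm2 v F : \bar R :=
  \int[lam]_x (F x ^+ 2 * (wp psi v x * wp rho (~: v) x))%:E.

Lemma measurable_kernelV d (T : measurableType d) w (f g : T -> 'rV[R]_n) :
  measurable_fun setT f -> measurable_fun setT g ->
  measurable_fun setT (fun p => kernelV w (f p) (g p)).
Proof.
move=> mf mg; apply: measurable_prod_in => j.
by apply: measurable_anova_kernel => //; mfun.
Qed.

Lemma kernel_norm2V_ge0 w x : (0 <= kernel_norm2V w x)%R.
Proof. by apply: weight_prod_ge0 => j t; exact: kernel_norm2_ge0. Qed.

Lemma measurable_kernel_norm2V w : measurable_fun setT (kernel_norm2V w).
Proof.
apply: measurable_weight_prod; last exact: measurable_id.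
by move=> j; exact: measurable_kernel_norm2.
Qed.

Section one_term.
Variables (u w : {set 'I_n}) (F : 'rV[R]_n -> R).
Hypothesis mF : measurable_fun setT F.
Hypothesis uw : [disjoint u & w]%B.

Lemma measurable_anova_integrand : measurable_fun setT (anova_integrand u w F).
Proof.
rewrite /anova_integrand; apply: measurable_funM; first by mfun.
by apply: measurable_funM; [apply: measurable_kernelV; mfun|mfun].
Qed.

Lemma measurable_anova_term : measurable_fun setT (anova_term u w F).
Proof. exact: (measurable_integral_param _ measurable_anova_integrand). Qed.

(** Extended-real and without cancellation: its bounds provide the integrability on which the uses
    of Fubini for [anova_term] rest. *)
Definition anova_abs (x : 'rV[R]_n) : \bar R :=
  \int[lam]_t `|anova_integrand u w F (x, t)|%:E.

(** The squared norm of t -> F(x_u, t) in L^2(psi_w rho_(~w)); it depends on x through x_u only. *)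
Definition fiber_norm2 (x : 'rV[R]_n) : \bar R :=
  \int[lam]_t (F (mix u x t) ^+ 2 * (wp psi w t * wp rho (~: w) t))%:E.

Lemma measurable_anova_abs : measurable_fun setT anova_abs.
Proof.
apply: (@measurable_eintegral_param _ _ _ _ _ _ (fun p : 'rV[R]_n * 'rV[R]_n =>
  `|anova_integrand u w F p|%R)).
by apply: measurable_norm_comp; exact: measurable_anova_integrand.
Qed.

Lemma anova_abs_ge0 x : 0 <= anova_abs x.
Proof. by apply: integral_ge0 => t _; rewrite lee_fin. Qed.

Lemma measurable_fiber_norm2 : measurable_fun setT fiber_norm2.
Proof.
apply: (@measurable_eintegral_param _ _ _ _ _ _ (fun p : 'rV[R]_n * 'rV[R]_n =>
  (F (mix u p.1 p.2) ^+ 2 * (wp psi w p.2 * wp rho (~: w) p.2))%R)).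
by mfun.
Qed.

Lemma fiber_norm2_ge0 x : 0 <= fiber_norm2 x.
Proof.
apply: integral_ge0 => t _.
by rewrite lee_fin mulr_ge0 ?sqr_ge0// mulr_ge0// weight_prod_ge0.
Qed.

Lemma fiber_norm2_mix x y : fiber_norm2 (mix u x y) = fiber_norm2 x.
Proof.
apply: eq_integral => t _; rewrite (_ : mix u _ _ = mix u x t)//.
by apply/rowP => j; rewrite !mixE; case: (j \in u).
Qed.

(** Cauchy-Schwarz for F sqrt(psi_w rho_(~w)) and kernel sqrt(rho_(~w) / psi_w). The second square
    is a product over the coordinates, so its integral is the product of the one-variable kernel
    norms. *)
Lemma anova_abs_sqr_le x :
  anova_abs x * anova_abs x <= fiber_norm2 x * (kernel_norm2V w x)%:E.
Proof.
pose f t := (F (mix u x t) * Num.sqrt (wp psi w t * wp rho (~: w) t))%R.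
pose g t := (kernelV w x t *
  Num.sqrt (wp (fun j t => (psi j t)^-1) w t * wp rho (~: w) t))%R.
have msqrt : measurable_fun setT (@Num.sqrt R).
  by apply: continuous_measurable_fun; exact: sqrt_continuous.
have mf : measurable_fun setT f by rewrite /f; mfun.
have mg : measurable_fun setT g.
  rewrite /g; apply: measurable_funM; last by mfun.
  by apply: measurable_kernelV => //; exact: measurable_cst.
have ip0 t : (0 <= wp (fun j t => (psi j t)^-1) w t)%R.
  by apply: weight_prod_ge0 => j s; rewrite invr_ge0.
have ipE t : (wp (fun j t => (psi j t)^-1) w t = (wp psi w t)^-1)%R.
  by rewrite /weight_prod prodfV.
have -> : anova_abs x = \int[lam]_t `|f t * g t|%:E.
  apply: eq_integral => t _; congr (`|_|%:E).
  rewrite /f /g /anova_integrand/= mulrACA -sqrtrM; last first.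
    by rewrite mulr_ge0// weight_prod_ge0.
  rewrite ipE [X in Num.sqrt X](_ : _ = (wp rho (~: w) t) ^+ 2)%R; last first.
    by field; rewrite gt_eqF// weight_prod_gt0.
  by rewrite sqrtr_sqr ger0_norm ?weight_prod_ge0// mulrA.
apply: (le_trans (integral_cauchy_schwarz _ mf mg)).
rewrite le_eqVlt; apply/orP; left; apply/eqP; congr (_ * _).
  apply: eq_integral => t _; congr _%:E.
  by rewrite /f exprMn sqr_sqrtr// mulr_ge0// weight_prod_ge0.
transitivity (\int[lam]_t (wp (fun j s => anova_kernel (rho j) (x 0 j) s ^+ 2 / psi j s) w t *
    wp rho (~: w) t)%:E).
  apply: eq_integral => t _; congr _%:E.
  rewrite /g exprMn sqr_sqrtr; last by rewrite mulr_ge0// weight_prod_ge0.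
  by rewrite mulrA; congr (_ * _)%R; rewrite /kernelV -prodrXl -big_split.
rewrite ge0_integral_weight_prod_density//; last 2 first.
- by move=> j; apply: measurable_sqr_kernel => //; exact: measurable_cst.
- by move=> j t; rewrite mulr_ge0 ?sqr_ge0// invr_ge0.
rewrite /kernel_norm2V /weight_prod -prodEFin; apply: eq_bigr => j _.
exact: kernel_norm2E.
Qed.

Lemma integral_fiber_norm2 :
  \int[lam]_x (fiber_norm2 x * (wp psi u x * wp rho (~: u) x)%:E) =
  weighted_norm2 (u :|: w) F.
Proof.
(* One weight for all coordinates: psi on u+w and rho elsewhere. Its factors in u stay with x, the
   others go to the second point t. *)
pose c j := if j \in u :|: w then psi j else rho j.
have cu x : wp c u x = wp psi u x.
  by apply: eq_bigr => j ju; rewrite /c inE ju.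
have cST x : (wp c ST x = wp psi (u :|: w) x * wp rho (~: (u :|: w)) x)%R.
  rewrite -(weight_prodC c (u :|: w)); congr (_ * _)%R; apply: eq_bigr => j.
    by rewrite /c => ->.
  by rewrite inE /c => /negbTE ->.
have cCu x : (wp c (~: u) x * wp rho u x = wp psi w x * wp rho (~: w) x)%R.
  have -> : ~: u = w :|: ~: (u :|: w).
    apply/setP => j; rewrite !inE; have := disjointFr uw (x := j).
    by case: (j \in u) => //=; [move=> ->|case: (j \in w)].
  have -> : ~: w = u :|: ~: (u :|: w).
    apply/setP => j; rewrite !inE; have := disjointFl uw (x := j).
    by case: (j \in w) => //=; [move=> ->|case: (j \in u)].
  rewrite !weight_prodU; last 2 first.
  - by rewrite finset.disjoints_subset finset.setCK finset.subsetUl.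
  - by rewrite finset.disjoints_subset finset.setCK finset.subsetUr.
  have -> : wp c w x = wp psi w x.
    by apply: eq_bigr => j jw; rewrite /c inE jw orbT.
  have -> : wp c (~: (u :|: w)) x = wp rho (~: (u :|: w)) x.
    by apply: eq_bigr => j; rewrite inE /c => /negbTE ->.
  by ring.
have mc j : measurable_fun setT (c j) by rewrite /c; case: (j \in _).
have c0 j t : (0 <= c j t)%R by rewrite /c; case: (j \in _).
rewrite /weighted_norm2; under [RHS]eq_integral do rewrite -cST.
rewrite -(@ge0_integral_marginal _ _ _ mrho rho0 rho1 (fun x => F x ^+ 2)%R _ u)//; last 2 first.
- by mfun.
- by move=> x; rewrite sqr_ge0.
apply: eq_integral => x _; rewrite /fiber_norm2 -ge0_integralZr//; last 3 first.
- by mfun.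
- by move=> t _; rewrite lee_fin mulr_ge0 ?sqr_ge0// mulr_ge0// weight_prod_ge0.
- by rewrite lee_fin mulr_ge0// weight_prod_ge0.
apply: eq_integral => t _; rewrite -EFinM; congr _%:E.
by rewrite cu cCu; ring.
Qed.

Hypothesis NF : weighted_norm2 (u :|: w) F < +oo.

(** [fiber_norm2] depends on x_u only and M on the other variables, so the integral factors. M stays
    general because it is a kernel norm times rho in the weighted bound and the indicator of a box
    in the local one. *)
Lemma ge0_integral_fiber_indep (M : 'rV[R]_n -> R) :
  measurable_fun setT M -> (forall x, (0 <= M x)%R) ->
  (forall x y, M (mix u x y) = M y) ->
  \int[lam]_x (fiber_norm2 x * (wp psi u x * M x)%:E) =
  weighted_norm2 (u :|: w) F * \int[lam]_x (M x * wp rho u x)%:E.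
Proof.
move=> mM M0 Mu; rewrite -integral_fiber_norm2.
under [X in X * _]eq_integral do rewrite EFinM muleA.
under [X in _ * X]eq_integral do rewrite EFinM.
rewrite -(@ge0_integral_indep _ _ _ mrho rho0 rho1 _ _ u).
- by apply: eq_integral => x _; rewrite EFinM muleA.
- by apply: emeasurable_funM; [exact: measurable_fiber_norm2|mfun].
- by move=> x; rewrite mule_ge0 ?fiber_norm2_ge0// lee_fin weight_prod_ge0.
- exact/measurable_EFinP.
- by move=> x; rewrite lee_fin.
- by move=> x y; rewrite fiber_norm2_mix weight_prod_mix_in.
- by move=> x y; rewrite Mu.
Qed.

Lemma kernel_norm2V_mix x y : kernel_norm2V w (mix u x y) = kernel_norm2V w y.
Proof. by rewrite /kernel_norm2V weight_prod_mix_out// disjoint_sym. Qed.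

Lemma integral_kernel_norm2V :
  \int[lam]_x (kernel_norm2V w x * wp rho ST x)%:E =
  \prod_(j in w) embedding_const (rho j) (psi j).
Proof.
transitivity (\int[lam]_x (wp (fun j t => kernel_norm2 (rho j) (psi j) t * rho j t)%R w x *
   wp rho (~: w) x)%:E).
  apply: eq_integral => x _; congr _%:E.
  rewrite -(weight_prodC rho w) mulrA; congr (_ * _)%R.
  by rewrite /kernel_norm2V /weight_prod -big_split.
rewrite ge0_integral_weight_prod_density//.
- by apply: eq_bigr => j _; exact: integral_kernel_norm2.
- by move=> j; apply: measurable_funM => //; exact: measurable_kernel_norm2.
- by move=> j t; rewrite mulr_ge0// kernel_norm2_ge0.
Qed.

(** [kernel_norm2V w] lives on w, disjoint from u, so the pointwise bound factors under the
    integral, and the average of the kernel norms is the product of the constants C. As the bound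
    concerns the absolute integral, it also yields integrability. *)
Lemma integral_anova_abs_sqr_le :
  \int[lam]_x (anova_abs x * anova_abs x * (wp psi u x * wp rho (~: u) x)%:E) <=
  (\prod_(j in w) embedding_const (rho j) (psi j)) * weighted_norm2 (u :|: w) F.
Proof.
have mk := measurable_kernel_norm2V w.
have w0 (x : 'rV[R]_n) : (0 <= wp psi u x * wp rho (~: u) x)%R.
  by rewrite mulr_ge0// weight_prod_ge0.
apply: (@le_trans _ _ (\int[lam]_x (fiber_norm2 x *
    (wp psi u x * (kernel_norm2V w x * wp rho (~: u) x))%:E))).
  apply: ge0_le_integral => //.
  - by move=> x _; rewrite !mule_ge0// ?anova_abs_ge0// lee_fin.
  - apply: emeasurable_funM; last by mfun.
    by apply: emeasurable_funM; exact: measurable_anova_abs.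
  - by apply: emeasurable_funM; [exact: measurable_fiber_norm2|mfun].
  - move=> x _; rewrite [X in _ <= _ * X](_ : _ = (kernel_norm2V w x)%:E *
      (wp psi u x * wp rho (~: u) x)%:E); last by rewrite -EFinM; congr _%:E; ring.
    by rewrite muleA lee_wpmul2r// ?lee_fin// anova_abs_sqr_le.
rewrite ge0_integral_fiber_indep; last 3 first.
- by mfun.
- by move=> x; rewrite mulr_ge0 ?kernel_norm2V_ge0// weight_prod_ge0.
- move=> x y; rewrite kernel_norm2V_mix weight_prod_mix_out//.
  by rewrite finset.disjoints_subset.
rewrite muleC -integral_kernel_norm2V; apply: lee_wpmul2r.
  apply: integral_ge0 => x _.
  by rewrite lee_fin mulr_ge0 ?sqr_ge0// mulr_ge0// weight_prod_ge0.
rewrite le_eqVlt; apply/orP; left; apply/eqP; apply: eq_integral => x _.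
by congr _%:E; rewrite -(weight_prodC rho u); ring.
Qed.

End one_term.
End anova_terms.

Section parameter_integral_factor.
Context d1 d2 (T1 : measurableType d1) (T2 : measurableType d2) (R : realType).
Variable m1 : {sigma_finite_measure set T1 -> \bar R}.
Variable m2 : {sigma_finite_measure set T2 -> \bar R}.
Local Open Scope ereal_scope.

Lemma normr_Rintegral_le d (T : measurableType d) (mu : {measure set T -> \bar R})
    (f : T -> R) : measurable_fun setT f ->
  `|\int[mu]_x f x|%R%:E <= \int[mu]_x `|f x|%:E.
Proof.
move=> /measurable_EFinP mf.
apply: le_trans (le_abse_integral mu measurableT mf).
by rewrite /Rintegral; case: (integral _ _ _) => [r||] /=; rewrite ?normr0 ?leey.
Qed.

Lemma Rintegral_factor d (T : measurableType d) (mu : {measure set T -> \bar R})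
    (f : T -> R) (c : R) :
  mu.-integrable setT (fun x => (f x * c)%:E) ->
  ((\int[mu]_x f x)%R * c)%:E = \int[mu]_x (f x * c)%:E.
Proof.
(* For c = 0 the hypothesis says nothing about f, but both sides vanish; otherwise f itself is
   integrable. *)
have [->|c0] := eqVneq c 0%R.
  by move=> _; rewrite mulr0; under [RHS]eq_integral do rewrite mulr0; rewrite integral0.
move=> fci; have fi : mu.-integrable setT (EFin \o f).
  rewrite (_ : EFin \o f = fun x => (c^-1)%:E * (f x * c)%:E); last first.
    by apply/funext => x /=; rewrite -EFinM; congr _%:E; field.
  exact: integrableZl.
rewrite EFinM; under [RHS]eq_integral do rewrite EFinM.
rewrite integralZr//; congr (_ * _).
by rewrite /Rintegral fineK//; exact: integrable_fin_num.
Qed.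

(** The real-valued inner integral takes a default value where a section is not integrable; Fubini
    confines the points where this matters to a null set. *)
Lemma integral_param_factor (h : T1 * T2 -> R) (g : T1 -> R) :
  measurable_fun setT h -> measurable_fun setT g ->
  (m1 \x m2).-integrable setT (fun p => (h p * g p.1)%:E) ->
  \int[m1]_x ((\int[m2]_y h (x, y))%R * g x)%:E =
  \int[m1]_x \int[m2]_y (h (x, y) * g x)%:E.
Proof.
move=> mh mg hi; apply: ae_eq_integral => //.
- by apply/measurable_EFinP; apply: measurable_funM => //; exact: measurable_integral_param.
- exact: (measurable_fubini_F hi).
- have := ae_integrable1 hi; apply: filterS => x hx _.
  exact: Rintegral_factor.
Qed.

End parameter_integral_factor.

(** * Integrability of the ANOVA terms over boxes *)

Section anova_terms_box.
Context {R : realType} {n : nat}.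
Variables rho psi : 'I_n -> R -> R.
Hypothesis hrho : forall j, positive_density (rho j).
Hypothesis hpsi : forall j, positive_weight (psi j).
Hypothesis hcond : forall j, embedding_condition (rho j) (psi j).
Local Notation lam := (lebesgueV n).
Local Notation leb := (@lebesgue_measure R).
Local Notation wp := weight_prod.
Local Notation ST := [set: 'I_n]%SET.
Local Open Scope ereal_scope.
Let mrho j : measurable_fun setT (rho j). Proof. exact: density_measurable. Qed.
Let rho0 j t : (0 <= rho j t)%R. Proof. exact: density_ge0. Qed.
Let rho1 j : \int[leb]_t (rho j t)%:E = 1. Proof. exact: density_integral. Qed.
Let mpsi j : measurable_fun setT (psi j). Proof. exact: weight_measurable. Qed.
Let mpsiV j : measurable_fun setT (fun t => (psi j t)^-1)%R.
Proof. exact: weightV_measurable. Qed.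
Let psi0 j t : (0 < psi j t)%R. Proof. exact: weight_gt0. Qed.
Let psi0' j t : (0 <= psi j t)%R. Proof. exact: ltW. Qed.

(** The sides are kept as separate functions of one variable, so that [weight_prod] over all
    coordinates is the indicator of the box and a single side can be replaced. *)
Definition oobox (a b : 'I_n -> R) (j : 'I_n) : R -> R := \1_`]a j, b j[%classic.

Lemma measurable_oobox a b j : measurable_fun setT (oobox a b j).
Proof. by apply: measurable_indic; exact: measurable_itv. Qed.

Lemma oobox_ge0 a b j t : (0 <= oobox a b j t)%R.
Proof. by rewrite /oobox indicE. Qed.

Lemma oobox_le1 a b j t : (oobox a b j t <= 1)%R.
Proof. by rewrite /oobox indicE; case: (_ \in _). Qed.

Lemma oobox_prod_le1 a b u x : (wp (oobox a b) u x <= 1)%R.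
Proof.
by apply: prodr_ile1 => j; rewrite oobox_ge0 oobox_le1.
Qed.

Lemma integral_oobox_lty a b j : \int[leb]_t (oobox a b j t)%:E < +oo.
Proof.
rewrite integral_indic//= setIT lebesgue_measure_itv/=.
by case: ifP => //; rewrite ltry.
Qed.

Lemma integrable_oobox a b j : leb.-integrable setT (EFin \o oobox a b j).
Proof.
apply/integrableP; split; first by apply/measurable_EFinP; exact: measurable_oobox.
under eq_integral do rewrite /= ger0_norm ?oobox_ge0//.
exact: integral_oobox_lty.
Qed.

(** The local integrability of 1/psi_j enters here, on the compact interval [a_j, b_j]. *)
Lemma integral_weightV_oobox_lty a b j :
  \int[leb]_t ((psi j t)^-1 * oobox a b j t)%:E < +oo.
Proof.
have [_ _ [_ _ /(_ `[a j, b j]%classic)]] := hpsi j.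
move=> /(_ (@subsetT _ _) (@segment_compact _ _ _)).
have mo := measurable_oobox a b; have mpj := mpsiV j.
apply: le_lt_trans; rewrite [leRHS]integral_mkcond.
apply: ge0_le_integral => //.
- by move=> t _; rewrite lee_fin mulr_ge0 ?invr_ge0 ?oobox_ge0.
- by mfun.
- apply/(measurable_restrictT _ _).1 => //.
  by apply/measurable_funTS/measurable_EFinP/measurable_norm_comp.
move=> t _; rewrite patchE mem_setE /oobox indicE mem_setE !in_itv/=.
have ip : (0 <= (psi j t)^-1)%R by rewrite invr_ge0.
case: (ltP (a j) t) => at_ /=.
  case: (ltP t (b j)) => tb /=.
    by rewrite (ltW at_) (ltW tb)/= mulr1 lee_fin ger0_norm.
  by rewrite mulr0; case: ifP; rewrite ?lee_fin.
by rewrite mulr0; case: ifP; rewrite ?lee_fin.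
Qed.

Lemma integral_kernel_norm2_oobox_lty a b j :
  \int[leb]_t (kernel_norm2 (rho j) (psi j) t * oobox a b j t)%:E < +oo.
Proof.
apply: le_lt_trans (integral_itv_kernel_norm2_lty (hrho j) (hpsi j) (hcond j) (a j) (b j)).
rewrite [leRHS]integral_mkcond le_eqVlt; apply/orP; left; apply/eqP.
apply: eq_integral => t _; rewrite patchE /oobox indicE.
by case: (_ \in _); rewrite ?mulr1 ?mulr0.
Qed.

Section one_term.
Variables (u w : {set 'I_n}) (F : 'rV[R]_n -> R).
Hypothesis mF : measurable_fun setT F.
Hypothesis uw : [disjoint u & w]%B.
Hypothesis NF : weighted_norm2 rho psi (u :|: w) F < +oo.
Local Notation T := (anova_term rho u w F).
Local Notation TI := (anova_integrand rho u w F).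
Local Notation TA := (anova_abs rho u w F).

(** Cauchy-Schwarz bounds the square by a product, which the factor psi_u splits into psi_u
    fiber_norm2 + kernel_norm2V / psi_u. The first summand is controlled by the weighted norm of F
    times the volume of the sides outside u; the second is a product over the coordinates of locally
    integrable functions. *)
Lemma integral_anova_abs_box a b :
  \int[lam]_x (TA x * (wp (oobox a b) ST x)%:E) < +oo.
Proof.
(* The factors of the second summand: kernel norms on w, 1/psi on u, 1 elsewhere, each cut off to
   its side of the box. *)
pose h j t := ((if j \in w then kernel_norm2 (rho j) (psi j) t
                else if j \in u then (psi j t)^-1 else 1) * oobox a b j t)%R.
have mo := measurable_oobox a b.
have mk := measurable_kernel_norm2V hrho hpsi w.
have mh j : measurable_fun setT (h j).
  rewrite /h; apply: measurable_funM => //.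
  case: (j \in w); first exact: measurable_kernel_norm2.
  by case: (j \in u) => //; exact: measurable_cst.
have h0 j t : (0 <= h j t)%R.
  rewrite mulr_ge0 ?oobox_ge0//; case: ifP => _; first exact: kernel_norm2_ge0.
  by case: ifP; rewrite ?invr_ge0.
have hE x : wp h ST x =
    (kernel_norm2V rho psi w x / wp psi u x * wp (oobox a b) ST x)%R.
  rewrite /weight_prod big_split/=; congr (_ * _)%R.
  rewrite /kernel_norm2V /weight_prod -prodfV big_mkcond [X in (_ * X)%R]big_mkcond.
  rewrite [X in (X * _)%R]big_mkcond -big_split/=; apply: eq_bigr => j _.
  rewrite inE; have := disjointFl uw (x := j).
  by case: (j \in w) => [-> //|_]; rewrite ?mulr1 ?mul1r//.
pose M := wp (oobox a b) (~: u).
have M0 x : (0 <= M x)%R by apply: weight_prod_ge0 => j t; exact: oobox_ge0.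
have mM : measurable_fun setT M by rewrite /M; mfun.
apply: (@le_lt_trans _ _ (\int[lam]_x (fiber_norm2 rho psi u w F x * (wp psi u x * M x)%:E
    + (wp h ST x)%:E))).
  apply: ge0_le_integral => //.
  - by move=> x _; rewrite mule_ge0 ?anova_abs_ge0// lee_fin weight_prod_ge0.
  - apply: emeasurable_funM; last by mfun.
    exact: measurable_anova_abs.
  - apply: emeasurable_funD; last by mfun.
    apply: emeasurable_funM; first exact: measurable_fiber_norm2.
    by mfun.
  - move=> x _.
    have b0 : (0 <= wp (oobox a b) ST x)%R.
      by apply: weight_prod_ge0 => j t; exact: oobox_ge0.
    have k0 : (0 <= kernel_norm2V rho psi w x)%R by exact: kernel_norm2V_ge0.
    have f0 : 0 <= fiber_norm2 rho psi u w F x by exact: fiber_norm2_ge0.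
    have CS : TA x * TA x <=
        fiber_norm2 rho psi u w F x * (kernel_norm2V rho psi w x)%:E.
      exact: anova_abs_sqr_le.
    have := lee_mul_am_gm (weight_prod_gt0 u x psi0) k0 (anova_abs_ge0 rho u w F x) f0 CS.
    move=> /(lee_wpmul2r (x := (wp (oobox a b) ST x)%:E)).
    rewrite lee_fin => /(_ b0)/le_trans; apply.
    rewrite ge0_muleDl; last 2 first.
    + by rewrite mule_ge0// lee_fin weight_prod_ge0.
    + by rewrite lee_fin divr_ge0 ?kernel_norm2V_ge0 ?weight_prod_ge0.
    (* The sides of the box in u are bounded by 1 and dropped, so that the factor left beside psi_u
       depends only on the variables outside u. *)
    rewrite -EFinM -hE leeD2r// muleAC -EFinM muleC lee_wpmul2l// lee_fin.
    rewrite ler_wpM2l ?weight_prod_ge0// -(weight_prodC _ u) ler_piMl//.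
    + exact: M0.
    + exact: oobox_prod_le1.
rewrite ge0_integralD//; last 4 first.
- by move=> x _; rewrite mule_ge0 ?fiber_norm2_ge0// lee_fin mulr_ge0// weight_prod_ge0.
- by apply: emeasurable_funM; [exact: measurable_fiber_norm2|mfun].
- by move=> x _; rewrite lee_fin weight_prod_ge0.
- by mfun.
rewrite lte_add_pinfty//.
- rewrite (ge0_integral_fiber_indep hrho hpsi)//; last first.
    by move=> x y; rewrite /M weight_prod_mix_out// finset.disjoints_subset.
  rewrite lte_mul_pinfty//.
  + by apply: integral_ge0 => x _; rewrite lee_fin mulr_ge0 ?sqr_ge0// mulr_ge0// weight_prod_ge0.
  + rewrite ge0_fin_numE//.
    by apply: integral_ge0 => x _; rewrite lee_fin mulr_ge0 ?sqr_ge0// mulr_ge0// weight_prod_ge0.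
  have := @ge0_integral_weight_prod_density _ _ _ mrho rho0 rho1 (oobox a b) (~: u) mo.
  rewrite finset.setCK => ->; last by move=> j t; exact: oobox_ge0.
  rewrite ltey_eq prode_fin_num// => j _; rewrite ge0_fin_numE.
    exact: integral_oobox_lty.
  by apply: integral_ge0 => t _; rewrite lee_fin oobox_ge0.
- rewrite ge0_integral_weight_prod// ltey_eq prode_fin_num// => j _; rewrite ge0_fin_numE.
    rewrite /h; case: (j \in w); first exact: integral_kernel_norm2_oobox_lty.
    case: (j \in u); first exact: integral_weightV_oobox_lty.
    by under eq_integral do rewrite mul1r; exact: integral_oobox_lty.
  by apply: integral_ge0 => t _; rewrite lee_fin.
Qed.

Lemma integrable_anova_integrandM (g : 'rV[R]_n -> R) : measurable_fun setT g ->
  \int[lam]_x (TA x * `|g x|%:E) < +oo ->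
  (lam \x lam).-integrable setT (fun p => (TI p * g p.1)%:E).
Proof.
move=> mg gi; have mTI := measurable_anova_integrand hrho u w mF.
apply/integrable12ltyP => /=; first by mfun.
apply: le_lt_trans gi; rewrite le_eqVlt; apply/orP; left; apply/eqP.
apply: eq_integral => x _; rewrite /anova_abs -ge0_integralZr//.
- by apply: eq_integral => y _; rewrite normrM EFinM.
- apply/measurable_EFinP/measurable_norm_comp.
  exact: (measurable_fun_pair2 x mTI).
Qed.

Lemma integrable_anova_termM (g : 'rV[R]_n -> R) : measurable_fun setT g ->
  \int[lam]_x (TA x * `|g x|%:E) < +oo ->
  lam.-integrable setT (fun x => (T x * g x)%:E).
Proof.
move=> mg gi; have mT := measurable_anova_term hrho u w mF.
have mTI := measurable_anova_integrand hrho u w mF.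
apply/integrableP; split; first by mfun.
apply: le_lt_trans gi; apply: ge0_le_integral => //.
- by apply/measurable_EFinP/measurable_norm_comp; mfun.
- by apply: emeasurable_funM; [exact: measurable_anova_abs|mfun].
move=> x _ /=; rewrite normrM EFinM lee_wpmul2r// ?lee_fin//.
apply: normr_Rintegral_le; exact: (measurable_fun_pair2 x mTI).
Qed.

Lemma anova_abs_box_bounded a b (g : 'rV[R]_n -> R) (M : R) :
  measurable_fun setT g -> (forall x, `|g x| <= M * wp (oobox a b) ST x)%R ->
  \int[lam]_x (TA x * `|g x|%:E) < +oo.
Proof.
move=> mg gM.
have M0 : (0 <= `|M|)%R by [].
have mo := measurable_oobox a b.
apply: (@le_lt_trans _ _ (`|M|%:E * \int[lam]_x (TA x * (wp (oobox a b) ST x)%:E))).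
  rewrite -ge0_integralZl//; last 2 first.
  - by apply: emeasurable_funM; [exact: measurable_anova_abs|mfun].
  - by move=> x _; rewrite mule_ge0 ?anova_abs_ge0// lee_fin weight_prod_ge0.
  apply: ge0_le_integral => //.
  - by move=> x _; rewrite mule_ge0 ?anova_abs_ge0// lee_fin.
  - by apply: emeasurable_funM; [exact: measurable_anova_abs|mfun].
  - apply: emeasurable_funM => //.
    by apply: emeasurable_funM; [exact: measurable_anova_abs|mfun].
  move=> x _; rewrite muleCA lee_wpmul2l ?anova_abs_ge0// -EFinM lee_fin.
  by rewrite (le_trans (gM x))// ler_wpM2r ?ler_norm// weight_prod_ge0.
rewrite lte_mul_pinfty//; exact: integral_anova_abs_box.
Qed.

End one_term.
End anova_terms_box.

(** * ANOVA terms and a single coordinate *)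

Section anova_terms_coordinate.
Context {R : realType} {n : nat}.
Variables rho psi : 'I_n -> R -> R.
Hypothesis hrho : forall j, positive_density (rho j).
Hypothesis hpsi : forall j, positive_weight (psi j).
Hypothesis hcond : forall j, embedding_condition (rho j) (psi j).
Local Notation lam := (lebesgueV n).
Local Notation leb := (@lebesgue_measure R).
Local Notation wp := weight_prod.
Local Open Scope ereal_scope.
Implicit Types (u w v : {set 'I_n}) (F : 'rV[R]_n -> R).

Let mrho j : measurable_fun setT (rho j). Proof. exact: density_measurable. Qed.
Let rho0 j t : (0 <= rho j t)%R. Proof. exact: density_ge0. Qed.
Let mpsi j : measurable_fun setT (psi j). Proof. exact: weight_measurable. Qed.
Let psi0 j t : (0 < psi j t)%R. Proof. exact: weight_gt0. Qed.
Let psi0' j t : (0 <= psi j t)%R. Proof. exact: ltW. Qed.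

(** [mix (~: [set j]) x y] is x with its coordinate j replaced by that of y. *)
Definition indep_coord (g : 'rV[R]_n -> R) (j : 'I_n) :=
  forall x y, g (mix (~: [set j]) x y) = g x.

Lemma indep_coordM g h j : indep_coord g j -> indep_coord h j ->
  indep_coord (fun x => g x * h x)%R j.
Proof. by move=> gj hj x y; rewrite gj hj. Qed.

Lemma indep_coord_weight_prod (c : 'I_n -> R -> R) v j : j \notin v ->
  indep_coord (wp c v) j.
Proof.
move=> jv x y; apply: weight_prod_mix_in; apply/fintype.subsetP => i iv.
by rewrite !inE; apply: contraNneq jv => <-.
Qed.

Lemma indep_coord_anova_term u w F j : j \notin u -> j \notin w ->
  indep_coord (anova_term rho u w F) j.
Proof.
move=> ju jw x y; apply: eq_Rintegral => t _; rewrite /anova_integrand/=.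
congr (F _ * (_ * _))%R.
  apply/rowP => i; rewrite !mixE !inE; case: ifPn => // iu.
  by rewrite (contraTneq _ iu)// => ->.
apply: eq_bigr => i iw; rewrite mixE !inE (_ : i != j)//.
by apply: contraTneq iw => ->.
Qed.

Section one_term.
Variables (u w : {set 'I_n}) (F : 'rV[R]_n -> R).
Hypothesis mF : measurable_fun setT F.
Hypothesis uw : [disjoint u & w]%B.
Local Notation T := (anova_term rho u w F).
Local Notation TI := (anova_integrand rho u w F).
Local Notation TA := (anova_abs rho u w F).

(** After Fubini, for fixed t the variable x_j occurs only in kappa_j(x_j, t_j) a(x_j), so it can be
    integrated out; rho_j fills the vacant coordinate and keeps the integral over R^n. With a =
    rho_j the result vanishes; with a of integral 0 it is an integration by parts. *)
Lemma anova_term_coordinate j (m : 'rV[R]_n -> R) (a : R -> R) : j \in w ->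
  measurable_fun setT m -> indep_coord m j -> leb.-integrable setT (EFin \o a) ->
  (lam \x lam).-integrable setT (fun p => (TI p * (m p.1 * a (p.1 0%R j)))%:E) ->
  \int[lam]_x (T x * (m x * a (x 0%R j)))%:E =
  \int[lam]_t \int[lam]_x (F (mix u x t) *
    (kernelV rho (w :\ j) x t * wp rho (~: w) t) * m x *
    (rho j (x 0%R j) * \int[leb]_y (anova_kernel (rho j) y (t 0%R j) * a y)))%:E.
Proof.
move=> jw mm mj ai hi.
have /measurable_EFinP ma := measurable_int _ ai.
have mTI := measurable_anova_integrand hrho u w mF.
have mg : measurable_fun setT (fun x : 'rV[R]_n => m x * a (x 0%R j))%R by mfun.
transitivity (\int[lam]_x \int[lam]_t (TI (x, t) * (m x * a (x 0%R j)))%:E).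
  exact: (integral_param_factor mTI mg hi).
rewrite [LHS](Fubini hi).
have mh : measurable_fun setT (fun p : 'rV[R]_n * 'rV[R]_n => (F (mix u p.2 p.1) *
    (kernelV rho (w :\ j) p.2 p.1 * wp rho (~: w) p.1) * m p.2 *
    (rho j (p.2 0%R j) *
     \int[leb]_y (anova_kernel (rho j) y (p.1 0%R j) * a y)))%R).
  have mi : measurable_fun setT (fun s => \int[leb]_y (anova_kernel (rho j) y s * a y))%R.
    apply: (@measurable_integral_param _ _ _ _ _ leb (fun p : R * R =>
      anova_kernel (rho j) p.2 p.1 * a p.2)%R).
    apply: measurable_funM; last exact: (measurableT_comp ma measurable_snd).
    exact: measurable_anova_kernel.
  apply: measurable_funM.
    apply: measurable_funM; last by mfun.
    apply: measurable_funM; first by mfun.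
    by apply: measurable_funM; [apply: measurable_kernelV => //; mfun|mfun].
  apply: measurable_funM; first by mfun.
  apply: (measurableT_comp mi); by mfun.
apply: ae_eq_integral => //.
- exact: (measurable_fubini_G hi).
- exact: (measurable_eintegral_param _ mh).
have := ae_integrable2 hi; apply: filterS => t ht _.
(* For almost every t the integrand is a factor [c] free of x_j times a function of x_j alone. *)
pose c x := (F (mix u x t) * (kernelV rho (w :\ j) x t * wp rho (~: w) t) * m x)%R.
pose at_ y := (anova_kernel (rho j) y (t 0%R j) * a y)%R.
have ju : j \notin u by rewrite (disjointFl uw jw).
have E x : (TI (x, t) * (m x * a (x 0%R j)) = c x * at_ (x 0%R j))%R.
  rewrite /anova_integrand/= /c /at_ /kernelV (big_setD1 j)//=; ring.
rewrite /fubini_G/=; under eq_integral do rewrite E.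
apply: integral_coordinate => //.
- rewrite /c; apply: measurable_funM => //; apply: measurable_funM.
    by apply: (measurableT_comp mF); mfun.
  by apply: measurable_funM; [apply: measurable_kernelV => //; exact: measurable_cst|mfun].
- apply: indep_coordM => //; move=> x y; congr (F _ * (_ * _))%R.
    apply/rowP => i; rewrite !mixE !inE; case: ifPn => // iu.
    by rewrite (contraTneq _ iu)// => ->.
  apply: eq_bigr => i; rewrite !inE => /andP[ij _].
  by rewrite mixE !inE ij.
- exact: integrable_anova_kernelM.
- by move: ht; apply: eq_integrable => // x _ /=; rewrite E.
Qed.

(** Half the sum of the squares of TA and S dominates TA |S|, and both squares have finite weighted
    integrals. In particular, products of two ANOVA terms are integrable. *)
Lemma integrable_anova_term_weighted (S : 'rV[R]_n -> R) :
  measurable_fun setT S ->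
  weighted_norm2 rho psi (u :|: w) F < +oo ->
  weighted_norm2 rho psi u S < +oo ->
  \int[lam]_x (TA x * `|S x * (wp psi u x * wp rho (~: u) x)|%:E) < +oo.
Proof.
move=> mS NF NS.
have w0 (x : 'rV[R]_n) : (0 <= wp psi u x * wp rho (~: u) x)%R.
  by rewrite mulr_ge0// weight_prod_ge0.
have mTA := measurable_anova_abs hrho u w mF.
have sq0 (x : 'rV[R]_n) : 0 <= TA x * TA x by rewrite mule_ge0// anova_abs_ge0.
apply: (@le_lt_trans _ _ (\int[lam]_x (2^-1%:E * (TA x * TA x *
   (wp psi u x * wp rho (~: u) x)%:E + (S x ^+ 2 * (wp psi u x * wp rho (~: u) x))%:E)))).
  apply: ge0_le_integral => //.
  - by move=> x _; rewrite mule_ge0 ?anova_abs_ge0// lee_fin.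
  - by apply: emeasurable_funM => //; mfun.
  - apply: emeasurable_funM => //; apply: emeasurable_funD; last by mfun.
    by apply: emeasurable_funM; [exact: emeasurable_funM|mfun].
  move=> x _; rewrite normrM (ger0_norm (w0 x)) EFinM muleA.
  rewrite (EFinM (S x ^+ 2)) -ge0_muleDl//; last by rewrite lee_fin sqr_ge0.
  rewrite muleA lee_wpmul2r ?lee_fin//.
  by apply: lee_mul_sqr => //; exact: anova_abs_ge0.
rewrite ge0_integralZl//; last 2 first.
- apply: emeasurable_funD; last by mfun.
  by apply: emeasurable_funM; [exact: emeasurable_funM|mfun].
- move=> x _; apply: adde_ge0; first by rewrite mule_ge0// lee_fin.
  by rewrite lee_fin mulr_ge0 ?sqr_ge0.
rewrite lte_mul_pinfty//.
rewrite ge0_integralD//; last 4 first.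
- by move=> x _; rewrite mule_ge0// lee_fin.
- by apply: emeasurable_funM; [exact: emeasurable_funM|mfun].
- by move=> x _; rewrite lee_fin mulr_ge0 ?sqr_ge0.
- by mfun.
rewrite lte_add_pinfty//.
apply: (le_lt_trans (integral_anova_abs_sqr_le hrho hpsi hcond mF uw)).
have N0 : 0 <= weighted_norm2 rho psi (u :|: w) F.
  apply: integral_ge0 => x _.
  by rewrite lee_fin mulr_ge0 ?sqr_ge0// mulr_ge0// weight_prod_ge0.
have C0 j : 0 <= embedding_const (rho j) (psi j).
  apply: integral_ge0 => t _; rewrite lee_fin divr_ge0// mulr_ge0 ?subr_ge0.
  - by [].
  - exact: density_cdf_ge0.
  - exact: density_cdf_le1.
rewrite lte_mul_pinfty//; first exact: prode_ge0.
rewrite prode_fin_num// => j _.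
by rewrite ge0_fin_numE// embedding_const_lty.
Qed.

(** As j lies in w, it is outside u, so x_j carries the weight rho_j; S does not depend on it, and
    kappa_j(., t_j) has mean zero for rho_j. The orthogonality of the terms and their zero means are
    both instances. *)
Lemma integral_anova_term_weighted j (S : 'rV[R]_n -> R) : j \in w ->
  measurable_fun setT S -> indep_coord S j ->
  weighted_norm2 rho psi (u :|: w) F < +oo ->
  weighted_norm2 rho psi u S < +oo ->
  \int[lam]_x (T x * (S x * (wp psi u x * wp rho (~: u) x)))%:E = 0.
Proof.
move=> jw mS Sj NF NS.
have ju : j \notin u by rewrite (disjointFl uw jw).
pose m x := (S x * (wp psi u x * wp rho (~: u :\ j) x))%R.
have E x : (S x * (wp psi u x * wp rho (~: u) x) = m x * rho j (x 0 j))%R.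
  rewrite /m [wp rho (~: u) x](_ : _ = wp rho (~: u :\ j) x * rho j (x 0 j))%R; first by ring.
  by rewrite /weight_prod (big_setD1 j) ?inE//= mulrC.
under eq_integral do rewrite E.
rewrite (anova_term_coordinate jw).
- rewrite integral0_eq// => t _; rewrite integral0_eq// => x _.
  by rewrite integral_anova_kernel_density ?mulr0.
- by rewrite /m; mfun.
- apply: indep_coordM => //; apply: indep_coordM; apply: indep_coord_weight_prod => //.
  by rewrite !inE eqxx.
- exact: density_integrable.
- have := integrable_anova_integrandM hrho mF _ (integrable_anova_term_weighted mS NF NS).
  have mg : measurable_fun setT (fun x => S x * (wp psi u x * wp rho (~: u) x))%R by mfun.
  by move=> /(_ mg); apply: eq_integrable => // p _; rewrite /= E.
Qed.

Lemma integral_anova_term_sqr_le :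
  \int[lam]_x (T x ^+ 2 * (wp psi u x * wp rho (~: u) x))%:E <=
  (\prod_(j in w) embedding_const (rho j) (psi j)) * weighted_norm2 rho psi (u :|: w) F.
Proof.
have mTA := measurable_anova_abs hrho u w mF.
have mT := measurable_anova_term hrho u w mF.
have mTI := measurable_anova_integrand hrho u w mF.
have w0 (x : 'rV[R]_n) : (0 <= wp psi u x * wp rho (~: u) x)%R.
  by rewrite mulr_ge0// weight_prod_ge0.
apply: le_trans (integral_anova_abs_sqr_le hrho hpsi hcond mF uw).
apply: ge0_le_integral => //.
- by move=> x _; rewrite lee_fin mulr_ge0 ?sqr_ge0.
- by mfun.
- by apply: emeasurable_funM; [exact: emeasurable_funM|mfun].
move=> x _; rewrite EFinM lee_wpmul2r ?lee_fin// -real_normK ?num_real// expr2 EFinM.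
have : `|T x|%:E <= TA x by apply: normr_Rintegral_le; exact: (measurable_fun_pair2 x mTI).
by move=> h; apply: lee_pmul; rewrite ?lee_fin.
Qed.

End one_term.
End anova_terms_coordinate.

(** * Integration by parts for ANOVA terms *)

Section anova_terms_box_identities.
Context {R : realType} {n : nat}.
Variables rho psi : 'I_n -> R -> R.
Hypothesis hrho : forall j, positive_density (rho j).
Hypothesis hpsi : forall j, positive_weight (psi j).
Hypothesis hcond : forall j, embedding_condition (rho j) (psi j).
Local Notation lam := (lebesgueV n).
Local Notation leb := (@lebesgue_measure R).
Local Notation wp := weight_prod.
Local Notation ST := [set: 'I_n]%SET.
Local Open Scope ereal_scope.
Implicit Types (u w v : {set 'I_n}) (F : 'rV[R]_n -> R).

Let mrho j : measurable_fun setT (rho j). Proof. exact: density_measurable. Qed.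
Let rho0 j t : (0 <= rho j t)%R. Proof. exact: density_ge0. Qed.
Let rho1 j : \int[leb]_t (rho j t)%:E = 1. Proof. exact: density_integral. Qed.

Definition primitive (phi : R -> R) (t : R) : R :=
  (\int[leb]_y ((y <= t)%R%:R * phi y))%R.

Lemma measurable_primitive phi : measurable_fun setT phi ->
  measurable_fun setT (primitive phi).
Proof.
move=> mphi; apply: (@measurable_integral_param _ _ _ _ _ leb (fun p : R * R =>
  (p.2 <= p.1)%R%:R * phi p.2)%R).
apply: measurable_funM; last exact: (measurableT_comp mphi measurable_snd).
exact: measurable_leb_indic.
Qed.

Section phi.
Variables (a b : 'I_n -> R) (j : 'I_n) (phi : R -> R) (M : R).
Hypothesis mphi : measurable_fun setT phi.
Hypothesis phiM : forall t, (`|phi t| <= M * oobox a b j t)%R.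
Hypothesis phi0 : (\int[leb]_t phi t = 0)%R.

Lemma integrable_box_bounded : leb.-integrable setT (EFin \o phi).
Proof.
apply/integrableP; split; first exact/measurable_EFinP.
apply: (@le_lt_trans _ _ (\int[leb]_t (`|M|%:E * (oobox a b j t)%:E))).
  apply: ge0_le_integral => //.
  - by apply/measurable_EFinP/measurable_norm_comp.
  - apply/measurable_EFinP; apply: measurable_funM => //; exact: measurable_oobox.
  - by move=> t _ /=; rewrite lee_fin (le_trans (phiM t))// ler_wpM2r ?ler_norm.
rewrite ge0_integralZl//; last 2 first.
- by apply/measurable_EFinP; exact: measurable_oobox.
- by move=> t _; rewrite lee_fin oobox_ge0.
by rewrite lte_mul_pinfty//; exact: integral_oobox_lty.
Qed.

(** On the left of the interval nothing has been integrated yet; on the right the integral is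
    complete, hence 0. The zero mean thus confines the support of the primitive to the same
    interval. *)
Lemma primitive_bounded t :
  (`|primitive phi t| <= (\int[leb]_y `|phi y|) * oobox a b j t)%R.
Proof.
have phi_out y : (y <= a j)%R || (b j <= y)%R -> phi y = 0%R.
  move=> h; have := phiM y; rewrite /oobox indicE mem_setE in_itv/=.
  by case/orP: h => h; [rewrite (ltNge (a j)) h|rewrite (ltNge y) h andbF];
    rewrite /= mulr0 normr_le0 => /eqP.
have [ta|at_] := leP t (a j).
  rewrite /oobox indicE mem_setE in_itv/= ltNge ta/= mulr0.
  rewrite /primitive (_ : (\int[leb]_y _)%R = 0%R) ?normr0//.
  rewrite /Rintegral integral0_eq// => y _; case: (leP y t) => yt /=.
    by rewrite phi_out ?mulr0// (le_trans yt).
  by rewrite mul0r.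
have [bt|tb] := leP (b j) t.
  rewrite /oobox indicE mem_setE in_itv/= [(t < b j)%R]ltNge bt/= andbF mulr0.
  rewrite /primitive (_ : (\int[leb]_y _)%R = 0%R) ?normr0//.
  rewrite -phi0; apply: eq_Rintegral => y _; case: (leP y t) => yt /=.
    by rewrite mul1r.
  by rewrite mul0r phi_out// (le_trans bt (ltW yt)) orbT.
rewrite /oobox indicE mem_setE in_itv/= at_ tb/= mulr1.
have im := integrable_mask t integrable_box_bounded.
apply: (le_trans (le_normr_Rintegral measurableT im)).
apply: le_Rintegral => //.
- exact: integrable_norm im.
- exact: integrable_norm integrable_box_bounded.
move=> y _; rewrite normrM ler_piMl//.
by case: (y <= t)%R; rewrite ?normr1 ?normr0.
Qed.

Lemma integral_anova_kernel_primitive t :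
  (\int[leb]_y (anova_kernel (rho j) y t * phi y) = - primitive phi t)%R.
Proof.
rewrite (integral_anova_kernelM _ _ integrable_box_bounded) phi0 mulr0 sub0r//.
Qed.

Lemma box_factor_bounded (h : R -> R) (c : R) :
  (forall t, `|h t| <= c * oobox a b j t)%R -> forall x : 'rV[R]_n,
  (`|wp (oobox a b) (~: [set j]) x * h (x 0 j)| <= c * wp (oobox a b) ST x)%R.
Proof.
move=> hc x; have w0 : (0 <= wp (oobox a b) (~: [set j]) x)%R.
  by apply: weight_prod_ge0 => i t; exact: oobox_ge0.
rewrite normrM (ger0_norm w0) -(weight_prodC _ (~: [set j])) mulrCA.
by rewrite ler_wpM2l// finset.setCK weight_prod1.
Qed.

Section one_term.
Variables (u w : {set 'I_n}) (F : 'rV[R]_n -> R).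
Hypothesis mF : measurable_fun setT F.
Hypothesis uw : [disjoint u & w]%B.
Hypothesis NF : weighted_norm2 rho psi (u :|: w) F < +oo.

Lemma integrable_anova_term_box (g : 'rV[R]_n -> R) c : measurable_fun setT g ->
  (forall x, `|g x| <= c * wp (oobox a b) ST x)%R ->
  lam.-integrable setT (fun x => (anova_term rho u w F x * g x)%:E).
Proof.
move=> mg gc; apply: integrable_anova_termM => //.
exact: (anova_abs_box_bounded hrho hpsi hcond mF uw NF mg gc).
Qed.

(** For j outside u and w the term does not depend on x_j, and phi has integral 0. *)
Lemma integral_anova_term_box0 : j \notin u -> j \notin w ->
  \int[lam]_x (anova_term rho u w F x *
    (wp (oobox a b) (~: [set j]) x * phi (x 0 j)))%:E = 0.
Proof.
move=> ju jw; have mT := measurable_anova_term hrho u w mF.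
have mo := measurable_oobox a b.
have ig : lam.-integrable setT (fun x => (anova_term rho u w F x *
    (wp (oobox a b) (~: [set j]) x * phi (x 0 j)))%:E).
  by apply: integrable_anova_term_box; [mfun|exact: box_factor_bounded phiM].
under eq_integral do rewrite mulrA.
rewrite (integral_coordinate hrho).
- by apply: integral0_eq => x _; rewrite phi0 !mulr0.
- by mfun.
- apply: indep_coordM; first exact: indep_coord_anova_term.
  by apply: indep_coord_weight_prod; rewrite !inE eqxx.
- exact: integrable_box_bounded.
- by move: ig; apply: eq_integrable => // x _ /=; rewrite mulrA.
Qed.

(** Integrating kappa_j against phi produces minus the primitive at t_j. Exchanging x_j and t_j
    moves the primitive to x and makes F read its coordinate j from x, so j passes from w to u. *)
Lemma integral_anova_term_box : j \in w ->
  \int[lam]_x (anova_term rho u w F x *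
    (wp (oobox a b) (~: [set j]) x * phi (x 0 j)))%:E =
  \int[lam]_x (anova_term rho (u :|: [set j]) (w :\ j) F x *
    (wp (oobox a b) (~: [set j]) x * - primitive phi (x 0 j)))%:E.
Proof.
move=> jw; have ju : j \notin u by rewrite (disjointFl uw jw).
have mo := measurable_oobox a b.
have mp := measurable_primitive mphi.
have mT := measurable_anova_term hrho u w mF.
pose m := wp (oobox a b) (~: [set j]).
have mm : measurable_fun setT m by rewrite /m; mfun.
have ujwj : (u :|: [set j]) :|: (w :\ j) = u :|: w.
  apply/setP => i; rewrite !inE; have [->|ij] := eqVneq i j; rewrite /= ?orbT ?orbF//.
  by rewrite jw orbT.
have dis' : [disjoint u :|: [set j] & w :\ j]%B.
  rewrite finset.disjoints_subset; apply/fintype.subsetP => i; rewrite !inE.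
  have [->|ij] := eqVneq i j; rewrite //= orbF => iu.
  by rewrite (disjointFr uw iu).
have NF' : weighted_norm2 rho psi ((u :|: [set j]) :|: (w :\ j)) F < +oo by rewrite ujwj.
have mTI2 := measurable_anova_integrand hrho (u :|: [set j]) (w :\ j) mF.
pose g2 x := (m x * - primitive phi (x 0 j))%R.
have mg2 : measurable_fun setT g2 by rewrite /g2; mfun.
have i2 : (lam \x lam).-integrable setT
    (fun p => (anova_integrand rho (u :|: [set j]) (w :\ j) F p * g2 p.1)%:E).
  apply: integrable_anova_integrandM => //.
  apply: (anova_abs_box_bounded hrho hpsi hcond mF dis' NF' mg2).
  apply: (@box_factor_bounded (fun t => - primitive phi t)%R) => t.
  by rewrite normrN; exact: primitive_bounded.
have mg : measurable_fun setT (fun x : 'rV[R]_n => m x * phi (x 0%R j))%R by mfun.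
have i1 : (lam \x lam).-integrable setT
    (fun p => (anova_integrand rho u w F p * (m p.1 * phi (p.1 0%R j)))%:E).
  apply: (integrable_anova_integrandM hrho mF mg).
  apply: (anova_abs_box_bounded hrho hpsi hcond mF uw NF mg).
  exact: (box_factor_bounded phiM).
rewrite (anova_term_coordinate hrho mF uw jw mm _ _ i1); last 2 first.
- by apply: indep_coord_weight_prod; rewrite !inE eqxx.
- exact: integrable_box_bounded.
transitivity (\int[lam]_t \int[lam]_x (anova_integrand rho (u :|: [set j]) (w :\ j) F
    (swapV (~: [set j]) (x, t)) * g2 (swapV (~: [set j]) (x, t)).1)%:E).
  apply: eq_integral => t _; apply: eq_integral => x _.
  rewrite integral_anova_kernel_primitive; congr _%:E.
  rewrite /swapV /anova_integrand /g2 /=.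
  rewrite (_ : mix (u :|: [set j]) _ _ = mix u x t); last first.
    apply/rowP => i; rewrite !mixE !inE; have [->|ij] := eqVneq i j => /=.
      by rewrite (negbTE ju) orbT.
    by rewrite orbF; case: (i \in u).
  rewrite (_ : kernelV rho (w :\ j) _ _ = kernelV rho (w :\ j) x t); last first.
    by apply: eq_bigr => i; rewrite !inE => /andP[ij _]; rewrite !mixE !inE ij.
  rewrite (_ : wp rho (~: (w :\ j)) _ = wp rho (~: w) t * rho j (x 0 j))%R; last first.
    rewrite /weight_prod (big_setD1 j)/= ?inE ?eqxx// mulrC mixE !inE eqxx/=; congr (_ * _)%R.
    rewrite (_ : ~: (w :\ j) :\ j = ~: w).
      apply: eq_bigr => i; rewrite inE => iw; rewrite mixE !inE.
      by rewrite (_ : i != j)//; apply: contraNneq iw => ->.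
    apply/setP => i; rewrite !inE; have [->|ij] := eqVneq i j; rewrite /= ?jw//.
  rewrite (_ : m _ = m x); last first.
    by apply: indep_coord_weight_prod; rewrite !inE eqxx.
  rewrite mixE !inE eqxx/=; ring.
have i3 := integrable_swap (~: [set j]) i2.
rewrite -[LHS](Fubini i3).
rewrite -(integral_swap (~: [set j]) i2).
apply/esym; exact: (integral_param_factor mTI2 mg2 i2).
Qed.

End one_term.
End phi.

(** For fixed x_u the term is, as a function of the remaining variables, an ANOVA term over the
    empty set for the section [Fm], and its mean is its product with the constant 1. *)
Lemma integral_anova_term_mix u w F x : measurable_fun setT F ->
  [disjoint u & w]%B -> w != finset.set0 -> fiber_norm2 rho psi u w F x < +oo ->
  lam.-integrable setT (fun y => (anova_term rho u w F (mix u x y) * wp rho ST y)%:E) /\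
  \int[lam]_y (anova_term rho u w F (mix u x y) * wp rho ST y)%:E = 0.
Proof.
move=> mF uw /finset.set0Pn[j jw] Fx.
have uw0 i : (i \in u) && (i \in w) = false.
  by case: (boolP (i \in u)) => //= iu; rewrite (disjointFr uw iu).
pose Fm t := F (mix u x t).
have mFm : measurable_fun setT Fm by rewrite /Fm; mfun.
have dw : [disjoint finset.set0 & w]%B by rewrite finset.disjoints_subset finset.sub0set.
have TE y : anova_term rho u w F (mix u x y) = anova_term rho finset.set0 w Fm y.
  apply: eq_Rintegral => t _; rewrite /anova_integrand/= /Fm.
  congr (F _ * (_ * _))%R.
    by apply/rowP => i; rewrite !mixE inE; case: (i \in u).
  apply: eq_bigr => i iw; rewrite mixE; have := uw0 i.
  by rewrite iw andbT => ->.
have N1 : weighted_norm2 rho psi (finset.set0 :|: w) Fm < +oo.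
  by rewrite finset.set0U.
have C0 : ~: finset.set0 = ST by apply/setP => i; rewrite !inE.
have w0E y : (wp psi finset.set0 y * wp rho (~: finset.set0) y = wp rho ST y)%R.
  by rewrite C0 {1}/weight_prod big_set0 mul1r.
have N2 : weighted_norm2 rho psi finset.set0 (fun=> 1%R) < +oo.
  rewrite /weighted_norm2; under eq_integral do rewrite w0E expr1n mul1r.
  by rewrite integral_density// ltry.
have m1 : measurable_fun setT (fun _ : 'rV[R]_n => 1%R : R) by exact: measurable_cst.
split; last first.
  rewrite -[RHS](integral_anova_term_weighted hrho hpsi hcond mFm dw jw m1 _ N1 N2) //.
  by apply: eq_integral => y _; rewrite TE w0E mul1r.
have ib := integrable_anova_term_weighted hrho hpsi hcond mFm dw m1 N1 N2.
have mr : measurable_fun setT (fun x : 'rV[R]_n => 1 * (wp psi finset.set0 x * wp rho (~: finset.set0) x))%R.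
  have mpsi i : measurable_fun setT (psi i) by exact: weight_measurable.
  by mfun.
have := integrable_anova_termM hrho mFm mr ib.
by apply: eq_integrable => // y _; rewrite TE w0E mul1r.
Qed.

End anova_terms_box_identities.

(** * Product test functions and weak derivatives *)

Section smooth_real_functions.
Context {R : realType}.
Implicit Types (f g : R -> R) (x : R).

(** For k = 0 this is the classical exp(-1/x), continued by 0. The powers x^-k are included because
    differentiation produces them. *)
Definition flat k x : R := if 0 < x then x^-1 ^+ k * expR (- x^-1) else 0.

Lemma flat_ge0 k x : 0 <= flat k x.
Proof.
rewrite /flat; case: ifP => // x0.
by rewrite mulr_ge0 ?expR_ge0// exprn_ge0// invr_ge0 ltW.
Qed.

Lemma flat0 k x : x <= 0 -> flat k x = 0.
Proof. by rewrite /flat leNgt => /negbTE ->. Qed.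

Lemma flat_gt0 k x : 0 < x -> 0 < flat k x.
Proof. by move=> x0; rewrite /flat x0 mulr_gt0 ?exprn_gt0 ?invr_gt0 ?expR_gt0. Qed.

(** From exp(y) >= y^(k+2) / (k+2)! with y = 1/x. The quadratic bound makes the difference quotients
    at 0 tend to 0. *)
Lemma flat_le_sqr k x : flat k x <= (k.+2)`!%:R * x ^+ 2.
Proof.
rewrite /flat; case: ifPn => [x0|_]; last by rewrite mulr_ge0 ?sqr_ge0.
have y0 : 0 < x^-1 by rewrite invr_gt0.
have := expR_ge1Dxn k.+1 (ltW y0).
have e0 := expR_gt0 x^-1.
have f0 : 0 < (k.+2)`!%:R :> R by rewrite ltr0n fact_gt0.
rewrite expRN => h.
have {}h : x^-1 ^+ k.+2 / (k.+2)`!%:R <= expR x^-1 by apply: le_trans h; rewrite lerDr.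
rewrite ler_pdivrMr// in h.
rewrite ler_pdivrMr//.
have -> : x^-1 ^+ k = x^-1 ^+ k.+2 * x ^+ 2.
  by rewrite -addn2 exprD -mulrA -exprMn mulVf ?gt_eqF// expr1n mulr1.
by rewrite [leRHS]mulrAC [_ * expR _]mulrC ler_wpM2r ?sqr_ge0.
Qed.

Lemma is_derive_flat k x :
  is_derive x 1 (flat k) (- k%:R * flat k.+1 x + flat k.+2 x).
Proof.
have [x0|x0|<-] := ltgtP 0 x.
- apply: (@near_eq_is_derive _ _ _ (fun y : R => (y^-1 ^+ k * expR (- y^-1)))).
    near=> y; rewrite /flat ifT//.
    near: y; exact: lt_nbhsr.
  rewrite /flat x0.
  have xn0 : x != 0 by rewrite gt_eqF.
  have dV : is_derive x 1 (fun y : R => y^-1) (- x ^- 2).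
    apply: (is_derive_eq (is_deriveV (f := id) xn0 (is_derive_id _ _))).
    by rewrite /GRing.scale/= mulr1.
  have dX : is_derive x 1 (fun y : R => y^-1 ^+ k) (k%:R * x^-1 ^+ k.-1 * - x ^- 2).
    by have := is_deriveX k dV; rewrite exprfctE.
  have dE : is_derive x 1 (fun y : R => expR (- y^-1)) (expR (- x^-1) * x ^- 2).
    have dN : is_derive x 1 (fun y : R => - y^-1) (x ^- 2).
      by apply: (is_derive_eq (is_deriveN dV)); rewrite opprK.
    exact: (is_derive1_comp (f := expR) (g := fun y => - y^-1)).
  apply: (is_derive_eq (is_deriveM dX dE)).
  rewrite /GRing.scale/= -exprVn.
  (* For k = 0 the truncated [k.-1] is multiplied by 0, so this case is separate. *)
  case: k dX => [|k] dX; first by rewrite !mul0r expr0; ring.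
  by rewrite /= !exprS; ring.
- apply: (@near_eq_is_derive _ _ _ (cst 0)).
    near=> y; rewrite flat0//= ltW//; near: y; exact: lt_nbhsl.
  by rewrite !flat0 ?ltW// mulr0 addr0; exact: is_derive_cst.
rewrite !flat0// mulr0 addr0.
have q0 : h^-1 *: (flat k (h *: 1 + 0) - flat k 0) @[h --> 0^'] --> (0 : R).
  apply/cvgrPdist_lt => e e0; near=> h.
  have h0 : h != 0 by near: h; exact: nbhs_dnbhs_neq.
  rewrite sub0r normrN (flat0 k (lexx 0)) subr0 addr0 /GRing.scale/= mulr1.
  rewrite normrM normfV (ger0_norm (flat_ge0 _ _)).
  rewrite mulrC ltr_pdivrMr ?normr_gt0//.
  apply: (le_lt_trans (flat_le_sqr k h)).
  rewrite -(real_normK (num_real h)) expr2 mulrA ltr_pM2r ?normr_gt0//.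
  rewrite -ltr_pdivlMl ?ltr0n ?fact_gt0//.
  near: h; apply: dnbhs0_lt.
  by rewrite mulr_gt0 ?invr_gt0 ?ltr0n ?fact_gt0.
apply: DeriveDef; first by apply/cvg_ex; exists 0.
exact: cvg_lim q0.
Unshelve. all: by end_near. Qed.

(* The derivative of [flat k] is a combination of [flat k.+1] and [flat k.+2], so
   this class is closed under differentiation by induction. *)
Inductive smoothR : (R -> R) -> Prop :=
| smoothR_flat k c e : smoothR (fun x => flat k (c * x + e))
| smoothR_cst c : smoothR (fun=> c)
| smoothR_add f g : smoothR f -> smoothR g -> smoothR (fun x => f x + g x)
| smoothR_mul f g : smoothR f -> smoothR g -> smoothR (fun x => f x * g x)
| smoothR_exp f : smoothR f -> smoothR (fun x => expR (f x))
| smoothR_primitive f g : smoothR g -> (forall x, is_derive x 1 f (g x)) -> smoothR f.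

Lemma smoothR_derive f : smoothR f ->
  exists2 g, smoothR g & forall x, is_derive x 1 f (g x).
Proof.
elim=> [k c e|c|f1 f2 s1 [g1 sg1 d1] s2 [g2 sg2 d2]
  |f1 f2 s1 [g1 sg1 d1] s2 [g2 sg2 d2]|f1 s1 [g1 sg1 d1]|f1 g1 s1 _ d1].
- exists (fun x => (- k%:R * flat k.+1 (c * x + e) + flat k.+2 (c * x + e)) * c).
    apply: smoothR_mul; last exact: smoothR_cst.
    apply: smoothR_add; last exact: smoothR_flat.
    by apply: smoothR_mul; [exact: smoothR_cst|exact: smoothR_flat].
  move=> x.
  have dl : is_derive x 1 (fun y : R => c * y + e) c.
    by apply: is_derive_eq; rewrite /GRing.scale/= mulr1 ?addr0 ?mulr0 ?addr0.
  exact: (is_derive1_comp (f := flat k) (g := fun y => c * y + e) (is_derive_flat _ _)).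
- by exists (fun=> 0) => [|x]; [exact: smoothR_cst|exact: is_derive_cst].
- exists (fun x => g1 x + g2 x) => [|x]; first exact: smoothR_add.
  exact: (is_deriveD (f := f1) (g := f2)).
- exists (fun x => f1 x * g2 x + f2 x * g1 x) => [|x].
    by apply: smoothR_add; exact: smoothR_mul.
  exact: (is_deriveM (f := f1) (g := f2)).
- exists (fun x => expR (f1 x) * g1 x) => [|x].
    by apply: smoothR_mul => //; exact: smoothR_exp.
  exact: (is_derive1_comp (f := expR) (g := f1)).
- by exists g1.
Qed.

Lemma smoothR_derive1 f : smoothR f ->
  smoothR (derive1 f) /\ forall x, is_derive x 1 f (derive1 f x).
Proof.
move=> /smoothR_derive[g sg df].
suff -> : derive1 f = g by [].
by apply/funext => x; rewrite derive1E; apply: derive_val.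
Qed.

Lemma smoothR_derive1n f k : smoothR f -> smoothR (iter k (@derive1 R R) f).
Proof. by move=> sf; elim: k => //= k /smoothR_derive1[]. Qed.

Lemma smoothR_derivable f x : smoothR f -> derivable f x 1.
Proof. by move=> /smoothR_derive1[_ /(_ x)[]]. Qed.

Lemma smoothR_continuous f : smoothR f -> continuous f.
Proof.
by move=> sf x; apply/differentiable_continuous/derivable1_diffP/smoothR_derivable.
Qed.

Lemma smoothR_measurable f : smoothR f -> measurable_fun setT f.
Proof. by move=> sf; apply: continuous_measurable_fun; exact: smoothR_continuous. Qed.

Lemma smoothR_primitive_int f : smoothR f ->
  lebesgue_measure.-integrable setT (EFin \o f) ->
  smoothR (primitive f) /\ forall x, is_derive x 1 (primitive f) (f x).
Proof.
move=> sf fi; suff df x : is_derive x 1 (primitive f) (f x).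
  by split => //; exact: smoothR_primitive df.
have pE : primitive f = fun x => (\int[lebesgue_measure]_(t in `]-oo, x]) f t).
  apply/funext => t; rewrite Rintegral_mkcond; apply: eq_Rintegral => y _.
  rewrite patchE mem_setE in_itv/=.
  by case: (y <= t)%R; rewrite ?mul1r ?mul0r.
(* The end point x + 1 only serves to make x interior. *)
have [] := @continuous_FTC1 R f -oo%O x (x + 1) _ _ _ _.
- by rewrite ltrDl.
- exact: integrableS fi.
- exact: ltNyr.
- exact: smoothR_continuous.
by rewrite -pE => d1 d2; apply: DeriveDef; [exact: d1|rewrite -derive1E; exact: d2].
Qed.

Definition bump (a b x : R) : R := flat 0 (x - a) * flat 0 (b - x).

(** Smooth, with values between 0 and the indicator of ]a, b[, and converging to it pointwise as k
    grows, so the indicator itself dominates the sequence. The form 1 - exp(-k bump) stays within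
    the constructors of [smoothR]. *)
Definition bump_approx (a b : R) (k : nat) (x : R) : R := 1 - expR (- k%:R * bump a b x).

Lemma smoothR_bump_approx a b k : smoothR (bump_approx a b k).
Proof.
have -> : bump_approx a b k =
    fun x => 1 + (-1) * expR (- k%:R * (flat 0 (1 * x + - a) * flat 0 (-1 * x + b))).
  apply/funext => x; rewrite /bump_approx /bump mul1r !mulN1r.
  by rewrite [- x + b]addrC.
apply: smoothR_add; first exact: smoothR_cst.
apply: smoothR_mul; first exact: smoothR_cst.
apply: smoothR_exp; apply: smoothR_mul; first exact: smoothR_cst.
by apply: smoothR_mul; exact: smoothR_flat.
Qed.

Lemma bump_ge0 a b x : 0 <= bump a b x.
Proof. by rewrite mulr_ge0 ?flat_ge0. Qed.

Lemma bump_gt0 a b x : a < x -> x < b -> 0 < bump a b x.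
Proof. by move=> ax xb; rewrite mulr_gt0// flat_gt0// subr_gt0. Qed.

Lemma bump_approx_ge0 a b k x : 0 <= bump_approx a b k x.
Proof.
by rewrite subr_ge0 -expR0 ler_expR mulNr oppr_le0 mulr_ge0// bump_ge0.
Qed.

Lemma bump_approx_le a b k x : bump_approx a b k x <= \1_`]a, b[%classic x.
Proof.
rewrite indicE mem_setE in_itv/=.
have [xa|ax] := leP x a.
  have h : x - a <= 0 by rewrite subr_le0.
  by rewrite /bump_approx /bump (flat0 _ h) mul0r mulr0 expR0 subrr.
have [bx|xb] /= := leP b x.
  have h : b - x <= 0 by rewrite subr_le0.
  by rewrite /bump_approx /bump (flat0 _ h) !mulr0 expR0 subrr.
by rewrite /bump_approx gerBl expR_ge0.
Qed.

Lemma bump_approx_cvg a b x :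
  bump_approx a b k x @[k --> \oo] --> (\1_`]a, b[%classic x : R).
Proof.
rewrite indicE mem_setE in_itv/=.
have [xab|xab] := boolP (a < x < b); last first.
  rewrite (_ : bump_approx a b ^~ x = fun=> 0); first exact: cvg_cst.
  apply/funext => k; apply/eqP; rewrite eq_le bump_approx_ge0 andbT.
  have := bump_approx_le a b k x.
  by rewrite indicE mem_setE in_itv/= (negbTE xab).
have b0 : 0 < bump a b x by case/andP: xab => *; exact: bump_gt0.
rewrite -[X in _ --> X](subr0 (1 : R)); apply: cvgB; first exact: cvg_cst.
apply/cvgrPdist_lt => e e0; near=> k.
rewrite sub0r normrN ger0_norm ?expR_ge0//.
rewrite mulNr expRN -[e]invrK ltf_pV2 ?posrE ?invr_gt0 ?expR_gt0//.
apply: lt_le_trans (expR_ge1Dx _).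
rewrite (@lt_le_trans _ _ (k%:R * bump a b x))//; last by rewrite lerDr.
rewrite -ltr_pdivrMr//.
by near: k; exact: nbhs_infty_gtr.
Unshelve. all: by end_near. Qed.

End smooth_real_functions.

(** * Products of smooth functions of one variable as test functions *)

Section product_test_functions.
Context {R : realType} {n : nat}.
Implicit Types (v : 'I_n -> R -> R) (a b : 'I_n -> R).
Local Notation wp := weight_prod.
Local Notation ST := [set: 'I_n]%SET.

Lemma weight_prodTE v (x : 'rV[R]_n) : wp v ST x = \prod_j v j (x 0 j).
Proof. by apply: eq_bigl => j; rewrite inE. Qed.

Lemma continuous_coordV j : continuous (fun x : 'rV[R]_n => x 0 j).
Proof. exact: coord_continuous. Qed.

Lemma continuous_weight_prodT v : (forall j, continuous (v j)) ->
  continuous (wp v ST : 'rV[R]_n -> R).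
Proof.
move=> cv; rewrite (_ : wp v ST = fun x => \prod_j v j (x 0 j)); last first.
  by apply/funext => x; exact: weight_prodTE.
elim: (index_enum _) => [|j s ih] x.
  have -> : (fun x : 'rV[R]_n => \prod_(j <- [::]) v j (x 0 j)) = fun=> 1.
    by apply/funext => y; rewrite big_nil.
  exact: cst_continuous.
have -> : (fun x : 'rV[R]_n => \prod_(i <- j :: s) v i (x 0 i)) =
    fun x : 'rV[R]_n => v j (x 0 j) * \prod_(i <- s) v i (x 0 i).
  by apply/funext => y; rewrite big_cons.
apply: (@continuousM _ _ (fun x : 'rV[R]_n => v j (x 0 j))); last exact: ih.
exact: (continuous_comp (@continuous_coordV j x) (cv j _)).
Qed.

Definition update v j (f : R -> R) : 'I_n -> R -> R :=
  fun i => if i == j then f else v i.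

Lemma weight_prod_update v j f (x : 'rV[R]_n) :
  wp (update v j f) ST x = wp v (~: [set j]) x * f (x 0 j).
Proof.
rewrite -(weight_prodC _ (~: [set j])) finset.setCK weight_prod1 /update eqxx.
by congr (_ * _); apply: eq_bigr => i; rewrite !inE => /negbTE ->.
Qed.

Lemma is_derive_weight_prodT v j (x : 'rV[R]_n) df :
  is_derive (x 0 j) 1 (v j) df ->
  is_derive x (delta_mx 0 j) (wp v ST) (wp v (~: [set j]) x * df).
Proof.
move=> dvj.
have E h : h^-1 *: (wp v ST (h *: delta_mx 0 j + x) - wp v ST x) =
    wp v (~: [set j]) x * (h^-1 *: (v j (h *: 1 + x 0 j) - v j (x 0 j))).
  have W (y : 'rV[R]_n) : wp v ST y = wp v (~: [set j]) y * v j (y 0 j).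
    by rewrite -(weight_prodC _ (~: [set j])) finset.setCK weight_prod1.
  rewrite !W !mxE !eqxx/=.
  rewrite (_ : wp v _ (_ + x) = wp v (~: [set j]) x); last first.
    apply: eq_bigr => i; rewrite !inE => ij.
    by rewrite !mxE (negbTE ij) andbF mulr0 add0r.
  by rewrite /GRing.scale/=; ring.
have q : h^-1 *: (v j (h *: 1 + x 0 j) - v j (x 0 j)) @[h --> 0^'] --> df.
  by case: dvj => + <-.
have {}q : h^-1 *: (wp v ST (h *: delta_mx 0 j + x) - wp v ST x) @[h --> 0^']
    --> wp v (~: [set j]) x * df.
  rewrite (_ : (fun h => _) = (fun h => wp v (~: [set j]) x *
     (h^-1 *: (v j (h *: 1 + x 0 j) - v j (x 0 j)))) :> (R -> R)); last first.
    by apply/funext => h; exact: E.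
  by apply: cvgM => //; exact: cvg_cst.
apply: DeriveDef; first by apply/cvg_ex; exists (wp v (~: [set j]) x * df).
exact: cvg_lim q.
Qed.

Lemma derive_weight_prodT v j (x : 'rV[R]_n) : smoothR (v j) ->
  derivable (wp v ST) x (delta_mx 0 j) /\
  'D_(delta_mx 0 j) (wp v ST) x = wp (update v j (derive1 (v j))) ST x.
Proof.
move=> /smoothR_derive1[_ /(_ (x 0 j)) /is_derive_weight_prodT[d1 d2]].
by split => //; rewrite d2 weight_prod_update.
Qed.

(** Each partial derivative acts on its own factor, so only the number of occurrences of a direction
    in [s] matters. *)
Lemma partials_weight_prodT v s : (forall j, smoothR (v j)) ->
  partials s (wp v ST) =
  wp (fun j => iter (count_mem j s) (@derive1 R R) (v j)) ST :> ('rV[R]_n -> R).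
Proof.
move=> sv; elim: s => [//|j s ih].
rewrite [LHS]/= ih; apply/funext => x.
have [_ ->] := @derive_weight_prodT
  (fun j => iter (count_mem j s) (@derive1 R R) (v j)) j x
  (smoothR_derive1n _ (sv j)).
rewrite !weight_prodTE; apply: eq_bigr => i _.
by rewrite /update /= eq_sym; case: eqVneq => [->|].
Qed.

Lemma smooth_weight_prodT v : (forall j, smoothR (v j)) -> smooth (wp v ST).
Proof.
move=> sv s; rewrite partials_weight_prodT//.
have sv' j : smoothR (iter (count_mem j s) (@derive1 R R) (v j)).
  exact: smoothR_derive1n.
split; first by apply: continuous_weight_prodT => j; exact: smoothR_continuous.
by move=> j x; have [] := @derive_weight_prodT
  (fun i => iter (count_mem i s) (@derive1 R R) (v i)) j x (sv' j).
Qed.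

Definition ccbox a b : set 'rV[R]_n := boxV (fun j => `[a j, b j]%classic).

Lemma compact_ccbox a b : compact (ccbox a b).
Proof.
apply: (@rV_compact _  _ (fun j => `[a j, b j]%classic)).
by move=> j; apply: segment_compact.
Qed.

Lemma closed_ccbox a b : closed (ccbox a b).
Proof.
apply: compact_closed; last exact: compact_ccbox.
exact: norm_hausdorff.
Qed.

Lemma measurable_ccbox a b : measurable (ccbox a b).
Proof. by apply: measurable_boxV => j; exact: measurable_itv. Qed.

Lemma oobox_prod_le_ccbox a b (x : 'rV[R]_n) :
  wp (oobox a b) ST x <= \1_(ccbox a b) x.
Proof.
rewrite indic_boxV weight_prodTE; apply: ler_prod => j _.
rewrite oobox_ge0 /oobox !indicE !mem_setE !in_itv/= ler_nat.
by case: ltP => //= ax; case: ltP => //= xb; rewrite (ltW ax) (ltW xb).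
Qed.

Lemma test_function_weight_prodT v a b (M : 'I_n -> R) :
  (forall j, smoothR (v j)) ->
  (forall j t, `|v j t| <= M j * oobox a b j t) ->
  test_function (wp v ST).
Proof.
move=> sv vM; split; first exact: smooth_weight_prodT.
apply: (subclosed_compact _ (@compact_ccbox a b)); first exact: closed_closure.
rewrite [X in _ `<=` X](proj1 (closure_id _) (@closed_ccbox a b)).
apply: closure_subset => x /= vx j /=.
have vj : v j (x 0 j) != 0.
  apply: contraNneq vx => vj; rewrite weight_prodTE (bigD1 j)//= vj mul0r//.
have := vM j (x 0 j); rewrite /oobox indicE mem_setE !in_itv/=.
case: ltP => ax /=; last by rewrite mulr0 normr_le0 (negbTE vj).
case: ltP => xb /=; last by rewrite mulr0 normr_le0 (negbTE vj).
by rewrite (ltW ax) (ltW xb).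
Qed.

Lemma integrable_locally_box (p g : 'rV[R]_n -> R) a b (M : R) :
  locally_integrableV p -> measurable_fun setT g ->
  (forall x, `|g x| <= M * wp (oobox a b) ST x) ->
  (lebesgueV n).-integrable setT (fun x => (p x * g x)%:E).
Proof.
move=> [mp /(_ _ (@compact_ccbox a b)) pK] mg gM.
have iK : (lebesgueV n).-integrable setT (fun x => `|M|%:E * (EFin \o p \_ (ccbox a b)) x)%E.
  apply: integrableZl => //.
  have := @integrable_mkcond _ _ _ (lebesgueV n) (ccbox a b) (EFin \o p) (measurable_ccbox a b).
  rewrite restrict_EFin => <-.
  apply/integrableP; split => //.
  by apply/measurable_EFinP/measurable_funTS.
apply: (le_integrable _ _ _ iK) => //; first by mfun.
move=> x _.
change (`|p x * g x|%:E <= `| `|M| * (p \_ (ccbox a b)) x|%:E)%E.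
rewrite lee_fin normrM.
rewrite normrM (ger0_norm (normr_ge0 M)).
rewrite patchE; case: ifPn => xK; last first.
  have := gM x; have := oobox_prod_le_ccbox a b x.
  rewrite indicE (negbTE xK) => h1 h2.
  suff -> : g x = 0 by rewrite normr0 !mulr0.
  apply/eqP; rewrite -normr_le0 (le_trans h2)//.
  have w0 : 0 <= wp (oobox a b) ST x by apply: weight_prod_ge0 => j t; exact: oobox_ge0.
  by rewrite (_ : wp _ _ _ = 0) ?mulr0//; apply/eqP; rewrite eq_le h1 w0.
rewrite mulrC ler_wpM2r// (le_trans (gM x))//.
have w0 : 0 <= wp (oobox a b) ST x by apply: weight_prod_ge0 => j t; exact: oobox_ge0.
rewrite (le_trans (ler_wpM2r w0 (ler_norm M)))// ler_piMr//.
exact: oobox_prod_le1.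
Qed.

(** Testing D^(u+j) f with v, and D^u f with the derivative of v in direction j, both lead to f
    against the same mixed derivative of v, with opposite signs since j is not in u. The function f
    disappears from the resulting relation. *)
Lemma weak_derivative_product (f p r : 'rV[R]_n -> R) (u : {set 'I_n}) j v a b
    (M M' : 'I_n -> R) : j \notin u ->
  is_weak_derivative u f p -> is_weak_derivative (u :|: [set j]) f r ->
  (forall i, smoothR (v i)) ->
  (forall i t, `|v i t| <= M i * oobox a b i t) ->
  (forall t, `|derive1 (v j) t| <= M' j * oobox a b j t) ->
  \int[lebesgueV n]_x (p x * wp (update v j (derive1 (v j))) ST x) =
  - \int[lebesgueV n]_x (r x * wp v ST x).
Proof.
move=> ju [_ pw] [_ rw] sv vM vM'.
have sv' i : smoothR (update v j (derive1 (v j)) i).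
  by rewrite /update; case: ifP => // _; exact: (smoothR_derive1 (sv j)).1.
rewrite pw; last first.
  apply: (@test_function_weight_prodT _ a b (fun i => if i == j then M' i else M i)) => // i t.
  by rewrite /update; case: eqVneq => [->|_]; [exact: vM'|exact: vM].
rewrite rw; last exact: test_function_weight_prodT vM.
rewrite finset.setUC finset.cardsU1 ju exprS mulN1r mulNr opprK; congr (_ * _).
apply: eq_Rintegral => x _; rewrite !partials_weight_prodT//; congr (_ * _).
rewrite !weight_prodTE; apply: eq_bigr => i _.
rewrite !count_uniq_mem ?enum_uniq// !mem_enum !inE /update.
case: eqVneq => [->|ij] /=; first by rewrite (negbTE ju).
by [].
Qed.

End product_test_functions.

(** * Functions determined by their integrals over boxes *)

Section density_measure.
Context d (T : measurableType d) (R : realType) (mu : {measure set T -> \bar R}).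
Local Open Scope ereal_scope.
Variables (f : T -> \bar R) (mf : measurable_fun setT f) (f0 : forall x, 0 <= f x).

(** The proofs are arguments of the definition so that the measure structure can be attached to it
    for every such f. *)
Definition density_measure of measurable_fun setT f & (forall x, 0 <= f x) :=
  fun A : set T => \int[mu]_(x in A) f x.

Let density_measure0 : density_measure mf f0 set0 = 0.
Proof. exact: integral_set0. Qed.

Let density_measure_ge0 A : 0 <= density_measure mf f0 A.
Proof. by apply: integral_ge0. Qed.

Let density_measure_sigma_additive : semi_sigma_additive (density_measure mf f0).
Proof. exact: semi_sigma_additive_nng_induced. Qed.

HB.instance Definition _ := isMeasure.Build _ _ _ (density_measure mf f0)
  density_measure0 density_measure_ge0 density_measure_sigma_additive.

End density_measure.

Section box_integrals.
Context {R : realType} {n : nat}.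
Local Notation lam := (lebesgueV n).
Local Notation leb := (@lebesgue_measure R).
Local Notation wp := weight_prod.
Local Notation ST := [set: 'I_n]%SET.
Local Open Scope ereal_scope.
Definition oobox_set a b : set 'rV[R]_n := boxV (fun j => `]a j, b j[%classic).

Lemma indic_oobox a b (x : 'rV[R]_n) : \1_(oobox_set a b) x = wp (oobox a b) ST x.
Proof. by rewrite indic_boxV weight_prodTE. Qed.

Lemma measurable_oobox_set a b : measurable (oobox_set a b).
Proof. by apply: measurable_boxV => j; exact: measurable_itv. Qed.

Lemma integral_oobox (q : 'rV[R]_n -> R) a b :
  \int[lam]_(x in oobox_set a b) (q x)%:E = \int[lam]_x (q x * wp (oobox a b) ST x)%:E.
Proof.
rewrite integral_mkcond; apply: eq_integral => x _.
rewrite patchE -indic_oobox indicE.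
by case: (_ \in _); rewrite ?mulr1 ?mulr0.
Qed.

(** On a large cube the positive and negative parts of q are densities of two finite measures that
    agree on boxes, hence on all measurable sets, which forces q = 0 almost everywhere there. *)
Lemma box_integrals_ae0 (q : 'rV[R]_n -> R) : measurable_fun setT q ->
  (forall a b, lam.-integrable setT (fun x => (q x * wp (oobox a b) ST x)%:E)) ->
  (forall a b, \int[lam]_x (q x * wp (oobox a b) ST x)%:E = 0) ->
  {ae lam, forall x, q x = 0%R}.
Proof.
move=> mq qi q0.
pose aN (k : nat) : 'I_n -> R := fun=> (- k%:R)%R.
pose bN (k : nat) : 'I_n -> R := fun=> k%:R%R.
have h k : {ae lam, forall x, (q x * wp (oobox (aN k) (bN k)) ST x)%:E = 0}.
  pose f x := (q x * wp (oobox (aN k) (bN k)) ST x)%:E.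
  have fi : lam.-integrable setT f by exact: qi.
  have mf := measurable_int _ fi.
  have mp : measurable_fun setT f^\+ by exact: measurable_funepos.
  have mm : measurable_fun setT f^\- by exact: measurable_funeneg.
  have p0 x : 0 <= f^\+ x by [].
  have m0 x : 0 <= f^\- x by [].
  have pm A : measurable A -> \int[lam]_(x in A) f^\+ x = \int[lam]_(x in A) f^\- x.
    apply: (@boxV_measure_unique _ _ (density_measure lam mp p0)
      (density_measure lam mm m0)) => [a b|a b]; rewrite /= /density_measure.
      have := integrable_funepos measurableT fi.
      move=> /(integrableS measurableT (measurable_oobox_set a b) (@subsetT _ _)).
      move=> /(integrable_lty (measurable_oobox_set a b)).
      exact.
    have fB : lam.-integrable (oobox_set a b) f.
      exact: (integrableS measurableT (measurable_oobox_set a b) (@subsetT _ _) fi).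
    have : \int[lam]_(x in oobox_set a b) f x = 0.
      rewrite integral_oobox.
      (* A box intersected with the cube is again a box, with the larger left and the smaller right
         ends, so the hypothesis on q applies. *)
      rewrite -(q0 (fun i => Num.max (aN k i) (a i)) (fun i => Num.min (bN k i) (b i))).
      apply: eq_integral => x _; congr _%:E; rewrite -mulrA; congr (_ * _)%R.
      rewrite -!indic_oobox !indicE -natrM mulnb; congr (_%:R)%R.
      congr (nat_of_bool _); apply/andP/idP => [[]|]; rewrite !inE.
        move=> h1 h2 i; have := h1 i; have := h2 i; rewrite /= !in_itv/=.
        by rewrite gt_max lt_min => /andP[-> ->] /andP[-> ->].
      move=> h1; split=> i; have := h1 i; rewrite /= !in_itv/= gt_max lt_min;
        by case/andP => /andP[? ?] /andP[? ?]; apply/andP.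
    have ip := integrable_fin_num (measurable_oobox_set a b)
      (integrable_funepos (measurable_oobox_set a b) fB).
    have im := integrable_fin_num (measurable_oobox_set a b)
      (integrable_funeneg (measurable_oobox_set a b) fB).
    move=> fB0; have := integralE lam (oobox_set a b) f; rewrite {}fB0.
    move: ip im; rewrite -/(oobox_set a b).
    move: (integral _ _ (f^\+)) (integral _ _ (f^\-)) => [r||] [s||] // _ _ [].
    by move=> /eqP; rewrite eq_sym subr_eq0 => /eqP ->.
  have := @integral_ae_eq _ _ _ lam setT measurableT (cst 0) f fi (measurable_cst _).
  have z E : E `<=` setT -> measurable E ->
      \int[lam]_(x in E) f x = \int[lam]_(x in E) cst 0 x.
    move=> _ mE; rewrite integral0 integralE pm// subee//.
    apply: integrable_fin_num => //; apply: integrable_funeneg => //.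
    exact: (integrableS measurableT mE (@subsetT _ _) fi).
  by move=> /(_ z); apply: filterS => x /(_ I).
have := ae_foralln h; apply: filterS => x hx.
pose k := (\max_(i < n) (Num.truncn `|x 0%R i|).+1)%N.
have := hx k; rewrite (_ : wp _ _ _ = 1%R) ?mulr1 => [[]//|].
rewrite -indic_oobox indicE mem_set// => i /=.
rewrite in_itv/= -ltr_norml (lt_le_trans (truncnS_gt _))//.
by rewrite ler_nat /k (bigD1 i)//= leq_max leqnn.
Qed.

Lemma integral_itv_len (c e : R) : (c <= e)%R ->
  (\int[leb]_t \1_(`]c, e[%classic) t)%R = (e - c)%R.
Proof.
move=> ce; rewrite /Rintegral integral_indic//= setIT lebesgue_measure_itv/=.
rewrite lte_fin; case: ltP => // ec.
have -> : e = c by apply/le_anti; rewrite ec ce.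
by rewrite subrr.
Qed.

End box_integrals.

Lemma Rintegral_dominated_cvg d (T : measurableType d) (R : realType)
    (mu : {measure set T -> \bar R}) (f_ : nat -> T -> R) (f g : T -> R) :
  (forall k, measurable_fun setT (f_ k)) -> measurable_fun setT f ->
  (forall x, f_ k x @[k --> \oo] --> f x) ->
  mu.-integrable setT (EFin \o g) -> (forall k x, `|f_ k x| <= g x) ->
  (\int[mu]_x f_ k x) @[k --> \oo] --> (\int[mu]_x f x : R).
Proof.
move=> mf_ mf cf ig fg.
have [] := @dominated_convergence _ _ _ mu setT measurableT
  (fun k => EFin \o f_ k) (EFin \o f) (EFin \o g).
- by move=> k; exact/measurable_EFinP.
- exact/measurable_EFinP.
- by apply: aeW => x _; apply: cvg_EFin (cf x); exact: nearW.
- exact: ig.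
- by apply: aeW => x k _; rewrite /= lee_fin.
by move=> i _ h; apply: fine_cvg; rewrite fineK//; exact: integrable_fin_num.
Qed.

(** * Combinations of mean zero *)

Section balance.
Context {R : realType}.
Local Notation leb := (@lebesgue_measure R).
Implicit Types h : R -> R.

(** The coefficients make the integral 0, so that the primitive has compact support when [h1] and
    [h2] do. *)
Definition balance h1 h2 (t : R) : R :=
  (\int[leb]_s h2 s) * h1 t - (\int[leb]_s h1 s) * h2 t.

Section bounded_by_box.
Context {n : nat}.
Variables (a b : 'I_n -> R) (j : 'I_n).
Let box_bounded h := measurable_fun setT h /\ forall t, 0 <= h t <= oobox a b j t.
Variables (h1 h2 : R -> R).
Hypothesis (H1 : box_bounded h1) (H2 : box_bounded h2).

Let L := \int[leb]_t oobox a b j t.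

Let integrable_bounded h : box_bounded h -> leb.-integrable setT (EFin \o h).
Proof.
move=> [mh hb]; apply: le_integrable (integrable_oobox a b j) => //.
  exact/measurable_EFinP.
move=> t _; have /andP[h0 hle] := hb t.
by rewrite /= lee_fin !ger0_norm ?oobox_ge0.
Qed.

Let integral_bounded h : box_bounded h -> 0 <= \int[leb]_t h t <= L.
Proof.
move=> bh; have [mh hb] := bh; apply/andP; split.
  by apply: Rintegral_ge0 => t _; have /andP[] := hb t.
apply: le_Rintegral => //; [exact: integrable_bounded|exact: integrable_oobox|].
by move=> t _; have /andP[] := hb t.
Qed.

Lemma measurable_balance : measurable_fun setT (balance h1 h2).
Proof.
apply: measurable_funB; apply: measurable_funM => //;
  [exact: (proj1 H1)|exact: (proj1 H2)].
Qed.

Lemma balance_bounded t : `|balance h1 h2 t| <= L * oobox a b j t.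
Proof.
have /andP[h10 h1b] := (proj2 H1) t; have /andP[h20 h2b] := (proj2 H2) t.
have /andP[i10 i1b] := integral_bounded H1; have /andP[i20 i2b] := integral_bounded H2.
rewrite /balance ler_norml; apply/andP; split.
  rewrite lerBrDr addrC -lerBrDr opprK (le_trans (y := L * oobox a b j t))//.
    by rewrite ler_pM.
  by rewrite lerDr mulr_ge0.
rewrite lerBlDr (le_trans (y := L * oobox a b j t))//; first by rewrite ler_pM.
by rewrite lerDl mulr_ge0.
Qed.

Lemma integral_balance : \int[leb]_t balance h1 h2 t = 0.
Proof.
have i1 := integrable_bounded H1; have i2 := integrable_bounded H2.
have iZ (c : R) h : box_bounded h -> leb.-integrable setT (EFin \o (fun t => c * h t)).
  by move=> /integrable_bounded hh; exact: (integrableZl measurableT c hh).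
rewrite RintegralB//; [|exact: iZ|exact: iZ].
by rewrite !RintegralZl// mulrC subrr.
Qed.

End bounded_by_box.

Lemma smoothR_balance h1 h2 : smoothR h1 -> smoothR h2 -> smoothR (balance h1 h2).
Proof.
move=> s1 s2; rewrite (_ : balance h1 h2 = fun t =>
    (\int[leb]_s h2 s) * h1 t + (- (\int[leb]_s h1 s)) * h2 t).
  by apply: smoothR_add; apply: smoothR_mul => //; exact: smoothR_cst.
by apply/funext => t; rewrite mulNr.
Qed.

End balance.

Lemma cvg_prod_in (R : realType) (I : finType) (P : pred I) (f_ : I -> nat -> R) (f : I -> R) :
  (forall i, P i -> f_ i k @[k --> \oo] --> f i) ->
  \prod_(i | P i) f_ i k @[k --> \oo] --> \prod_(i | P i) f i.
Proof.
move=> fc; elim: (index_enum I) => [|i s ih].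
  rewrite big_nil (_ : (fun k => _) = fun=> 1); first exact: cvg_cst.
  by apply/funext => k; rewrite big_nil.
rewrite big_cons (_ : (fun k => _) = fun k =>
    if P i then f_ i k * \prod_(i <- s | P i) f_ i k else \prod_(i <- s | P i) f_ i k).
  by case: ifPn => // Pi; apply: cvgM => //; exact: fc.
by apply/funext => k; rewrite big_cons.
Qed.

(** * Weak derivatives tested against boxes *)

Section weak_derivative_boxes.
Context {R : realType} {n : nat}.
Local Notation lam := (lebesgueV n).
Local Notation leb := (@lebesgue_measure R).
Local Notation wp := weight_prod.
Local Notation ST := [set: 'I_n]%SET.

Definition itv_balance (c1 e1 c2 e2 : R) : R -> R :=
  balance \1_`]c1, e1[%classic \1_`]c2, e2[%classic.

Section itv_in_box.
Variables (a b : 'I_n -> R) (j : 'I_n) (c e : R).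
Hypotheses (ac : a j <= c) (eb : e <= b j).

Lemma indic_itv_box_bounded : measurable_fun setT (\1_`]c, e[%classic : R -> R) /\
  forall t, 0 <= (\1_`]c, e[%classic t : R) <= oobox a b j t.
Proof.
split; first exact: measurable_indic.
move=> t; rewrite /oobox !indicE !mem_setE !in_itv/= ler0n/= ler_nat.
case: ltP => //= ct; case: ltP => //= te.
by rewrite (le_lt_trans ac ct) (lt_le_trans te eb).
Qed.

Lemma bump_approx_box_bounded k : measurable_fun setT (bump_approx c e k) /\
  forall t, 0 <= bump_approx c e k t <= oobox a b j t.
Proof.
split; first by apply: smoothR_measurable; exact: smoothR_bump_approx.
move=> t; rewrite bump_approx_ge0 (le_trans (bump_approx_le _ _ _ _))//.
by have /andP[] := (proj2 indic_itv_box_bounded) t.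
Qed.

Lemma integral_bump_approx_cvg : (\int[leb]_t bump_approx c e k t) @[k --> \oo] -->
  (\int[leb]_t \1_`]c, e[%classic t : R).
Proof.
apply: (@Rintegral_dominated_cvg _ _ _ leb (bump_approx c e) \1_`]c, e[%classic (oobox a b j)).
- by move=> k; have [] := bump_approx_box_bounded k.
- exact: measurable_indic.
- by move=> t; exact: bump_approx_cvg.
- exact: integrable_oobox.
- move=> k t; have /andP[b0 bb] := (proj2 (bump_approx_box_bounded k)) t.
  by rewrite ger0_norm.
Qed.

End itv_in_box.

(** For the smooth approximations, the balanced factor is the derivative of its own primitive, which
    is smooth and supported in the side of the box, so [weak_derivative_product] applies. Both sides
    then converge by dominated convergence, with a multiple of the indicator of the box as majorant
    of the test functions. *)
Lemma weak_derivative_itv_balance (f p r : 'rV[R]_n -> R) (u : {set 'I_n}) j a b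
    (c1 e1 c2 e2 : R) : j \notin u ->
  is_weak_derivative u f p -> is_weak_derivative (u :|: [set j]) f r ->
  a j <= c1 -> e1 <= b j -> a j <= c2 -> e2 <= b j ->
  \int[lam]_x (p x *
    (wp (oobox a b) (~: [set j]) x * itv_balance c1 e1 c2 e2 (x 0 j))) =
  - \int[lam]_x (r x *
    (wp (oobox a b) (~: [set j]) x * primitive (itv_balance c1 e1 c2 e2) (x 0 j))).
Proof.
move=> ju pw rw ac1 eb1 ac2 eb2.
pose L : R := \int[leb]_t oobox a b j t.
pose phi k := balance (bump_approx c1 e1 k) (bump_approx c2 e2 k).
(* The test function: bumps in the other directions, and in direction j the primitive, whose
   derivative is [phi k]. *)
pose v k : 'I_n -> R -> R :=
  update (fun i => bump_approx (a i) (b i) k) j (primitive (phi k)).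
have bk1 k := bump_approx_box_bounded ac1 eb1 k.
have bk2 k := bump_approx_box_bounded ac2 eb2 k.
have b1 := indic_itv_box_bounded ac1 eb1.
have b2 := indic_itv_box_bounded ac2 eb2.
have mphik k : measurable_fun setT (phi k) by exact: measurable_balance (bk1 k) (bk2 k).
have mphi : measurable_fun setT (itv_balance c1 e1 c2 e2) by exact: measurable_balance b1 b2.
have phikL k t : `|phi k t| <= L * oobox a b j t by exact: balance_bounded.
have phiL t : `|itv_balance c1 e1 c2 e2 t| <= L * oobox a b j t by exact: balance_bounded.
have phik0 k : \int[leb]_t phi k t = 0 by exact: integral_balance (bk1 k) (bk2 k).
have phi0 : \int[leb]_t itv_balance c1 e1 c2 e2 t = 0 by exact: integral_balance b1 b2.
have io : leb.-integrable setT (EFin \o (fun t => L * oobox a b j t)).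
  apply: (@integrable_box_bounded _ _ a b j _ L) => [|t].
    by apply: measurable_funM => //; exact: measurable_oobox.
  by rewrite ger0_norm// mulr_ge0 ?oobox_ge0// Rintegral_ge0// => s _; exact: oobox_ge0.
pose K : R := \int[leb]_t (L * oobox a b j t).
have ibox (h : R -> R) : measurable_fun setT h -> (forall t, `|h t| <= L * oobox a b j t) ->
    \int[leb]_t `|h t| <= K.
  move=> mh hL; apply: le_Rintegral => //.
  exact: (integrable_norm (integrable_box_bounded mh hL)).
have o0 t : 0 <= oobox a b j t by exact: oobox_ge0.
have primK k t : `|primitive (phi k) t| <= K * oobox a b j t.
  by rewrite (le_trans (primitive_bounded (mphik k) (phikL k) (phik0 k) t))// ler_wpM2r// ibox.
have phic t : phi k t @[k --> \oo] --> itv_balance c1 e1 c2 e2 t.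
  by apply: cvgB; apply: cvgM; [exact: integral_bump_approx_cvg ac2 eb2|exact: bump_approx_cvg
    |exact: integral_bump_approx_cvg ac1 eb1|exact: bump_approx_cvg].
have primc t : primitive (phi k) t @[k --> \oo] --> primitive (itv_balance c1 e1 c2 e2) t.
  apply: (@Rintegral_dominated_cvg _ _ _ leb (fun k s => (s <= t)%R%:R * phi k s)
    (fun s => (s <= t)%R%:R * itv_balance c1 e1 c2 e2 s) (fun t => L * oobox a b j t)) => //.
  - by move=> k; apply: measurable_funM; [by apply: measurable_leb_indic => //; exact: measurable_cst|exact: mphik].
  - by apply: measurable_funM; [by apply: measurable_leb_indic => //; exact: measurable_cst|exact: mphi].
  - by move=> s; apply: cvgM => //; exact: cvg_cst.
  - move=> k s; rewrite normrM (le_trans _ (phikL k s))// ler_piMl//.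
    by case: (s <= t)%R; rewrite ?normr1 ?normr0.
have mpr : measurable_fun setT p by case: pw => -[].
have mrr : measurable_fun setT r by case: rw => -[].
have wpc x : wp (fun i => bump_approx (a i) (b i) k) (~: [set j]) x @[k --> \oo] -->
    (wp (oobox a b) (~: [set j]) x : R).
  apply: cvg_prod_in => i _; exact: bump_approx_cvg.
have wpb k x : `|wp (fun i => bump_approx (a i) (b i) k) (~: [set j]) x| <=
    wp (oobox a b) (~: [set j]) x.
  rewrite ger0_norm; last by apply: weight_prod_ge0 => i t; exact: bump_approx_ge0.
  by apply: ler_prod => i _; rewrite bump_approx_ge0 bump_approx_le.
(* One passage to the limit for both sides: [h_] is the balanced factor or its primitive, with
   bounds uniform in k. *)
have lim (q : 'rV[R]_n -> R) (h_ : nat -> R -> R) (h : R -> R) M : locally_integrableV q ->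
    (forall k, measurable_fun setT (h_ k)) -> measurable_fun setT h ->
    (forall k t, `|h_ k t| <= M * oobox a b j t) ->
    (forall t, h_ k t @[k --> \oo] --> h t) ->
    \int[lam]_x (q x * (wp (fun i => bump_approx (a i) (b i) k) (~: [set j]) x *
      h_ k (x 0 j))) @[k --> \oo] -->
    \int[lam]_x (q x * (wp (oobox a b) (~: [set j]) x * h (x 0 j))).
  move=> lq mh_ mh hM hc; have mq := lq.1.
  have mo := measurable_oobox a b.
  have mb k i : measurable_fun setT (bump_approx (a i) (b i) k).
    by apply: smoothR_measurable; exact: smoothR_bump_approx.
  apply: (@Rintegral_dominated_cvg _ _ _ lam (fun k x => q x *
      (wp (fun i => bump_approx (a i) (b i) k) (~: [set j]) x * h_ k (x 0 j)))
    (fun x => q x * (wp (oobox a b) (~: [set j]) x * h (x 0 j)))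
    (fun x => `|q x * (M * wp (oobox a b) ST x)|)).
  - by move=> k; mfun.
  - by mfun.
  - move=> x; apply: cvgM; first exact: cvg_cst.
    by apply: cvgM; [exact: wpc|exact: hc].
  - apply: (integrable_abse (f := fun x => (q x * (M * wp (oobox a b) ST x))%:E)).
    apply: (@integrable_locally_box _ _ _ _ a b `|M|) => // [|x]; first by mfun.
    rewrite normrM (ger0_norm (x := wp _ _ _))//.
    by apply: weight_prod_ge0 => i t; exact: oobox_ge0.
  - move=> k x; rewrite !normrM ler_wpM2l//.
    apply: (@le_trans _ _ (wp (oobox a b) (~: [set j]) x * (M * oobox a b j (x 0 j)))).
      by rewrite ler_pM.
    have w0 u' : 0 <= wp (oobox a b) u' x by apply: weight_prod_ge0 => i t; exact: oobox_ge0.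
    rewrite (ger0_norm (w0 ST)) -(weight_prodC _ (~: [set j])) finset.setCK weight_prod1.
    by rewrite mulrCA ler_wpM2r ?ler_norm// mulr_ge0.
have LP : \int[lam]_x (p x * (wp (fun i => bump_approx (a i) (b i) k) (~: [set j]) x *
      phi k (x 0 j))) @[k --> \oo] --> (\int[lam]_x (p x *
    (wp (oobox a b) (~: [set j]) x * itv_balance c1 e1 c2 e2 (x 0 j))) : R).
  by apply: (lim p phi _ L pw.1).
have LR : (- \int[lam]_x (r x * (wp (fun i => bump_approx (a i) (b i) k) (~: [set j]) x *
      primitive (phi k) (x 0 j)))) @[k --> \oo] --> (- \int[lam]_x (r x *
    (wp (oobox a b) (~: [set j]) x * primitive (itv_balance c1 e1 c2 e2) (x 0 j))) : R).
  apply: cvgN; apply: (lim r (fun k => primitive (phi k)) _ K rw.1) => //.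
    by move=> k; exact: measurable_primitive.
  exact: measurable_primitive.
(* Both sides are limits of sequences that agree for each k. *)
apply: (cvg_unique _ LP); first exact: Rhausdorff.
apply: cvg_trans LR; apply: near_eq_cvg; apply: nearW => k.
have sphi : smoothR (phi k) by apply: smoothR_balance; exact: smoothR_bump_approx.
have [sprim dprim] := smoothR_primitive_int sphi (integrable_box_bounded (mphik k) (phikL k)).
have dE : derive1 (primitive (phi k)) = phi k.
  by apply/funext => t; rewrite derive1E; apply: derive_val.
have vj : v k j = primitive (phi k) by rewrite /v /update eqxx.
have -> : \int[lam]_x (p x * (wp (fun i => bump_approx (a i) (b i) k) (~: [set j]) x *
    phi k (x 0 j))) = \int[lam]_x (p x * wp (update (v k) j (derive1 (v k j))) ST x).
  apply: eq_Rintegral => x _; rewrite vj dE weight_prod_update.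
  congr (_ * (_ * _)); apply: eq_bigr => i; rewrite !inE => ij.
  by rewrite /v /update (negbTE ij).
rewrite (@weak_derivative_product _ _ f p r u j (v k) a b
  (fun i => if i == j then K else 1) (fun=> L) ju pw rw).
- by congr (- _); apply: eq_Rintegral => x _; rewrite weight_prod_update.
- by move=> i; rewrite /v /update; case: eqVneq => // _; exact: smoothR_bump_approx.
- move=> i t; rewrite /v /update; case: eqVneq => [->|_]; first exact: primK.
  by rewrite mul1r ger0_norm ?bump_approx_ge0// bump_approx_le.
- by move=> t; rewrite vj dE.
Qed.

End weak_derivative_boxes.

(** The exchange preserves the product measure, so the pairs (x, y) with [mix u x y] in a null set
    form a null set, and Tonelli passes to almost every section. *)
Lemma ae_mix (R : realType) (n : nat) (P : 'rV[R]_n -> Prop) (u : {set 'I_n}) :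
  {ae lebesgueV n, forall x, P x} ->
  {ae lebesgueV n, forall x, {ae lebesgueV n, forall y, P (mix u x y)}}.
Proof.
move=> [N [mN N0 PN]].
pose k : 'rV[R]_n -> R := \1_N.
have mk : measurable_fun setT k by exact: measurable_indic.
have k0 x : (0 <= (k x)%:E)%E by rewrite lee_fin.
have I0 : (\int[lebesgueV n]_x \int[lebesgueV n]_y (k (mix u x y))%:E)%E = 0%E.
  have mN1 : measurable_fun setT (fun p : 'rV[R]_n * 'rV[R]_n => (k p.1)%:E) by mfun.
  have := @ge0_integral_swap _ _ u (fun p => (k p.1)%:E) mN1 (fun=> k0 _).
  move=> /= <-; rewrite (ge0_integral_exchange mN1)//; apply: integral0_eq => y _ /=.
  by rewrite integral_indic// setIT.
have mF : measurable_fun setT (fun x => \int[lebesgueV n]_y (k (mix u x y))%:E)%E.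
  apply: (@measurable_eintegral_param _ _ _ _ _ _ (fun p : 'rV[R]_n * 'rV[R]_n =>
    k (mix u p.1 p.2))) => //; mfun.
have := (ae_eq_integral_abs (lebesgueV n) measurableT mF).1.
have -> : (\int[lebesgueV n]_x `|\int[lebesgueV n]_y (k (mix u x y))%:E|)%E = 0%E.
  by rewrite -I0; apply: eq_integral => x _; rewrite gee0_abs//; exact: integral_ge0.
move=> /(_ erefl); apply: filterS => x /(_ I) Ix.
have mkx : measurable_fun setT (fun y => (k (mix u x y))%:E) by mfun.
have := (ae_eq_integral_abs (lebesgueV n) measurableT mkx).1.
under eq_integral do rewrite gee0_abs//.
move=> /(_ Ix); apply: filterS => y /(_ I) [ky].
apply: contrapT => nP; move: ky; rewrite /k indicE mem_set//; last exact: PN.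
by move/eqP; rewrite oner_eq0.
Qed.

Lemma integrable_param_factor d1 d2 (T1 : measurableType d1) (T2 : measurableType d2)
    (R : realType) (m1 : {sigma_finite_measure set T1 -> \bar R})
    (m2 : {sigma_finite_measure set T2 -> \bar R}) (h : T1 * T2 -> R) (g : T1 -> R) :
  measurable_fun setT h -> measurable_fun setT g ->
  (m1 \x m2)%E.-integrable setT (fun p => (h p * g p.1)%:E) ->
  m1.-integrable setT (fun x => ((\int[m2]_y h (x, y)) * g x)%:E).
Proof.
move=> mh mg hi.
have mhg : measurable_fun setT (fun x => ((\int[m2]_y h (x, y)) * g x)%:E).
  by apply/measurable_EFinP; apply: measurable_funM => //; exact: measurable_integral_param.
apply/integrableP; split => //.
have /integrableP[_] := integrable_fubini_F hi; apply: le_lt_trans.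
rewrite le_eqVlt; apply/orP; left; apply/eqP; apply: ae_eq_integral => //.
- exact: measurableT_comp.
- by apply: measurableT_comp => //; exact: measurable_fubini_F hi.
- have := ae_integrable1 hi; apply: filterS => x hx _.
  by rewrite (Rintegral_factor (f := fun y => h (x, y)) (c := g x)).
Qed.

(** * Functions determined by x_u *)

Section balanced_functions.
Context {R : realType} {n : nat}.
Local Notation lam := (lebesgueV n).
Local Notation leb := (@lebesgue_measure R).
Local Notation wp := weight_prod.
Local Notation ST := [set: 'I_n]%SET.
Implicit Types (a b : 'I_n -> R).

Definition replace (P : pred 'I_n) a (c : R) : 'I_n -> R :=
  fun i => if P i then c else a i.

Variables (u : {set 'I_n}) (q : 'rV[R]_n -> R).
Hypothesis mq : measurable_fun setT q.
Hypothesis iq : forall a b, lam.-integrable setT (fun x => (q x * wp (oobox a b) ST x)%:E).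
Hypothesis balq : forall j a b c1 e1 c2 e2, j \notin u ->
  a j <= c1 -> e1 <= b j -> a j <= c2 -> e2 <= b j ->
  \int[lam]_x (q x *
    (wp (oobox a b) (~: [set j]) x * itv_balance c1 e1 c2 e2 (x 0 j))) = 0.

Let J a b := \int[lam]_x (q x * wp (oobox a b) ST x).
Let L a b j := \int[leb]_t oobox a b j t.

(** The side ]a_j, b_j[ is balanced against the unit interval, so the integral over a box is
    proportional to the length of each side outside u. *)
Let J_coordinate j a b : j \notin u ->
  J a b = L a b j * J (replace (pred1 j) a 0) (replace (pred1 j) b 1).
Proof.
move=> ju; set a' := replace _ a 0; set b' := replace _ b 1.
(* An enlarged side containing both ]a_j, b_j[ and ]0, 1[, as [balq] requires. *)
pose c := Num.min (a j) 0; pose e := Num.max (b j) 1.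
have := @balq j (replace (pred1 j) a c) (replace (pred1 j) b e) (a j) (b j) 0 1 ju.
rewrite /replace/= eqxx /c /e !ge_min !le_max !lexx !orbT => /(_ isT isT isT isT).
have i01 : \int[leb]_t (\1_(`]0, 1[%classic) t : R) = 1.
  by rewrite integral_itv_len ?subr0.
have w1 x : wp (oobox a b) (~: [set j]) x * \1_(`]a j, b j[%classic) (x 0 j) =
    wp (oobox a b) ST x.
  by rewrite -(weight_prodC _ (~: [set j])) finset.setCK weight_prod1.
have w2 x : wp (oobox a b) (~: [set j]) x * \1_(`]0, 1[%classic) (x 0 j) =
    wp (oobox a' b') ST x.
  rewrite -(weight_prodC _ (~: [set j])) finset.setCK weight_prod1.
  congr (_ * _); last by rewrite /oobox /a' /b' /replace/= eqxx.
  by apply: eq_bigr => i; rewrite !inE /oobox /a' /b' /replace/= => /negbTE ->.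
rewrite (_ : \int[lam]_x _ = \int[lam]_x (q x * wp (oobox a b) ST x -
    L a b j * (q x * wp (oobox a' b') ST x))); last first.
  apply: eq_Rintegral => x _; rewrite /itv_balance /balance i01 mul1r -w1 -w2.
  rewrite [wp _ (~: _) x](_ : _ = wp (oobox a b) (~: [set j]) x).
    by rewrite /L /oobox; ring.
  by apply: eq_bigr => i; rewrite !inE /oobox /replace/= => /negbTE ->.
rewrite RintegralB//; [|exact: iq|exact: (integrableZl measurableT (L a b j) (iq a' b'))].
by rewrite RintegralZl//; [move/eqP; rewrite subr_eq0 => /eqP|exact: iq].
Qed.

Let J_coordinates (s : seq 'I_n) a b : uniq s -> (forall j, j \in s -> j \notin u) ->
  J a b = (\prod_(j <- s) L a b j) * J (replace (mem s) a 0) (replace (mem s) b 1).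
Proof.
elim: s => [_ _|j s ih /= /andP[js us] su].
  by rewrite big_nil mul1r; congr J; apply/funext => i; rewrite /replace/=.
rewrite ih//; last by move=> i si; apply: su; rewrite inE si orbT.
rewrite big_cons (@J_coordinate j) ?su ?mem_head// mulrA; congr (_ * J _ _).
- rewrite mulrC; congr (_ * _).
  by rewrite /L; apply: eq_Rintegral => t _; rewrite /oobox /replace/= (negbTE js).
- by apply/funext => i; rewrite /replace/= inE; case: eqVneq.
- by apply/funext => i; rewrite /replace/= inE; case: eqVneq.
Qed.

Let J_section a b : J a b = (\prod_(j in ~: u) L a b j) *
  J (replace (mem (~: u)) a 0) (replace (mem (~: u)) b 1).
Proof.
rewrite (@J_coordinates (enum (~: u))) ?enum_uniq//; last first.
  by move=> j; rewrite mem_enum inE.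
have E a' c : replace (mem (enum (~: u))) a' c = replace (mem (~: u)) a' c.
  by apply/funext => i; rewrite /replace/= mem_enum.
by rewrite !E (big_enum _ _ (~: u)).
Qed.

(** The average of q over the unit cube in the variables outside u; the coordinates of y in u
    contribute a factor 1. It depends on x_u only, and q will be shown to equal it. *)
Let Q x := \int[lam]_y (q (mix u x y) * wp (oobox (fun=> 0) (fun=> 1)) ST y).

(** Before the exchange: q on the box with the sides of (a, b) in u and unit sides elsewhere, times
    a box with the opposite choice for the second point. After it: q at the mixed point, the unit
    cube for y and the box (a, b) for x. *)
Let G a b (p : 'rV[R]_n * 'rV[R]_n) :=
  q p.1 * wp (oobox (replace (mem (~: u)) a 0) (replace (mem (~: u)) b 1)) ST p.1 *
  wp (oobox (replace (mem u) a 0) (replace (mem u) b 1)) ST p.2.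

Let measurable_G a b : measurable_fun setT (G a b).
Proof.
have mo a' b' := @measurable_oobox R n a' b'.
by rewrite /G; mfun.
Qed.

Let G_swap a b x y : G a b (mix u x y, mix u y x) =
  q (mix u x y) * wp (oobox (fun=> 0) (fun=> 1)) ST y * wp (oobox a b) ST x.
Proof.
rewrite /G /= -!mulrA; congr (_ * _); rewrite !weight_prodTE -!big_split.
apply: eq_bigr => j _ /=; rewrite !mixE /oobox /replace/= inE.
by case: (j \in u) => //=; rewrite mulrC.
Qed.

Let integral_box a b : (\int[lam]_y (wp (oobox a b) ST y)%:E)%E = (\prod_j L a b j)%:E.
Proof.
rewrite ge0_integral_weight_prod; last 2 first.
- exact: measurable_oobox.
- by move=> j t; exact: oobox_ge0.
rewrite -prodEFin; apply: eq_bigr => j _; rewrite fineK// ge0_fin_numE.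
  exact: integral_oobox_lty.
by apply: integral_ge0 => t _; rewrite lee_fin oobox_ge0.
Qed.

Let integrable_G a b : (lam \x lam)%E.-integrable setT (EFin \o G a b).
Proof.
apply/integrable12ltyP; first by apply/measurable_EFinP.
set a1 := replace (mem (~: u)) a 0; set b1 := replace (mem (~: u)) b 1.
set a2 := replace (mem u) a 0; set b2 := replace (mem u) b 1.
have w0 a' b' (x : 'rV[R]_n) : 0 <= wp (oobox a' b') ST x.
  by apply: weight_prod_ge0 => j t; exact: oobox_ge0.
have mo a' b' := @measurable_oobox R n a' b'.
rewrite (_ : (fun x => _) = fun x => (`|(q x * wp (oobox a1 b1) ST x)%:E| * (\prod_j L a2 b2 j)%:E)%E); last first.
  apply/funext => x; rewrite -integral_box -ge0_integralZl//.
  - by apply: eq_integral => y _; rewrite /= -EFinM normrM (ger0_norm (w0 _ _ y)).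
  - by apply/measurable_EFinP; mfun.
  - by move=> y _; rewrite lee_fin.
have /integrableP[mi ilt] := iq a1 b1.
rewrite ge0_integralZr//.
- apply: lte_mul_pinfty; [exact: integral_ge0| |exact: ltry].
  by rewrite ge0_fin_numE//; exact: integral_ge0.
- by apply: measurableT_comp.
- by rewrite -integral_box integral_ge0// => y _; rewrite lee_fin.
Qed.

Let mQ : measurable_fun setT Q.
Proof.
have mo := @measurable_oobox R n (fun=> 0) (fun=> 1).
apply: (@measurable_integral_param _ _ _ _ _ _ (fun p : 'rV[R]_n * 'rV[R]_n =>
  q (mix u p.1 p.2) * wp (oobox (fun=> 0) (fun=> 1)) ST p.2)); mfun.
Qed.

(** The exchange turns the integral of Q into that of q over the box with unit sides outside u,
    times the lengths of the true sides there; [J_section] identifies this with the integral of q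
    over the whole box. *)
Let Q_box a b :
  lam.-integrable setT (fun x => (Q x * wp (oobox a b) ST x)%:E) /\
  (\int[lam]_x (Q x * wp (oobox a b) ST x)%:E = (J a b)%:E)%E.
Proof.
have mo a' b' := @measurable_oobox R n a' b'.
have w0 a' b' (x : 'rV[R]_n) : 0 <= wp (oobox a' b') ST x.
  by apply: weight_prod_ge0 => j t; exact: oobox_ge0.
pose h (p : 'rV[R]_n * 'rV[R]_n) :=
  q (mix u p.1 p.2) * wp (oobox (fun=> 0) (fun=> 1)) ST p.2.
have mh : measurable_fun setT h by rewrite /h; mfun.
have mg : measurable_fun setT (wp (oobox a b) ST : 'rV[R]_n -> R) by mfun.
have hi : (lam \x lam)%E.-integrable setT (fun p => (h p * wp (oobox a b) ST p.1)%:E).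
  have := integrable_swap u (integrable_G a b).
  rewrite (_ : (EFin \o G a b) \o swapV u = fun p => (h p * wp (oobox a b) ST p.1)%:E)//.
  by apply/funext => -[x y]; rewrite /= G_swap.
split; first exact: (integrable_param_factor mh mg hi).
rewrite (integral_param_factor mh mg hi).
transitivity (\int[lam]_x \int[lam]_y (EFin \o G a b) (x, y))%E.
  rewrite (integral_swap u (integrable_G a b)).
  by apply: eq_integral => x _; apply: eq_integral => y _; rewrite /= G_swap.
rewrite J_section EFinM.
set a1 := replace (mem (~: u)) a 0; set b1 := replace (mem (~: u)) b 1.
transitivity (\int[lam]_x ((q x * wp (oobox a1 b1) ST x)%:E * (\prod_(j in ~: u) L a b j)%:E))%E.
  apply: eq_integral => x _ /=.
  rewrite (_ : \prod_(j in ~: u) _ = \prod_j L (replace (mem u) a 0) (replace (mem u) b 1) j).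
    rewrite -integral_box -integralZl//.
      by apply/integrableP; split; [mfun|under eq_integral do rewrite gee0_abs ?lee_fin ?w0//; rewrite integral_box ltry].
  rewrite [RHS](bigID (mem u))/= [X in _ = X * _]big1 ?mul1r => [|j ju].
    apply: eq_big => [j|j]; rewrite !inE// => ju.
    by apply: eq_Rintegral => t _; rewrite /oobox /replace/= (negbTE ju).
  rewrite /L /oobox /replace/= ju; rewrite integral_itv_len ?subr0//.
rewrite (integralZr measurableT (iq a1 b1)).
by rewrite muleC; congr (_ * _)%E; rewrite /J /Rintegral fineK//; apply: integrable_fin_num => //; exact: iq.
Qed.

(** q and Q have the same box integrals, hence q = Q almost everywhere. So q depends on x_u only,
    its average against rho over the other variables is Q itself, and this average is 0. *)
Lemma balanced_ae0 (rho : 'I_n -> R -> R) :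
  (forall j, positive_density (rho j)) ->
  {ae lam, forall x,
    (\int[lam]_y (q (mix u x y) * wp rho ST y)%:E = 0)%E} ->
  {ae lam, forall x, q x = 0}.
Proof.
move=> hrho q0.
have qQ : {ae lam, forall x, q x - Q x = 0}.
  apply: box_integrals_ae0; first by mfun.
    move=> a b; under eq_fun do rewrite mulrBl EFinB.
    by apply: integrableB; [|exact: iq|exact: (Q_box a b).1].
  move=> a b; under eq_integral do rewrite mulrBl EFinB.
  rewrite (integralB measurableT (iq a b) (Q_box a b).1).
  rewrite (Q_box a b).2 /J /Rintegral fineK ?subee//; last first.
    by apply: integrable_fin_num => //; exact: iq.
  by apply: integrable_fin_num => //; exact: iq.
have Qmix x y : Q (mix u x y) = Q x.
  apply: eq_Rintegral => z _; rewrite (_ : mix u (mix u x y) z = mix u x z)//.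
  by apply/rowP => j; rewrite !mixE; case: (j \in u).
have := ae_mix u qQ; move: q0 qQ; apply: filterS3 => x qx0 qQx.
move=> hy; move: qQx; rewrite (_ : Q x = 0) ?subr0//.
have mrho j : measurable_fun setT (rho j) by exact: density_measurable.
have E : (\int[lam]_y (q (mix u x y) * wp rho ST y)%:E = \int[lam]_y (Q x * wp rho ST y)%:E)%E.
  apply: ae_eq_integral => //; [by mfun|by mfun|].
  move: hy; apply: filterS => y /eqP; by rewrite subr_eq0 Qmix => /eqP -> _.
move: E; rewrite qx0; under eq_integral do rewrite EFinM.
rewrite integralZl//.
  rewrite integral_density//; last 2 first.
  - by move=> j t; exact: density_ge0.
  - by move=> j; exact: density_integral.
  by rewrite mule1 => -[].
exact: integrable_density.
Qed.

End balanced_functions.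

(** * The ANOVA expansion of weak derivatives *)

Lemma subset_setC1 (I : finType) (A : {set I}) x : (A \subset ~: [set x]%SET) = (x \notin A).
Proof. by rewrite -finset.disjoints_subset disjoint_sym finset.disjoints1. Qed.

Lemma EFin_Rintegral d (T : measurableType d) (R : realType)
    (mu : {measure set T -> \bar R}) (h : T -> R) :
  mu.-integrable setT (EFin \o h) -> (\int[mu]_x (h x)%:E)%E = (\int[mu]_x h x)%:E.
Proof. by move=> ih; rewrite /Rintegral fineK//; exact: integrable_fin_num. Qed.

Section finite_sums.
Context d (T : measurableType d) (R : realType) (mu : {measure set T -> \bar R}).
Variables (I : Type) (s : seq I) (P : pred I) (h : I -> T -> R).
Hypothesis ih : forall i, P i -> mu.-integrable setT (EFin \o h i).

Lemma integrable_sum_EFin :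
  mu.-integrable setT (EFin \o (fun x => \sum_(i <- s | P i) h i x)).
Proof.
rewrite (_ : EFin \o _ = fun x => (\sum_(i <- s | P i) (EFin \o h i) x)%E).
  exact: integrable_sum.
by apply/funext => x /=; rewrite sumEFin.
Qed.

End finite_sums.

Lemma Rintegral_sum d (T : measurableType d) (R : realType)
    (mu : {measure set T -> \bar R}) I (s : seq I) (P : pred I) (h : I -> T -> R) :
  (forall i, P i -> mu.-integrable setT (EFin \o h i)) ->
  \int[mu]_x (\sum_(i <- s | P i) h i x) = \sum_(i <- s | P i) \int[mu]_x h i x.
Proof.
move=> ih; elim: s => [|i s IH].
  by rewrite big_nil; under eq_Rintegral do rewrite big_nil; rewrite /Rintegral integral0.
rewrite big_cons -IH; under eq_Rintegral do rewrite big_cons.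
case: ifPn => // Pi; rewrite RintegralD//; first exact: ih.
exact: integrable_sum_EFin.
Qed.

Section reconstruction.
Context {R : realType} {n : nat}.
Variables rho psi : 'I_n -> R -> R.
Hypothesis hrho : forall j, positive_density (rho j).
Hypothesis hpsi : forall j, positive_weight (psi j).
Hypothesis hcond : forall j, embedding_condition (rho j) (psi j).
Local Notation lam := (lebesgueV n).
Local Notation leb := (@lebesgue_measure R).
Local Notation wp := weight_prod.
Local Notation ST := [set: 'I_n]%SET.
Implicit Types (u w v : {set 'I_n}).

Let mrho j : measurable_fun setT (rho j). Proof. exact: density_measurable. Qed.
Let rho0 j t : (0 <= rho j t)%R. Proof. exact: density_ge0. Qed.
Let rho1 j : (\int[leb]_t (rho j t)%:E = 1)%E. Proof. exact: density_integral. Qed.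
Let mpsi j : measurable_fun setT (psi j). Proof. exact: weight_measurable. Qed.
Let psi0 j t : (0 < psi j t)%R. Proof. exact: weight_gt0. Qed.

Definition anova_mean v (g : 'rV[R]_n -> R) (x : 'rV[R]_n) : R :=
  \int[lam]_y (g (mix v x y) * wp rho ST y).

Lemma measurable_anova_mean v g : measurable_fun setT g ->
  measurable_fun setT (anova_mean v g).
Proof.
move=> mg; apply: (@measurable_integral_param _ _ _ _ _ _ (fun p : 'rV[R]_n * 'rV[R]_n =>
  g (mix v p.1 p.2) * wp rho ST p.2)); mfun.
Qed.

Lemma anova_mean_mix v g x y : anova_mean v g (mix v x y) = anova_mean v g x.
Proof.
apply: eq_Rintegral => z _; rewrite (_ : mix v (mix v x y) z = mix v x z)//.
by apply/rowP => j; rewrite !mixE; case: (j \in v).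
Qed.

Lemma disjoint_subsetC u w : w \subset ~: u -> [disjoint u & w]%B.
Proof. by rewrite disjoint_sym finset.disjoints_subset. Qed.

Lemma anova_term0 u g x :
  anova_term rho u finset.set0 (anova_mean u g) x = anova_mean u g x.
Proof.
rewrite /anova_term (_ : \int[lam]_t _ = \int[lam]_t (anova_mean u g x * wp rho ST t)).
  rewrite RintegralZl//; last exact: integrable_density.
  rewrite (_ : \int[lam]_t _ = 1) ?mulr1//.
  by rewrite /Rintegral integral_density.
apply: eq_Rintegral => t _; rewrite /anova_integrand/= anova_mean_mix.
by rewrite /kernelV big_set0 mul1r finset.setC0.
Qed.

(** [fiber_norm2] has a finite integral against a strictly positive weight. *)
Lemma fiber_norm2_lty u w F : measurable_fun setT F -> [disjoint u & w]%B ->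
  (weighted_norm2 rho psi (u :|: w) F < +oo)%E ->
  {ae lam, forall x, (fiber_norm2 rho psi u w F x < +oo)%E}.
Proof.
move=> mF uw NF.
have c0 x : 0 < wp psi u x * wp rho (~: u) x.
  by rewrite mulr_gt0// weight_prod_gt0// => j t; case: (hrho j).
have h : lam.-integrable setT (fun x => fiber_norm2 rho psi u w F x *
    (wp psi u x * wp rho (~: u) x)%:E)%E.
  apply/integrableP; split.
    by apply: emeasurable_funM; [exact: measurable_fiber_norm2|mfun].
  under eq_integral do rewrite gee0_abs ?mule_ge0 ?fiber_norm2_ge0 ?lee_fin ?ltW//.
  by rewrite integral_fiber_norm2.
have := integrable_ae measurableT h; apply: filterS => x /(_ I).
have := c0 x.
move: (wp psi u x * wp rho (~: u) x) => c.
have := fiber_norm2_ge0 hrho hpsi u w F x.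
case: (fiber_norm2 _ _ _ _ _ _) => [r||] //; first by rewrite ltry.
by move=> _ c0'; rewrite gt0_mulye ?lte_fin.
Qed.

Variables (f : 'rV[R]_n -> R) (p : {set 'I_n} -> 'rV[R]_n -> R).
Hypothesis pw : forall v, is_weak_derivative v f (p v).
Hypothesis ip : forall v, {ae lam, forall x,
  lam.-integrable setT (fun y => (p v (mix v x y) * wp rho ST y)%:E)}.
Local Notation F v := (anova_mean v (p v)).
Hypothesis Np : forall v, (weighted_norm2 rho psi v (F v) < +oo)%E.

Definition anova_sum u x :=
  \sum_(w : {set 'I_n} | w \subset ~: u) anova_term rho u w (F (u :|: w)) x.

Let mp v : measurable_fun setT (p v). Proof. by case: (pw v) => -[]. Qed.
Let mF v : measurable_fun setT (F v). Proof. exact: measurable_anova_mean. Qed.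

Lemma measurable_anova_sum u : measurable_fun setT (anova_sum u).
Proof.
rewrite (_ : anova_sum u = fun x => \sum_(w <- [seq w : {set 'I_n} <- index_enum _ | w \subset ~: u])
  anova_term rho u w (F (u :|: w)) x).
  by apply: measurable_sum => w; exact: measurable_anova_term.
by apply/funext => x; rewrite big_filter.
Qed.

Let integrable_p_box v a b c (g : 'rV[R]_n -> R) : measurable_fun setT g ->
  (forall x, `|g x| <= c * wp (oobox a b) ST x) ->
  lam.-integrable setT (fun x => (p v x * g x)%:E).
Proof. by move=> mg gc; apply: (integrable_locally_box (pw v).1 mg gc). Qed.

Let integrable_term_box u w a b c (g : 'rV[R]_n -> R) : w \subset ~: u ->
  measurable_fun setT g ->
  (forall x, `|g x| <= c * wp (oobox a b) ST x) ->
  lam.-integrable setT (fun x => (anova_term rho u w (F (u :|: w)) x * g x)%:E).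
Proof.
move=> wu mg gc.
exact: (integrable_anova_term_box hrho hpsi hcond (mF _) (disjoint_subsetC wu) (Np _) mg gc).
Qed.

Let integral_sum_box u a b c (g : 'rV[R]_n -> R) : measurable_fun setT g ->
  (forall x, `|g x| <= c * wp (oobox a b) ST x) ->
  \int[lam]_x (anova_sum u x * g x) =
  \sum_(w : {set 'I_n} | w \subset ~: u) \int[lam]_x (anova_term rho u w (F (u :|: w)) x * g x).
Proof.
move=> mg gc; rewrite -Rintegral_sum.
  by apply: eq_Rintegral => x _; rewrite /anova_sum mulr_suml.
move=> w wu; exact: integrable_term_box gc.
Qed.

Let integrable_sum_box u a b c (g : 'rV[R]_n -> R) : measurable_fun setT g ->
  (forall x, `|g x| <= c * wp (oobox a b) ST x) ->
  lam.-integrable setT (fun x => (anova_sum u x * g x)%:E).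
Proof.
move=> mg gc; rewrite (_ : (fun x => _) = EFin \o (fun x =>
    \sum_(w : {set 'I_n} | w \subset ~: u) (anova_term rho u w (F (u :|: w)) x * g x))).
  by apply: integrable_sum_EFin => w wu; exact: integrable_term_box gc.
by apply/funext => x; rewrite /anova_sum /= mulr_suml.
Qed.

(** A term with j outside w integrates to 0; the terms with j in w correspond to the terms for u+j
    by removing j from w. *)
Lemma anova_sum_balance u j a b c1 e1 c2 e2 : j \notin u ->
  a j <= c1 -> e1 <= b j -> a j <= c2 -> e2 <= b j ->
  \int[lam]_x (anova_sum u x *
    (wp (oobox a b) (~: [set j]) x * itv_balance c1 e1 c2 e2 (x 0 j))) =
  - \int[lam]_x (anova_sum (u :|: [set j]) x *
    (wp (oobox a b) (~: [set j]) x * primitive (itv_balance c1 e1 c2 e2) (x 0 j))).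
Proof.
move=> ju ac1 eb1 ac2 eb2; set phi := itv_balance _ _ _ _.
have b1 := indic_itv_box_bounded ac1 eb1.
have b2 := indic_itv_box_bounded ac2 eb2.
have mphi : measurable_fun setT phi by exact: measurable_balance b1 b2.
pose L : R := \int[leb]_t oobox a b j t.
have phiL t : `|phi t| <= L * oobox a b j t by exact: balance_bounded.
have phi0 : \int[leb]_t phi t = 0 by exact: integral_balance b1 b2.
have primK := primitive_bounded mphi phiL phi0.
have mprim := measurable_primitive mphi.
have mo := measurable_oobox a b.
rewrite (integral_sum_box _ _ (box_factor_bounded phiL)); last by mfun.
rewrite (integral_sum_box _ _ (box_factor_bounded primK)); last by mfun.
rewrite (bigID (fun w : {set 'I_n} => j \in w))/= [X in _ + X]big1 ?addr0; last first.
  move=> w /andP[wu jw]; rewrite /Rintegral.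
  by rewrite (integral_anova_term_box0 hrho hpsi hcond mphi phiL phi0 (mF _) (disjoint_subsetC wu) (Np _) ju jw).
rewrite -sumrN.
rewrite (reindex_onto (fun w : {set 'I_n} => j |: w) (fun w => w :\ j))/=; last first.
  by move=> w /andP[_ jw]; rewrite finset.setD1K.
apply: eq_big => [w|w].
  rewrite !inE eqxx orTb andbT finset.setCU finset.subsetI finset.subUset.
  rewrite finset.sub1set inE ju/= subset_setC1; congr (_ && _).
  apply/eqP/idP => [<-|jw]; first by rewrite !inE eqxx.
  by rewrite finset.setU1K.
rewrite !inE eqxx => /andP[/andP[wu _] /eqP wj].
rewrite {1}/Rintegral (integral_anova_term_box hrho hpsi hcond mphi phiL phi0 (mF _) (disjoint_subsetC wu) (Np _)).
  rewrite wj finset.setUA.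
  have wuj : w \subset ~: (u :|: [set j]).
    move: wu; rewrite finset.setCU finset.subsetI finset.subUset => /andP[_ ->].
    by rewrite subset_setC1 -wj !inE eqxx.
  rewrite -mulN1r -RintegralZl//.
    by apply: eq_Rintegral => x _; ring.
  by apply: (integrable_term_box wuj _ (box_factor_bounded primK)); mfun.
by rewrite !inE eqxx.
Qed.

(** The induction has no separate base: for u the full set there is no direction outside u, and only
    the average has to be compared. *)
Lemma weak_derivative_anova_sum u : {ae lam, forall x, p u x = anova_sum u x}.
Proof.
have [k] := ubnP #|~: u|; elim: k u => // k ih u /ltnSE uk.
have mg := measurable_anova_sum u.
suff : {ae lam, forall x, p u x - anova_sum u x = 0}.
  by apply: filterS => x /eqP; rewrite subr_eq0 => /eqP.
apply: (@balanced_ae0 _ _ u _ _ _ _ rho) => //.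
- by apply: measurable_funB.
- move=> a b; under eq_fun do rewrite mulrBl EFinB.
  have mo := measurable_oobox a b.
  have w1 x : `|wp (oobox a b) ST x| <= 1 * wp (oobox a b) ST x.
    by rewrite mul1r ger0_norm// weight_prod_ge0// => i t; exact: oobox_ge0.
  apply: integrableB => //; [apply: (integrable_p_box _ _ w1); mfun|].
  apply: (integrable_sum_box _ _ w1); mfun.
- move=> j a b c1 e1 c2 e2 ju ac1 eb1 ac2 eb2.
  have b1 := indic_itv_box_bounded ac1 eb1.
  have b2 := indic_itv_box_bounded ac2 eb2.
  have mphi : measurable_fun setT (itv_balance c1 e1 c2 e2) by exact: measurable_balance b1 b2.
  have phiL := balance_bounded b1 b2.
  have mo := measurable_oobox a b.
  under eq_Rintegral do rewrite mulrBl.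
  rewrite RintegralB//; last 2 first.
  - by apply: (integrable_p_box _ _ (box_factor_bounded phiL)); mfun.
  - by apply: (integrable_sum_box _ _ (box_factor_bounded phiL)); mfun.
  rewrite anova_sum_balance// (weak_derivative_itv_balance ju (pw u) (pw _))//.
  apply/eqP; rewrite subr_eq0; apply/eqP; congr (- fine _).
  have mprim := measurable_primitive mphi.
  have mg' := measurable_anova_sum (u :|: [set j]).
  apply: ae_eq_integral => //; [by have mpj := mp (u :|: [set j]); mfun|by mfun|].
  (* The primitive tests D^(u+j) f, which the induction hypothesis replaces by its expansion. *)
  have /ih : (#|~: (u :|: [set j])| < k)%N.
    rewrite (leq_trans _ uk)// finset.setCU; apply: proper_card.
    apply/properP; split; first exact: finset.subsetIl.
    by exists j; rewrite !inE ?ju// eqxx andbF.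
  by apply: filterS => x -> _.
(* It remains to compare the averages over the variables outside u: that of [p u] is [F u] by
   definition, and every term with w nonempty has average 0. *)
have mu : {ae lam, forall x w, w \subset ~: u ->
    (fiber_norm2 rho psi u w (F (u :|: w)) x < +oo)%E}.
  apply: filter_forall => w.
  case: (boolP (w \subset ~: u)) => wu; last exact: aeW.
  by have := fiber_norm2_lty (mF _) (disjoint_subsetC wu) (Np _); apply: filterS.
move: mu (ip u); apply: filterS2 => x hx ix.
have T0 : anova_term rho u finset.set0 (F (u :|: finset.set0)) = F u.
  by apply/funext => y; rewrite finset.setU0 anova_term0.
have iT w : w \subset ~: u -> lam.-integrable setT (fun y =>
    (anova_term rho u w (F (u :|: w)) (mix u x y) * wp rho ST y)%:E).
  have [->|w0] := eqVneq w finset.set0 => wu.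
    rewrite T0; under eq_fun do rewrite anova_mean_mix EFinM.
    by apply: integrableZl => //; exact: integrable_density.
  by have [] := integral_anova_term_mix hrho hpsi hcond (mF _) (disjoint_subsetC wu) w0 (hx w wu).
have iS : lam.-integrable setT (fun y => (anova_sum u (mix u x y) * wp rho ST y)%:E).
  rewrite (_ : (fun y => _) = EFin \o (fun y => \sum_(w : {set 'I_n} | w \subset ~: u)
    (anova_term rho u w (F (u :|: w)) (mix u x y) * wp rho ST y))).
    by apply: integrable_sum_EFin => w wu; exact: iT.
  by apply/funext => y; rewrite /anova_sum /= mulr_suml.
under eq_integral do rewrite mulrBl EFinB.
rewrite (integralB measurableT ix iS).
rewrite (@EFin_Rintegral _ _ _ _ (fun y => p u (mix u x y) * wp rho ST y))//.
rewrite (@EFin_Rintegral _ _ _ _ (fun y => anova_sum u (mix u x y) * wp rho ST y))//.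
rewrite -EFinB -/(F u x) (_ : \int[lam]_y _ = F u x) ?subrr//.
under eq_Rintegral do rewrite mulr_suml.
rewrite Rintegral_sum; last by move=> w wu; exact: iT.
rewrite (bigD1 finset.set0) ?finset.sub0set//= big1 ?addr0 => [|w /andP[wu w0]].
  under eq_Rintegral do rewrite T0 anova_mean_mix.
  rewrite RintegralZl//; last exact: integrable_density.
  rewrite (_ : \int[lam]_t _ = 1) ?mulr1//.
  by rewrite /Rintegral integral_density.
by have [_] := integral_anova_term_mix hrho hpsi hcond (mF _) (disjoint_subsetC wu) w0 (hx w wu);
  rewrite /Rintegral => ->.
Qed.

End reconstruction.

(** * Orthogonality of the ANOVA terms *)

Section anova_orthogonality.
Context {R : realType} {n : nat}.
Variables rho psi : 'I_n -> R -> R.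
Hypothesis hrho : forall j, positive_density (rho j).
Hypothesis hpsi : forall j, positive_weight (psi j).
Hypothesis hcond : forall j, embedding_condition (rho j) (psi j).
Local Notation lam := (lebesgueV n).
Local Notation wp := weight_prod.
Local Notation C j := (embedding_const (rho j) (psi j)).
Implicit Types (u w v : {set 'I_n}).

Let mrho j : measurable_fun setT (rho j). Proof. exact: density_measurable. Qed.
Let rho0 j t : (0 <= rho j t)%R. Proof. exact: density_ge0. Qed.
Let mpsi j : measurable_fun setT (psi j). Proof. exact: weight_measurable. Qed.
Let psi0 j t : (0 < psi j t)%R. Proof. exact: weight_gt0. Qed.

Lemma embedding_const_ge0 j : (0 <= C j)%E.
Proof.
apply: integral_ge0 => t _; rewrite lee_fin; apply: divr_ge0; last exact: ltW.
apply: mulr_ge0; first exact: density_cdf_ge0.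
by rewrite subr_ge0 density_cdf_le1.
Qed.

Lemma prod_embedding_const_ge0 w : (0 <= \prod_(j in w) C j)%E.
Proof. by apply: prode_ge0 => j _; exact: embedding_const_ge0. Qed.

Lemma prod_embedding_const_lty w : (\prod_(j in w) C j < +oo)%E.
Proof.
rewrite (eq_bigr (fun j => (fine (C j))%:E)) ?prodEFin ?ltry// => j _.
by rewrite fineK// ge0_fin_numE ?embedding_const_ge0//; exact: embedding_const_lty.
Qed.

Lemma weighted_norm2_ge0 v F : (0 <= weighted_norm2 rho psi v F)%E.
Proof.
apply: integral_ge0 => x _; rewrite lee_fin mulr_ge0 ?sqr_ge0// mulr_ge0//;
  by apply: weight_prod_ge0 => // j t; exact: ltW.
Qed.

Variables (u : {set 'I_n}) (F : {set 'I_n} -> 'rV[R]_n -> R).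
Hypothesis mF : forall w, measurable_fun setT (F w).
Hypothesis NF : forall w, (weighted_norm2 rho psi (u :|: w) (F w) < +oo)%E.
Local Notation T w := (anova_term rho u w (F w)).
Local Notation c := (fun x => wp psi u x * wp rho (~: u) x).

Let mT w : measurable_fun setT (T w). Proof. exact: measurable_anova_term. Qed.

Lemma weighted_norm2_anova_term_le w : w \subset ~: u ->
  (weighted_norm2 rho psi u (T w) <=
    \prod_(j in w) C j * weighted_norm2 rho psi (u :|: w) (F w))%E.
Proof. by move=> /disjoint_subsetC; exact: integral_anova_term_sqr_le. Qed.

Let norm2_term_lty w : w \subset ~: u -> (weighted_norm2 rho psi u (T w) < +oo)%E.
Proof.
move=> wu; apply: le_lt_trans (weighted_norm2_anova_term_le wu) _.
rewrite lte_mul_pinfty ?prod_embedding_const_ge0//.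
by rewrite ge0_fin_numE ?prod_embedding_const_ge0// prod_embedding_const_lty.
Qed.

Let integrable_terms w w' : w \subset ~: u -> w' \subset ~: u ->
  lam.-integrable setT (fun x => (T w x * (T w' x * c x))%:E).
Proof.
move=> wu wu'; have mw := mT w; have mw' := mT w'.
apply: (integrable_anova_termM hrho (mF w)); first by mfun.
exact: (integrable_anova_term_weighted hrho hpsi hcond (mF w)
  (disjoint_subsetC wu) mw' (NF w) (norm2_term_lty wu')).
Qed.

(** With j in w but not in w', the term for w' does not depend on x_j, while that for w has mean
    zero in x_j. *)
Let orthogonal_term j w w' : w \subset ~: u -> w' \subset ~: u ->
  j \in w -> j \notin w' -> \int[lam]_x (T w x * (T w' x * c x)) = 0.
Proof.
move=> wu wu' jw jw'; rewrite /Rintegral.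
rewrite (integral_anova_term_weighted hrho hpsi hcond (mF w) (disjoint_subsetC wu) jw
  (mT w'))//; last exact: norm2_term_lty.
apply: indep_coord_anova_term => //.
by have /fintype.subsetP/(_ _ jw) := wu; rewrite inE.
Qed.

Let orthogonal_terms w w' : w \subset ~: u -> w' \subset ~: u -> w != w' ->
  \int[lam]_x (T w x * (T w' x * c x)) = 0.
Proof.
move=> wu wu' ww'.
(* Distinct sets differ by an element of one of them, and the integral is symmetric in w and w'. *)
have [|/fintype.subsetPn[j jw jw']] := boolP (w \subset w'); last exact: orthogonal_term jw jw'.
have [|/fintype.subsetPn[j jw' jw] _] := boolP (w' \subset w).
  by move=> w'w ww; move: ww'; rewrite finset.eqEsubset ww w'w.
rewrite -[RHS](orthogonal_term wu' wu jw' jw).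
by apply: eq_Rintegral => x _; ring.
Qed.

Lemma weighted_norm2_anova_sum :
  weighted_norm2 rho psi u (fun x => \sum_(w : {set 'I_n} | w \subset ~: u) T w x) =
  (\sum_(w : {set 'I_n} | w \subset ~: u) weighted_norm2 rho psi u (T w))%E.
Proof.
transitivity (\int[lam]_x (\sum_(w : {set 'I_n} | w \subset ~: u)
    \sum_(w' : {set 'I_n} | w' \subset ~: u) (T w x * (T w' x * c x)))%:E)%E.
  apply: eq_integral => x _; congr _%:E; rewrite expr2 -mulrA mulr_suml.
  by apply: eq_bigr => w _; rewrite mulr_suml mulr_sumr.
have i1 w : w \subset ~: u -> lam.-integrable setT (EFin \o (fun x =>
    \sum_(w' : {set 'I_n} | w' \subset ~: u) (T w x * (T w' x * c x)))).
  by move=> wu; apply: integrable_sum_EFin => w' wu'; exact: integrable_terms.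
rewrite EFin_Rintegral; last exact: integrable_sum_EFin.
rewrite Rintegral_sum// -sumEFin; apply: eq_bigr => w wu.
rewrite Rintegral_sum; last by move=> w' wu'; exact: integrable_terms.
rewrite (bigD1 w)//= big1 ?addr0; last first.
  by move=> w' /andP[wu' ww']; apply: orthogonal_terms => //; rewrite eq_sym.
rewrite -(@EFin_Rintegral _ _ _ _ (fun x => T w x * (T w x * c x))); last exact: integrable_terms.
by apply: eq_integral => x _; congr _%:E; ring.
Qed.

End anova_orthogonality.

(** * The equivalence constant *)

Section norm_comparison.
Context {R : realType} {n : nat}.
Variables (rho psi : 'I_n -> R -> R) (gamma : {set 'I_n} -> R).
Hypothesis hrho : forall j, positive_density (rho j).
Hypothesis hpsi : forall j, positive_weight (psi j).
Hypothesis hcond : forall j, embedding_condition (rho j) (psi j).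
Hypothesis hgamma : forall u, 0 < gamma u.
Local Notation C j := (embedding_const (rho j) (psi j)).
Implicit Types (u w v : {set 'I_n}).
Local Open Scope ereal_scope.

Lemma equivalence_const_ge v :
  \sum_(w : {set 'I_n} | w \subset v) (gamma v / gamma (v :\: w))%:E * \prod_(j in w) C j <=
  equivalence_const rho psi gamma.
Proof.
rewrite /equivalence_const [leRHS](bigD1 v)//= le_max; apply/orP; left; exact: lexx.
Qed.

(** The entry of the maximum at v = empty set contains the term w = empty set, which is 1. In
    particular the constant is positive, although the maximum starts at -oo. *)
Lemma equivalence_const_ge1 : 1 <= equivalence_const rho psi gamma.
Proof.
apply: le_trans (equivalence_const_ge finset.set0).
rewrite (bigD1 finset.set0)//= big_set0 mule1 finset.setD0 divff ?gt_eqF//.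
rewrite leeDl//; apply: sume_ge0 => w _.
rewrite mule_ge0 ?(prod_embedding_const_ge0 hrho hpsi)//.
by rewrite lee_fin divr_ge0 ?ltW.
Qed.

Lemma equivalence_const_lty : equivalence_const rho psi gamma < +oo.
Proof.
rewrite /equivalence_const; elim/big_ind: _ => //.
- by move=> x y x1 y1; rewrite gt_max x1 y1.
move=> v _; apply: lte_sum_pinfty => w _.
rewrite lte_mul_pinfty ?lee_fin ?divr_ge0 ?ltW//.
exact: prod_embedding_const_lty.
Qed.

(** Pairs (u, w) with w outside u correspond to pairs (v, w) with w inside v through u = v \ w, and
    1/gamma_(v \ w) is gamma_v / gamma_(v \ w) times 1/gamma_v. For fixed v this yields the sum over
    w in the constant. *)
Lemma sum_norm2_le (N : {set 'I_n} -> \bar R) : (forall v, 0 <= N v) ->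
  \sum_u (gamma u)^-1%:E * (\sum_(w : {set 'I_n} | w \subset ~: u)
    \prod_(j in w) C j * N (u :|: w)) <=
  equivalence_const rho psi gamma * \sum_v (gamma v)^-1%:E * N v.
Proof.
move=> N0; have C0 w := prod_embedding_const_ge0 hrho hpsi w.
have g0 u : 0 <= (gamma u)^-1%:E by rewrite lee_fin invr_ge0 ltW.
rewrite ge0_sume_distrr; last by move=> v _; rewrite mule_ge0.
rewrite (eq_bigr (fun u => \sum_(w : {set 'I_n} | w \subset ~: u)
    (gamma u)^-1%:E * (\prod_(j in w) C j * N (u :|: w)))); last first.
  by move=> u _; rewrite ge0_sume_distrr// => w _; rewrite mule_ge0.
rewrite (exchange_big_dep xpredT)//=.
rewrite (eq_bigr (fun w : {set 'I_n} => \sum_(v : {set 'I_n} | w \subset v)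
   (gamma (v :\: w))^-1%:E * (\prod_(j in w) C j * N v))); last first.
  move=> w _; rewrite (reindex_onto (fun v => v :\: w) (fun u => u :|: w))/=; last first.
    move=> u wu; apply/finset.setP => i; rewrite !inE.
    case: (boolP (i \in w)) => iw /=; last by rewrite orbF.
    by have /fintype.subsetP/(_ i iw) := wu; rewrite inE => /negbTE.
  apply: eq_big => [v|v /andP[_ /eqP ->]]//.
  have -> : (v :\: w) :|: w = v :|: w.
    by apply/finset.setP => i; rewrite !inE; case: (i \in w); rewrite ?orbT ?orbF.
  have -> : w \subset ~: (v :\: w).
    by apply/fintype.subsetP => i iw; rewrite !inE iw.
  by rewrite finset.setUC; apply/eqP/idP => /finset.setUidPr.
rewrite (exchange_big_dep xpredT)//=; apply: lee_sum => v _.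
apply: (@le_trans _ _ ((\sum_(w : {set 'I_n} | w \subset v)
  (gamma v / gamma (v :\: w))%:E * \prod_(j in w) C j) * ((gamma v)^-1%:E * N v))).
  rewrite ge0_sume_distrl; last first.
    by move=> w _; rewrite mule_ge0// lee_fin divr_ge0 ?ltW.
  apply: lee_sum => w _; rewrite le_eqVlt; apply/orP; left; apply/eqP.
  rewrite [RHS]muleACA -EFinM mulrAC divff ?gt_eqF// mul1r muleA//.
by rewrite lee_wpmul2r ?equivalence_const_ge// mule_ge0.
Qed.

End norm_comparison.

(** * Comparison of the two norms *)

Section merge.
Context {R : realType} {n : nat}.
Variable rho : 'I_n -> R -> R.
Hypothesis hrho : forall j, positive_density (rho j).
Local Notation lam := (lebesgueV n).
Local Notation leb := (@lebesgue_measure R).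
Local Notation wp := weight_prod.
Local Notation ST := [set: 'I_n]%SET.
Local Open Scope ereal_scope.
Variable u : {set 'I_n}.
Local Notation lamu := (lebesgueV #|u|).
Local Notation lamc := (lebesgueV #|~: u|).

Let mrho j : measurable_fun setT (rho j). Proof. exact: density_measurable. Qed.
Let rho0 j t : (0 <= rho j t)%R. Proof. exact: density_ge0. Qed.
Let rho1 j : \int[leb]_t (rho j t)%:E = 1. Proof. exact: density_integral. Qed.

Lemma integral_merge_marginal (g : 'rV[R]_n -> R) (k : 'rV[R]_#|u| -> R) :
  measurable_fun setT g -> (forall x, (0 <= g x)%R) ->
  (forall y z, g (mergeV y z) = k y) ->
  \int[lam]_x (g x * wp rho (~: u) x)%:E = \int[lamu]_y (k y)%:E.
Proof.
move=> mg g0 gk; rewrite (ge0_integral_merge u); last 2 first.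
- by mfun.
- by move=> x; rewrite lee_fin mulr_ge0// weight_prod_ge0.
apply: eq_integral => y _; under eq_integral do rewrite gk EFinM.
have k0 : (0 <= k y)%R by rewrite -(gk y 0%R).
have h := ge0_integral_mix_merge mrho rho0 rho1 y 0%R
  (measurable_cst (1%R : R)) (fun=> ler01).
rewrite ge0_integralZl//.
- under eq_integral do rewrite -[X in X%:E]mul1r.
  rewrite -h; under eq_integral do rewrite mul1r.
  by rewrite integral_density// mule1.
- have mm : measurable_fun setT (fun z : 'rV[R]_#|~: u| => mergeV y z).
    by apply: measurable_mergeV => //; exact: measurable_id.
  by mfun.
- by move=> z _; rewrite lee_fin weight_prod_ge0.
Qed.

(** The integral of 1_A rho_(~u) over R^n is the measure of B, and rho is strictly positive, so A is
    null exactly when B is. *)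
Lemma ae_merge (A : set 'rV[R]_n) (B : set 'rV[R]_#|u|) : measurable A -> measurable B ->
  (forall y z, A (mergeV y z) <-> B y) ->
  {ae lamu, forall y, ~ B y} <-> {ae lam, forall x, ~ A x}.
Proof.
move=> mA mB AB.
have mA1 : measurable_fun setT (\1_A : 'rV[R]_n -> R) by exact: measurable_indic.
have mi : measurable_fun setT (fun x : 'rV[R]_n => (\1_A x * wp rho (~: u) x)%:E) by mfun.
have := @integral_merge_marginal \1_A \1_B mA1.
have r0 x : (0 < wp rho (~: u) x)%R.
  by apply: weight_prod_gt0 => j t; case: (hrho j).
move=> /(_ (fun=> ler0n _ _)) E.
have {}E : \int[lam]_x `|(\1_A x * wp rho (~: u) x)%:E| = \int[lamu]_y (\1_B y : R)%:E.
  under eq_integral do rewrite gee0_abs ?lee_fin ?mulr_ge0// ?ltW//.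
  apply: E => y z; rewrite !indicE; congr (_%:R)%R; congr nat_of_bool.
  by apply/idP/idP; rewrite !inE => /AB.
have {}E : \int[lam]_x `|(\1_A x * wp rho (~: u) x)%:E| = lamu B.
  by rewrite E integral_indic// setIT.
have hA := ae_eq_integral_abs lam measurableT mi.
split=> [[N [mN N0 BN]]|hnA].
- have B0 : lamu B = 0.
    apply/eqP; rewrite -measure_le0 -N0 le_measure ?inE//.
    by move=> y By; apply: BN => /=; apply.
  move: hA.1; rewrite E B0 => /(_ erefl); apply: filterS => x /(_ I) + Ax.
  rewrite indicE mem_set// mul1r => -[] /eqP; rewrite gt_eqF//.
- have B0 : lamu B = 0.
    rewrite -E; apply/hA; move: hnA; apply: filterS => x nA _.
    by rewrite indicE memNset// mul0r.
  exists B; split => // y /= nnB; exact: contrapT.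
Qed.

Variable p : 'rV[R]_n -> R.
Hypothesis mp : measurable_fun setT p.

Let slice (y : 'rV[R]_#|u|) (z : 'rV[R]_#|~: u|) : R :=
  (p (mergeV y z) * wp rho (~: u) (mergeV y z))%R.

Let mslice y : measurable_fun setT (slice y).
Proof.
have mm : measurable_fun setT (fun z : 'rV[R]_#|~: u| => mergeV y z).
  by apply: measurable_mergeV => //; exact: measurable_id.
by rewrite /slice; mfun.
Qed.

Let norm_slice y z : \int[lam]_t `|(p (mix u (mergeV y z) t) * wp rho ST t)%:E| =
  \int[lamc]_z `|(slice y z)%:E|.
Proof.
have mn : measurable_fun setT (fun x => `|p x|%R) by mfun.
have := ge0_integral_mix_merge mrho rho0 rho1 y z mn (fun=> normr_ge0 _).
have r0 v x : (`|wp rho v x|%R = wp rho v x) by rewrite ger0_norm// weight_prod_ge0.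
move=> h; transitivity (\int[lam]_t (`|p (mix u (mergeV y z) t)| * wp rho ST t)%:E).
  by apply: eq_integral => t _; rewrite -[in RHS]r0 -normrM.
by rewrite h; apply: eq_integral => t _; rewrite -[in LHS]r0 -normrM.
Qed.

(** The absolute integrals of the slice and of the function of t agree at merged points, so the sets
    where they are infinite correspond and are null together. This translates the third clause of
    [W_space] into a statement about [mix]. *)
Lemma ae_integrable_merge :
  {ae lamu, forall y, lamc.-integrable setT (EFin \o slice y)} <->
  {ae lam, forall x, lam.-integrable setT (fun t => (p (mix u x t) * wp rho ST t)%:E)}.
Proof.
pose a (x : 'rV[R]_n) := \int[lam]_t `|(p (mix u x t) * wp rho ST t)%:E|.
pose b y := \int[lamc]_z `|(slice y z)%:E|.
have ma : measurable_fun setT a.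
  apply: (@measurable_eintegral_param _ _ _ _ _ _ (fun q : 'rV[R]_n * 'rV[R]_n =>
    `|p (mix u q.1 q.2) * wp rho ST q.2|%R)) => //; mfun.
have mb : measurable_fun setT b.
  have mm : measurable_fun setT (fun q : 'rV[R]_#|u| * 'rV[R]_#|~: u| => mergeV q.1 q.2).
    by apply: measurable_mergeV; [exact: measurable_fst|exact: measurable_snd].
  apply: (@measurable_eintegral_param _ _ _ _ _ _
    (fun q : 'rV[R]_#|u| * 'rV[R]_#|~: u| => `|slice q.1 q.2|%R)) => //.
  by rewrite /slice; mfun.
have mS d (T : measurableType d) (h : T -> \bar R) : measurable_fun setT h ->
    measurable [set t | h t = +oo].
  move=> mh; rewrite (_ : [set t | _] = setT `&` h @^-1` [set +oo]).
    exact: mh.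
  by rewrite setTI.
have := @ae_merge [set x | a x = +oo] [set y | b y = +oo] (mS _ _ _ ma) (mS _ _ _ mb) _.
rewrite /= /a /b => /(_ _)[y z|h1 h2]; first by rewrite norm_slice.
have nyl (x : \bar R) : x <> +oo <-> x < +oo.
  by case: x => [r||]; rewrite ?ltry ?ltNyr ?ltxx; split.
split=> h.
- have /h1 : {ae lamu, forall y, b y <> +oo}.
    by move: h; apply: filterS => y /integrableP[_] /nyl.
  apply: filterS => x /nyl ax; apply/integrableP; split => //; mfun.
- have /h2 : {ae lam, forall x, a x <> +oo}.
    by move: h; apply: filterS => y /integrableP[_] /nyl.
  by apply: filterS => x /nyl ax; apply/integrableP; split => //; exact/measurable_EFinP.
Qed.

(** The positive and negative parts are treated separately, so the identity holds also where the
    integral diverges. *)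
Lemma anova_mean_merge y z :
  anova_mean rho u p (mergeV y z) = (\int[lamc]_z slice y z)%R.
Proof.
rewrite /anova_mean /Rintegral [in LHS]integralE [in RHS]integralE.
have r0 v x : (0 <= wp rho v x)%R by rewrite weight_prod_ge0.
pose pp x := Num.max (p x) 0%R; pose pn x := Num.max (- p x)%R 0%R.
have mpp : measurable_fun setT pp by apply: measurable_maxr.
have mpn : measurable_fun setT pn by apply: measurable_maxr => //; mfun.
have hp := ge0_integral_mix_merge mrho rho0 rho1 y z mpp _.
have hn := ge0_integral_mix_merge mrho rho0 rho1 y z mpn _.
congr (fine (_ - _)).
- transitivity (\int[lam]_t (pp (mix u (mergeV y z) t) * wp rho ST t)%:E).
    by apply: eq_integral => t _; rewrite funeposE /= -EFin_max maxr_pMl// mul0r.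
  rewrite hp => [|x]; last by rewrite /pp le_max lexx orbT.
  by apply: eq_integral => t _; rewrite funeposE /= -EFin_max maxr_pMl// mul0r.
- transitivity (\int[lam]_t (pn (mix u (mergeV y z) t) * wp rho ST t)%:E).
    by apply: eq_integral => t _; rewrite funenegE /= -EFin_max maxr_pMl// mul0r mulNr.
  rewrite hn => [|x]; last by rewrite /pn le_max lexx orbT.
  by apply: eq_integral => t _; rewrite funenegE /= -EFin_max maxr_pMl// mul0r mulNr.
Qed.

Lemma weighted_norm2_anova_mean (psi : 'I_n -> R -> R) :
  (forall j, positive_weight (psi j)) ->
  \int[lamu]_y (`|(\int[lamc]_z slice y z)%R| ^+ 2 * wp psi u (spreadV y))%:E =
  weighted_norm2 rho psi u (anova_mean rho u p).
Proof.
move=> hpsi.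
have mpsi j : measurable_fun setT (psi j) by exact: weight_measurable.
have psi0 j t : (0 <= psi j t)%R by apply/ltW/weight_gt0.
have mF := measurable_anova_mean hrho u mp.
rewrite -(@integral_merge_marginal (fun x => anova_mean rho u p x ^+ 2 * wp psi u x)%R).
- by apply: eq_integral => x _; rewrite mulrA.
- by mfun.
- by move=> x; rewrite mulr_ge0 ?sqr_ge0 ?weight_prod_ge0.
move=> y z; rewrite anova_mean_merge real_normK ?num_real//; congr (_ * _)%R.
by apply: eq_bigr => j ju; rewrite mergeV_in.
Qed.

End merge.

(** * The two inequalities and the equality of the spaces *)

Section comparison.
Context {R : realType} {d : nat}.
Variables (rho psi : 'I_d -> R -> R) (gamma : {set 'I_d} -> R).
Hypothesis hrho : forall j, positive_density (rho j).
Hypothesis hpsi : forall j, positive_weight (psi j).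
Hypothesis hgamma : forall u, 0 < gamma u.
Hypothesis hcond : forall j, embedding_condition (rho j) (psi j).
Local Notation lam := (lebesgueV d).
Local Notation wp := weight_prod.
Local Notation ST := [set: 'I_d]%SET.
Implicit Types (u v w : {set 'I_d}) (f g : 'rV[R]_d -> R).
Local Open Scope ereal_scope.

Let mrho j : measurable_fun setT (rho j). Proof. exact: density_measurable. Qed.
Let mpsi j : measurable_fun setT (psi j). Proof. exact: weight_measurable. Qed.

Let gammaV_ge0 u : 0 <= (gamma u)^-1%:E.
Proof. by rewrite lee_fin invr_ge0 ltW. Qed.

Lemma weak_derivativeP f u : has_weak_derivatives f ->
  is_weak_derivative u f (weak_derivative u f).
Proof. by move=> hf; exact: (xgetPex (cst 0%R) (hf u)). Qed.

Lemma measurable_weak_derivative f u : has_weak_derivatives f ->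
  measurable_fun setT (weak_derivative u f).
Proof. by move=> hf; have [[]] := weak_derivativeP u hf. Qed.

Lemma H_norm2E f : H_norm2 rho psi gamma f =
  \sum_(u : {set 'I_d}) (gamma u)^-1%:E * weighted_norm2 rho psi u (weak_derivative u f).
Proof.
apply: eq_bigr => u _; congr (_ * _); apply: eq_integral => x _.
by rewrite real_normK ?num_real// mulrA.
Qed.

Lemma W_norm2E f : has_weak_derivatives f -> W_norm2 rho psi gamma f =
  \sum_(u : {set 'I_d}) (gamma u)^-1%:E *
    weighted_norm2 rho psi u (anova_mean rho u (weak_derivative u f)).
Proof.
move=> hf; apply: eq_bigr => u _; congr (_ * _).
by rewrite -weighted_norm2_anova_mean//; exact: measurable_weak_derivative.
Qed.

(** Seen as the term for w = empty set, the mean inherits the bounds of the terms, with an empty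
    product of constants. *)
Lemma anova_meanE u g : anova_mean rho u g = anova_term rho u finset.set0 g.
Proof.
apply/funext => x; apply: eq_Rintegral => t _; rewrite /anova_integrand /kernelV/=.
by rewrite big_set0 mul1r finset.setC0.
Qed.

Lemma disjointV0 u : [disjoint u & (finset.set0 : {set 'I_d})]%B.
Proof. by apply: disjoint_subsetC; rewrite finset.sub0set. Qed.

Lemma weighted_norm2_anova_mean_le u g : measurable_fun setT g ->
  weighted_norm2 rho psi u (anova_mean rho u g) <= weighted_norm2 rho psi u g.
Proof.
move=> mg; rewrite anova_meanE.
have := integral_anova_term_sqr_le hrho hpsi hcond mg (disjointV0 u).
by rewrite big_set0 mul1e finset.setU0.
Qed.

Lemma W_norm2_le_H_norm2 f : has_weak_derivatives f ->
  W_norm2 rho psi gamma f <= H_norm2 rho psi gamma f.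
Proof.
move=> hf; rewrite H_norm2E W_norm2E//; apply: lee_sum => u _.
by rewrite lee_wpmul2l// weighted_norm2_anova_mean_le//; exact: measurable_weak_derivative.
Qed.

Lemma weighted_sum_lty (N : {set 'I_d} -> \bar R) u : (forall v, 0 <= N v) ->
  \sum_v (gamma v)^-1%:E * N v < +oo -> N u < +oo.
Proof.
move=> N0; rewrite (bigD1 u)//= => h.
have {h} : (gamma u)^-1%:E * N u < +oo.
  by apply: le_lt_trans h; rewrite leeDl// sume_ge0// => v _; rewrite mule_ge0.
have := N0 u; case: (N u) => [r _ _|_|//]; first exact: ltry.
by rewrite gt0_muley ?lte_fin ?invr_gt0.
Qed.

(** The case w = empty set of the pointwise Cauchy-Schwarz bound: the square of the absolute
    integral is at most [fiber_norm2], finite for almost every x. *)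
Lemma ae_integrable_slice u g : measurable_fun setT g ->
  weighted_norm2 rho psi u g < +oo ->
  {ae lam, forall x, lam.-integrable setT (fun y => (g (mix u x y) * wp rho ST y)%:E)}.
Proof.
move=> mg Ng.
have := fiber_norm2_lty hrho hpsi mg (disjointV0 u).
rewrite finset.setU0 => /(_ Ng); apply: filterS => x Sx.
apply/integrableP; split; first by mfun.
have := anova_abs_sqr_le hrho hpsi hcond u finset.set0 mg x.
rewrite (_ : kernel_norm2V rho psi finset.set0 x = 1%R) ?mule1; last exact: big_set0.
move=> /le_lt_trans/(_ Sx).
rewrite (_ : \int[lam]_y _ = anova_abs rho u finset.set0 g x).
  have := anova_abs_ge0 rho u finset.set0 g x.
  by case: (anova_abs _ _ _ _ _) => [r _ _| |//]; rewrite ?ltry.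
apply: eq_integral => y _; rewrite /anova_integrand/= /kernelV big_set0 mul1r.
by rewrite finset.setC0.
Qed.

Lemma H_space_sub_W_space : H_space rho psi gamma `<=` W_space rho psi gamma.
Proof.
move=> f [lf hf Hf]; split => //; last exact: le_lt_trans (W_norm2_le_H_norm2 hf) Hf.
move=> u; have mp := measurable_weak_derivative u hf.
apply: (ae_integrable_merge hrho u mp).2; apply: ae_integrable_slice => //.
move: Hf; rewrite H_norm2E; apply: weighted_sum_lty => v.
exact: weighted_norm2_ge0.
Qed.

Lemma H_norm2_le_W_norm2 f : W_space rho psi gamma f ->
  H_norm2 rho psi gamma f <= equivalence_const rho psi gamma * W_norm2 rho psi gamma f.
Proof.
move=> [lf hf Wi Wf]; pose p u := weak_derivative u f.
have mp u : measurable_fun setT (p u) by exact: measurable_weak_derivative.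
have N0 v g : 0 <= weighted_norm2 rho psi v g by exact: weighted_norm2_ge0.
have Np v : weighted_norm2 rho psi v (anova_mean rho v (p v)) < +oo.
  move: Wf; rewrite W_norm2E//.
  exact: (@weighted_sum_lty (fun v => weighted_norm2 rho psi v (anova_mean rho v (p v)))).
have ip v := (ae_integrable_merge hrho v (mp v)).1 (Wi v).
have pE := weak_derivative_anova_sum hrho hpsi hcond (fun v => weak_derivativeP v hf) ip Np.
rewrite H_norm2E W_norm2E//.
apply: le_trans (sum_norm2_le hrho hpsi hgamma
  (N := fun v => weighted_norm2 rho psi v (anova_mean rho v (p v))) _); last first.
  by move=> v; exact: N0.
apply: lee_sum => u _; rewrite lee_wpmul2l//.
have mS := measurable_anova_sum hrho (fun v => weak_derivativeP v hf) u.
rewrite (_ : weighted_norm2 _ _ _ _ = weighted_norm2 rho psi u (anova_sum rho p u)).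
  rewrite weighted_norm2_anova_sum//; last by move=> w; exact: measurable_anova_mean.
  apply: lee_sum => w wu; apply: (@weighted_norm2_anova_term_le _ _ _ _ hrho hpsi hcond u
    (fun w => anova_mean rho (u :|: w) (p (u :|: w)))) => // w'.
  exact: measurable_anova_mean.
apply: ae_eq_integral => //; [by have mpu := mp u; mfun|by mfun|].
by move: (pE u); apply: filterS => x; rewrite /p => ->.
Qed.

Lemma H_spaceE : H_space rho psi gamma = W_space rho psi gamma.
Proof.
apply/seteqP; split; first exact: H_space_sub_W_space.
move=> f Wf; have [lf hf Wi Wlt] := Wf; split => //.
apply: le_lt_trans (H_norm2_le_W_norm2 Wf) _.
rewrite lte_mul_pinfty// ?equivalence_const_lty//.
  exact: le_trans (equivalence_const_ge1 hrho hpsi hgamma).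
rewrite ge0_fin_numE ?equivalence_const_lty//.
exact: le_trans (equivalence_const_ge1 hrho hpsi hgamma).
Qed.

End comparison.

Theorem theorem14 (R : realType) (d : nat) (hd : (0 < d)%N)
  (rho psi : 'I_d -> R -> R) (gamma : {set 'I_d} -> R)
  (hrho : forall j, positive_density (rho j))
  (hpsi : forall j, positive_weight (psi j))
  (hgamma : forall u, 0 < gamma u)
  (hcond : forall j, embedding_condition (rho j) (psi j)) :
  [/\ H_space rho psi gamma = W_space rho psi gamma,
      (exists c C : R, [/\ 0 < c, 0 < C &
         forall f, H_space rho psi gamma f ->
           c * W_norm rho psi gamma f <= H_norm rho psi gamma f /\
           H_norm rho psi gamma f <= C * W_norm rho psi gamma f]) &
      forall f, H_space rho psi gamma f ->
        (W_norm2 rho psi gamma f <= H_norm2 rho psi gamma f)%E /\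
        (H_norm2 rho psi gamma f <=
           equivalence_const rho psi gamma * W_norm2 rho psi gamma f)%E].
Proof.
have HW := H_spaceE hrho hpsi hgamma hcond.
have bounds f : H_space rho psi gamma f ->
    (W_norm2 rho psi gamma f <= H_norm2 rho psi gamma f)%E /\
    (H_norm2 rho psi gamma f <=
      equivalence_const rho psi gamma * W_norm2 rho psi gamma f)%E.
  move=> Hf; split; first by case: Hf => _ hf _; exact: W_norm2_le_H_norm2.
  by apply: H_norm2_le_W_norm2 => //; rewrite -HW.
split => //; pose K := equivalence_const rho psi gamma.
have K1 : (1 <= K)%E by exact: equivalence_const_ge1.
have K0 : (0 <= K)%E by exact: le_trans K1.
have Kfin : K \is a fin_num by rewrite ge0_fin_numE ?equivalence_const_lty.
have fK1 : 1 <= fine K by rewrite -lee_fin fineK.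
(* The norms are square roots, hence the constants 1 and sqrt(K); K >= 1 makes the second
   positive. *)
exists 1, (Num.sqrt (fine K)); split => //.
  by rewrite sqrtr_gt0 (lt_le_trans ltr01).
move=> f Hf; have [WH HKW] := bounds f Hf; have [_ hf Hlt] := Hf.
have W0 : (0 <= W_norm2 rho psi gamma f)%E.
  rewrite W_norm2E//; apply: sume_ge0 => u _.
  by rewrite mule_ge0 ?weighted_norm2_ge0// lee_fin invr_ge0 ltW.
(* The norms pass through [fine], which sends +oo to 0, so the roots are compared only after both
   squared norms are known to be finite. *)
have Wfin : W_norm2 rho psi gamma f \is a fin_num.
  by rewrite ge0_fin_numE// (le_lt_trans WH).
have Hfin : H_norm2 rho psi gamma f \is a fin_num.
  by rewrite ge0_fin_numE// (le_trans W0).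
rewrite mul1r; split.
  by rewrite ler_sqrt ?fine_ge0 ?(le_trans W0)//; exact: fine_le.
rewrite -sqrtrM ?(le_trans ler01)// ler_sqrt ?mulr_ge0 ?fine_ge0//.
by rewrite -fineM//; apply: fine_le => //; rewrite fin_numM.
Qed.
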